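(* Let $\boldsymbol{k} = (k_1,\dots,k_m) \in \mathbb{Z}_+^m$ be a partition of $n$. For every $\lambda > -1$ and every $\boldsymbol{\kappa} \in \mathbb{N}^m$, the homomorphism of $C^*$-algebras \[ \pi_{\boldsymbol{\kappa}} : \mathcal{T}^{(\lambda)}(L^\infty(\mathbb{B}^n)^{\mathbb{T}^m}) \rightarrow \mathrm{End}(\mathcal{P}_{\boldsymbol{\kappa}}(\mathbb{C}^n)), \qquad T \mapsto T|_{\mathcal{P}_{\boldsymbol{\kappa}}(\mathbb{C}^n)}, \] defines an irreducible representation of $\mathcal{T}^{(\lambda)}(L^\infty(\mathbb{B}^n)^{\mathbb{T}^m})$. In particular, if $m < n$, i.e. $\boldsymbol{k} \neq (1,\dots,1)$, then $\mathcal{T}^{(\lambda)}(L^\infty(\mathbb{B}^n)^{\mathbb{T}^m})$ is not commutative.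
   Context: Here $\mathbb{N}=\{0,1,2,\dots\}$ and $\mathbb{Z}_+$ is the set of positive integers. $\mathbb{B}^n$ is the open unit ball of $\mathbb{C}^n$ with Lebesgue measure $v$. For $\lambda>-1$, $dv_\lambda(z) = c_\lambda (1-|z|^2)^\lambda dv(z)$ with $c_\lambda = \frac{\Gamma(n+\lambda+1)}{\pi^n\Gamma(\lambda+1)}$, and $\mathcal{A}^2_\lambda(\mathbb{B}^n)$ is the closed subspace of holomorphic functions in $L^2(\mathbb{B}^n,v_\lambda)$ (weighted Bergman space), with orthogonal projection $B_\lambda : L^2(\mathbb{B}^n,v_\lambda)\to \mathcal{A}^2_\lambda(\mathbb{B}^n)$. For $a\in L^\infty(\mathbb{B}^n)$ the Toeplitz operator is $T_a^{(\lambda)}(f)=B_\lambda(af)$ on $\mathcal{A}^2_\lambda(\mathbb{B}^n)$. A partition of $n$ is $\boldsymbol{k}=(k_1,\dots,k_m)\in\mathbb{Z}_+^m$ with $k_1+\dots+k_m=n$. It gives $\mathbb{C}^n=\mathbb{C}^{k_1}\times\dots\times\mathbb{C}^{k_m}$, and correspondingly $z=(z_{(1)},\dots,z_{(m)})$ and, for multi-indices, $\alpha=(\alpha_{(1)},\dots,\alpha_{(m)})\in\mathbb{N}^n$ with $\alpha_{(j)}\in\mathbb{N}^{k_j}$. $\mathbb{T}^m=\{(t_1I_{(1)},\dots,t_mI_{(m)}) : t_j\in\mathbb{T}\}$, where $I_{(j)}$ is the identity on $\mathbb{C}^{k_j}$, is regarded as a subgroup of the unitary group $\mathrm{U}(n)$.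 For a subgroup $H\subset \mathrm{U}(n)$, $L^\infty(\mathbb{B}^n)^H$ is the space of $a\in L^\infty(\mathbb{B}^n)$ with $a\circ A=a$ for all $A\in H$, and $\mathcal{T}^{(\lambda)}(L^\infty(\mathbb{B}^n)^H)$ is the $C^*$-algebra generated by the Toeplitz operators $T_a^{(\lambda)}$ with $a \in L^\infty(\mathbb{B}^n)^H$. For $\boldsymbol{\kappa}\in\mathbb{N}^m$, $\mathcal{P}_{\boldsymbol{\kappa}}(\mathbb{C}^n)$ is the linear span of the monomials $z^\alpha$ with $|\alpha_{(j)}|=\kappa_j$ for all $j=1,\dots,m$, considered as a subspace of $\mathcal{A}^2_\lambda(\mathbb{B}^n)$; operators in $\mathcal{T}^{(\lambda)}(L^\infty(\mathbb{B}^n)^{\mathbb{T}^m})$ leave $\mathcal{P}_{\boldsymbol{\kappa}}(\mathbb{C}^n)$ invariant, so $\pi_{\boldsymbol{\kappa}}$ is well defined. *)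

(* Defs.v *)
From HB Require Import structures.
From mathcomp Require Import all_boot all_order all_algebra.
From mathcomp Require Import all_classical all_reals all_analysis.
From mathcomp Require Import measurable_realfun complex ring.

Set Implicit Arguments.
Unset Strict Implicit.
Unset Printing Implicit Defensive.

Import Order.TTheory GRing.Theory Num.Theory.
Import numFieldNormedType.Exports.

Local Open Scope classical_set_scope.
Local Open Scope ring_scope.

Section operator_algebras.
Context (R : realType) (H : lmodType R[i]) (dot : H -> H -> R[i]).

Definition hnorm (x : H) : R := Num.sqrt (complex.Re (dot x x)).

Definition bounded_op (T : H -> H) : Prop :=
  linear T /\ exists M : R, forall x, hnorm (T x) <= M * hnorm x.

Definition is_adjoint (T S : H -> H) : Prop :=
  forall x y, dot (T x) y = dot x (S y).

(* Norm-closed *-subalgebras of the bounded operators on H.  A bounded S with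
   [is_adjoint T S] is the Hilbert space adjoint of T. *)
Record cstar_algebra (A : set (H -> H)) : Prop := CstarAlgebra {
  cstar_bounded : A `<=` bounded_op;
  cstar0 : A (fun=> 0);
  cstar_linear : forall (c : R[i]) T S,
    A T -> A S -> A (fun x => c *: T x + S x);
  cstar_comp : forall T S, A T -> A S -> A (T \o S);
  cstar_adjoint : forall T S, A T -> bounded_op S -> is_adjoint T S -> A S;
  cstar_norm_closed : forall T, bounded_op T ->
    (forall e : R, 0 < e -> exists2 S, A S &
       forall x, hnorm (T x - S x) <= e * hnorm x) -> A T }.

Definition cstar_generated (G : set (H -> H)) : set (H -> H) :=
  smallest cstar_algebra G.

End operator_algebras.

Section representations.
Context (R : realType) (H : lmodType R[i]) (dot : H -> H -> R[i]).
Context (V : lmodType R[i]) (dotV : V -> V -> R[i]).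
Variables (A : set (H -> H)) (pi : (H -> H) -> (V -> V)).

Record star_representation : Prop := StarRepresentation {
  repr_bounded : forall T, A T -> bounded_op dotV (pi T);
  repr_linear : forall (c : R[i]) T S, A T -> A S ->
    pi (fun x => c *: T x + S x) = (fun v => c *: pi T v + pi S v);
  repr_comp : forall T S, A T -> A S -> pi (T \o S) = pi T \o pi S;
  repr_adjoint : forall T S, A T -> A S ->
    is_adjoint dot T S -> is_adjoint dotV (pi T) (pi S) }.

(* Nonzero and without nontrivial invariant subspace.  W ranges over all linear
   subspaces, not only the closed ones; this makes no difference when V is
   finite-dimensional. *)
Definition irreducible_representation : Prop :=
  [/\ star_representation, (exists2 T, A T & exists v, pi T v <> 0) &
    forall W : set V,
      W 0 -> (forall (c : R[i]) u v, W u -> W v -> W (c *: u + v)) ->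
      (forall T v, A T -> W v -> W (pi T v)) ->
      W = [set 0] \/ W = [set: V]].

End representations.

(* The library provides these structures on abstract number fields only; with
   them [differentiable] over R[i] is complex differentiability. *)
HB.instance Definition _ (R : realType) := GRing.ComAlgebra.copy R[i] R[i]^o.
HB.instance Definition _ (R : realType) := Vector.copy R[i] R[i]^o.
HB.instance Definition _ (R : realType) := NormedModule.copy R[i] R[i]^o.

Section submodules.
Context (C : pzRingType) (E : lmodType C).

Record subsp (S : submodClosed E) := Subsp {
  subsp_val : E;
  subsp_valP : subsp_val \in S }.

HB.instance Definition _ S := [isSub for @subsp_val S].
HB.instance Definition _ S := [Choice of subsp S by <:].
HB.instance Definition _ S := [SubChoice_isSubLmodule of subsp S by <:].

Definition lspan (G : set E) : {pred E} :=
  [pred x | `[< exists (s : nat) (c : 'I_s -> C) (g : 'I_s -> E),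
    (forall i, G (g i)) /\ x = \sum_i c i *: g i >]].

Lemma lspan_submod_closed G : submod_closed (lspan G).
Proof.
split=> [|a x y /asboolP[s [c [g [Gg ->]]]] /asboolP[s' [c' [g' [Gg' ->]]]]].
  apply/asboolP; exists 0%N, (fun=> 0), (fun=> 0).
  by split=> [[]//|]; rewrite big_ord0.
apply/asboolP; exists (s + s')%N,
  (fun i => match fintype.split i with inl j => a * c j | inr j => c' j end),
  (fun i => match fintype.split i with inl j => g j | inr j => g' j end); split.
  by move=> i; case: splitP.
rewrite big_split_ord scaler_sumr /=; congr (_ + _); apply: eq_bigr => i _.
  by rewrite (unsplitK (inl i)) scalerA.
by rewrite (unsplitK (inr i)).
Qed.

HB.instance Definition _ G :=
  GRing.isSubmodClosed.Build C E (lspan G) (lspan_submod_closed G).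

End submodules.

Section product_measures.
Context d1 d2 (T1 : measurableType d1) (T2 : measurableType d2) (R : realType).
Variable m1 : {sigma_finite_measure set T1 -> \bar R}.
Variable m2 : {sigma_finite_measure set T2 -> \bar R}.

(* alias of the product measure, carrying a sigma-finite structure that can be
   inferred *)
Definition prod_measure : set (T1 * T2) -> \bar R := (m1 \x m2)%E.

HB.instance Definition _ := Measure.on prod_measure.

Lemma prod_measure_sigma_finite : sigma_finite setT prod_measure.
Proof.
have /sigma_finiteP[F [TF ndF Foo]] := sigma_finiteT m1.
have /sigma_finiteP[G [TG ndG Goo]] := sigma_finiteT m2.
exists (fun n => F n `*` G n) => [|k].
  rewrite -setXTT TF TG predeqE => -[x y]; split=> [[/= [n _ Fnx] [k _ Gky]]|].
    exists (maxn n k) => //; split=> /=.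
    - by move: x Fnx; exact/subsetPset/ndF/leq_maxl.
    - by move: y Gky; exact/subsetPset/ndG/leq_maxr.
  by move=> [n _ []/= ? ?]; split; exists n.
have [? ?] := Foo k; have [? ?] := Goo k.
split; first exact: measurableX.
by rewrite /prod_measure product_measure1E// lte_mul_pinfty// ge0_fin_numE.
Qed.

HB.instance Definition _ :=
  Measure_isSigmaFinite.Build _ _ _ prod_measure prod_measure_sigma_finite.

End product_measures.

Section power_measure.
Context d (T : measurableType d) (R : realType).

Definition tcons n (p : T * n.-tuple T) : n.+1.-tuple T :=
  [the n.+1.-tuple T of p.1 :: p.2].

Lemma measurable_tcons n : measurable_fun [set: T * n.-tuple T] (@tcons n).
Proof. exact: (measurable_cons measurable_fst measurable_snd). Qed.

Variable mu : {sigma_finite_measure set T -> \bar R}.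

Section cons_measure.
Context n (nu : {sigma_finite_measure set (n.-tuple T) -> \bar R}).

Definition cons_measure : set (n.+1.-tuple T) -> \bar R :=
  pushforward (prod_measure mu nu) (@tcons n).

Let cons_measure0 : cons_measure set0 = 0%E.
Proof. by rewrite /cons_measure /pushforward preimage_set0 measure0. Qed.

Let cons_measure_ge0 A : (0 <= cons_measure A)%E.
Proof. exact: (@measure_ge0 _ _ _ (prod_measure mu nu)). Qed.

Let cons_measure_sigma_additive : semi_sigma_additive cons_measure.
Proof.
move=> F mF tF mUF; rewrite /cons_measure /pushforward preimage_bigcup.
apply: (@measure_semi_sigma_additive _ _ _ (prod_measure mu nu)) => /=.
- by move=> k; rewrite -[X in measurable X]setTI; exact: measurable_tcons.
- apply/trivIsetP => /= i j _ _ ij; rewrite -preimage_setI.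
  by move/trivIsetP : tF => /(_ _ _ _ _ ij) ->//; rewrite preimage_set0.
- rewrite -preimage_bigcup -[X in measurable X]setTI.
  exact: measurable_tcons.
Qed.

HB.instance Definition _ := isMeasure.Build _ _ _ cons_measure
  cons_measure0 cons_measure_ge0 cons_measure_sigma_additive.

Let cons_measure_sigma_finite : sigma_finite setT cons_measure.
Proof.
have [F TF Foo] := sigma_finiteT (prod_measure mu nu).
pose uncons (t : n.+1.-tuple T) : T * n.-tuple T :=
  (thead t, [tuple of behead t]).
have unconsK t : uncons (tcons t) = t.
  by case: t => x t; congr pair; apply/val_inj.
have muncons : measurable_fun setT uncons.
  apply/measurable_fun_pairP; split; first exact: measurable_tnth.
  exact: measurable_behead.
exists (fun k => uncons @^-1` F k) => [|k].
  by rewrite -preimage_bigcup -TF preimage_setT.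
have [mF Fk] := Foo k; split.
  by rewrite -[X in measurable X]setTI; exact: muncons.
rewrite /cons_measure /pushforward -comp_preimage.
by rewrite (_ : uncons \o _ = id)//; apply/funext.
Qed.

HB.instance Definition _ :=
  Measure_isSigmaFinite.Build _ _ _ cons_measure cons_measure_sigma_finite.

End cons_measure.

Fixpoint power_measure n : {sigma_finite_measure set (n.-tuple T) -> \bar R} :=
  match n with
  | 0 => \d_([tuple] : 0.-tuple T)
  | n'.+1 => cons_measure (power_measure n')
  end.

End power_measure.

Section unit_ball.
Context (R : realType) (n : nat).
Local Notation C := R[i].
Local Notation Cn := 'cV[C]_n.

Definition sqabs (z : C) : R := complex.Re z ^+ 2 + complex.Im z ^+ 2.

Lemma sqabs_ge0 z : 0 <= sqabs z.
Proof. by rewrite addr_ge0// sqr_ge0. Qed.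

Lemma sqabs_lin c x y : sqabs (c * x + y) <= 2 * sqabs c * sqabs x + 2 * sqabs y.
Proof.
case: c x y => [c1 c2] [x1 x2] [y1 y2]; rewrite /sqabs /= -subr_ge0.
rewrite (_ : _ - _ =
  (c1 * x1 - c2 * x2 - y1) ^+ 2 + (c1 * x2 + c2 * x1 - y2) ^+ 2); last by ring.
by rewrite addr_ge0// sqr_ge0.
Qed.

Definition sqnorm (z : Cn) : R := \sum_i sqabs (z i 0).

Definition unit_ball : set Cn := [set z | sqnorm z < 1].

(* C^n is identified with (R * R)^n, which carries the product sigma-algebra;
   v is the product of 2n copies of the Lebesgue measure of R. *)
Local Notation R2n := (n.-tuple (measurableTypeR R * measurableTypeR R)%type).

Definition of_real_coords (t : R2n) : Cn :=
  \col_i ((tnth t i).1 +i* (tnth t i).2)%C.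

Definition vol : {sigma_finite_measure set R2n -> \bar R} :=
  power_measure (prod_measure (@lebesgue_measure R) (@lebesgue_measure R)) n.

Definition ball_coords : set R2n := of_real_coords @^-1` unit_ball.

Definition ball_measurable (f : Cn -> C) : Prop :=
  measurable_fun ball_coords (fun t => complex.Re (f (of_real_coords t))) /\
  measurable_fun ball_coords (fun t => complex.Im (f (of_real_coords t))).

Definition ae_ball (P : Cn -> Prop) : Prop :=
  {ae vol, forall t, ball_coords t -> P (of_real_coords t)}.

Definition Gamma (x : R) : R :=
  \int[@lebesgue_measure R]_(t in `]0, +oo[) (t `^ (x - 1) * expR (- t)).

Section weighted.
Variable lambda : R.

(* the density of v_lambda with respect to v *)
Definition weight (z : Cn) : R :=
  Gamma (n%:R + lambda + 1) / (pi ^+ n * Gamma (lambda + 1)) *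
  (1 - sqnorm z) `^ lambda.

Definition rint_ball (u : Cn -> R) : R :=
  \int[vol]_(t in ball_coords) (weight (of_real_coords t) * u (of_real_coords t)).

Definition cint_ball (f : Cn -> C) : C :=
  (rint_ball (fun z => complex.Re (f z)) +i*
   rint_ball (fun z => complex.Im (f z)))%C.

Definition L2 (f : Cn -> C) : Prop :=
  ball_measurable f /\
  (\int[vol]_(t in ball_coords)
     (weight (of_real_coords t) * sqabs (f (of_real_coords t)))%:E < +oo)%E.

Definition inner (f g : Cn -> C) : C := cint_ball (fun z => f z * (g z)^*%C).

End weighted.

Definition Linfty (a : Cn -> C) : Prop :=
  ball_measurable a /\ exists M : R, ae_ball (fun z => `|a z| <= M%:C%C).

Definition holomorphic (f : Cn -> C) : Prop :=
  forall z, unit_ball z -> differentiable f z.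

Lemma measurable_tnthR2 (i : 'I_n) :
  measurable_fun [set: R2n] (fun t => (tnth t i).1) /\
  measurable_fun [set: R2n] (fun t => (tnth t i).2).
Proof.
split.
  exact: (measurableT_comp measurable_fst (measurable_tnth i)).
exact: (measurableT_comp measurable_snd (measurable_tnth i)).
Qed.

Lemma measurable_sqnorm :
  measurable_fun [set: R2n] (fun t => sqnorm (of_real_coords t)).
Proof.
apply: measurable_sum => i; have [m1 m2] := measurable_tnthR2 i.
under eq_fun do rewrite /sqabs mxE /=.
by apply: measurable_funD; apply: measurable_funX.
Qed.

Lemma measurable_ball_coords : measurable ball_coords.
Proof.
rewrite (_ : ball_coords =
  setT `&` (fun t => sqnorm (of_real_coords t)) @^-1` `]-oo, 1[%classic).
  exact: measurable_sqnorm.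
by rewrite setTI; apply/seteqP; split=> t /=; rewrite in_itv.
Qed.

Lemma measurable_weight lambda :
  measurable_fun ball_coords (fun t => weight lambda (of_real_coords t)).
Proof.
apply: measurable_funM => //; apply: (measurableT_comp (measurable_powR _)).
apply: measurable_funB => //.
exact: measurable_funS measurable_sqnorm.
Qed.

Lemma weight_ge0 lambda z : 0 <= weight lambda z.
Proof.
have G0 x : 0 <= Gamma x.
  by apply: Rintegral_ge0 => t _; rewrite mulr_ge0// ?powR_ge0// expR_ge0.
by rewrite mulr_ge0 ?powR_ge0// divr_ge0// mulr_ge0// exprn_ge0// pi_ge0.
Qed.

Lemma L2_lin lambda (c : C) (f g : Cn -> C) :
  L2 lambda f -> L2 lambda g -> L2 lambda (c *: f + g).
Proof.
move=> [[mRf mIf] foo] [[mRg mIg] goo].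
set w := fun t : R2n => weight lambda (of_real_coords t).
have mw : measurable_fun ball_coords w := measurable_weight lambda.
have mwsq (h : Cn -> C) : ball_measurable h -> measurable_fun ball_coords
    (fun t => (w t * sqabs (h (of_real_coords t)))%:E).
  move=> [mR mI]; apply/measurable_EFinP; apply: measurable_funM => //.
  by apply: measurable_funD; exact: measurable_funX.
have ge0 k (h : Cn -> C) : 0 <= k ->
    forall t, (0 <= (k * (w t * sqabs (h (of_real_coords t))))%:E)%E.
  move=> k0 t; rewrite lee_fin mulr_ge0// mulr_ge0 ?sqabs_ge0//.
  exact: weight_ge0.
have mcfg : ball_measurable (c *: f + g).
  split.
    rewrite [X in measurable_fun _ X](_ : _ = (fun t =>
        complex.Re c * complex.Re (f (of_real_coords t)) -
        complex.Im c * complex.Im (f (of_real_coords t)) +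
        complex.Re (g (of_real_coords t)))); last first.
      apply/funext => t; rewrite [_ (of_real_coords t)]/=.
      by rewrite /GRing.scale /GRing.add /=; case: c (f _) (g _) =>
        [? ?] [? ?] [? ?].
    by apply: measurable_funD => //; apply: measurable_funB;
      apply: measurable_funM.
  rewrite [X in measurable_fun _ X](_ : _ = (fun t =>
      complex.Re c * complex.Im (f (of_real_coords t)) +
      complex.Im c * complex.Re (f (of_real_coords t)) +
      complex.Im (g (of_real_coords t)))); last first.
    apply/funext => t; rewrite [_ (of_real_coords t)]/=.
    by rewrite /GRing.scale /GRing.add /=; case: c (f _) (g _) =>
      [? ?] [? ?] [? ?].
  by apply: measurable_funD => //; apply: measurable_funD;
    apply: measurable_funM.
split=> //.
pose k : R := 2 * sqabs c.
have k0 : 0 <= k by rewrite mulr_ge0// sqabs_ge0.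
have mB := measurable_ball_coords.
apply: (@le_lt_trans _ _ (\int[vol]_(t in ball_coords)
    (k%:E * (w t * sqabs (f (of_real_coords t)))%:E +
     2%:E * (w t * sqabs (g (of_real_coords t)))%:E))%E).
  apply: ge0_le_integral => //.
  - by move=> t _; have := ge0 1 (c *: f + g) ler01 t; rewrite mul1r.
  - exact: mwsq.
  - by apply: emeasurable_funD; apply: emeasurable_funM => //; exact: mwsq.
  - move=> t _; rewrite -!EFinM -EFinD lee_fin.
    rewrite (mulrCA k) (mulrCA 2) -mulrDr ler_wpM2l ?weight_ge0//.
    exact: sqabs_lin.
rewrite ge0_integralD//; last 4 first.
- by move=> t _; rewrite -EFinM; exact: ge0.
- by apply: emeasurable_funM => //; exact: mwsq.
- by move=> t _; rewrite -EFinM; exact: ge0.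
- by apply: emeasurable_funM => //; exact: mwsq.
have ge01 h : forall t, ball_coords t ->
    (0 <= (w t * sqabs (h (of_real_coords t)))%:E)%E.
  by move=> t _; have := ge0 1 h ler01 t; rewrite mul1r.
rewrite !ge0_integralZl ?lee_fin//; try exact: mwsq; try exact: ge01.
by rewrite lte_add_pinfty// lte_mul_pinfty// ?lee_fin.
Qed.

Definition bergman_pred (lambda : R) : {pred (Cn -> C)} :=
  [pred f | `[< [/\ L2 lambda f, holomorphic f
                  & forall z, ~ unit_ball z -> f z = 0] >]].

Lemma bergman_submod_closed lambda : submod_closed (bergman_pred lambda).
Proof.
split=> [|c f g /asboolP[Lf hf f0] /asboolP[Lg hg g0]]; apply/asboolP; split.
- split; first by split; apply: measurable_cst.
  rewrite integral0_eq ?ltry// => t _.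
  by rewrite /sqabs /= expr0n addr0 mulr0.
- by move=> z _; exact: differentiable_cst.
- by [].
- exact: L2_lin.
- move=> z Bz; apply: differentiableD; last exact: hg.
  by apply: differentiableZ; exact: hf.
- move=> z Bz; transitivity (c *: f z + g z) => //.
  by rewrite f0// g0// scaler0 addr0.
Qed.

HB.instance Definition _ lambda :=
  GRing.isSubmodClosed.Build C (Cn -> C) (bergman_pred lambda)
    (bergman_submod_closed lambda).

(* The weighted Bergman space.  Its elements are extended by 0 outside of the
   ball, so that equality in [bergman lambda] is equality of functions on the
   ball. *)
Definition bergman (lambda : R) : Type := subsp (bergman_pred lambda).

HB.instance Definition _ lambda := GRing.Lmodule.on (bergman lambda).

End unit_ball.

Definition bergman_fun (R : realType) n (lambda : R) (f : bergman n lambda) :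
  'cV[R[i]]_n -> R[i] := subsp_val f.
Coercion bergman_fun : bergman >-> Funclass.

Section toeplitz.
Context (R : realType) (n : nat) (lambda : R).
Local Notation C := R[i].
Local Notation Cn := 'cV[C]_n.
Local Notation A2 := (bergman n lambda).

Definition bergman_inner (f g : A2) : C := inner lambda f g.

(* the graph of the orthogonal projection of L^2 onto the Bergman space:
   f is the projection of g *)
Definition bergman_projects (g : Cn -> C) (f : A2) : Prop :=
  forall h : A2, inner lambda (g - (f : Cn -> C)) h = 0.

Definition is_toeplitz (a : Cn -> C) (T : A2 -> A2) : Prop :=
  forall f : A2, bergman_projects (fun z => a z * f z) (T f).

Definition invariant_symbol (G : set 'M[C]_n) (a : Cn -> C) : Prop :=
  Linfty a /\ forall A, G A -> ae_ball (fun z => a (A *m z) = a z).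

Definition toeplitz_algebra (G : set 'M[C]_n) : set (A2 -> A2) :=
  cstar_generated bergman_inner
    [set T | exists2 a, invariant_symbol G a & is_toeplitz a T].

End toeplitz.

Arguments bergman_inner {R n} lambda f g.
Arguments toeplitz_algebra {R n} lambda G.

Section partition.
Context (R : realType) (m : nat) (k : 'I_m -> nat).
Local Notation C := R[i].
Local Notation n := (\sum_j k j)%N.

Definition block_torus : set 'M[C]_n :=
  [set \mxdiag_j (t j)%:M | t in [set t : 'I_m -> C | forall j, `|t j| = 1]].

Definition monomial (alpha : 'cV[nat]_n) (z : 'cV[C]_n) : C :=
  \prod_i z i 0 ^+ alpha i 0.

Definition block_degree (alpha : 'cV[nat]_n) (j : 'I_m) : nat :=
  (\sum_i submxcol alpha j i 0%R)%N.

Section homogeneous.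
Context (lambda : R) (kappa : 'I_m -> nat).

Definition block_monomials : set (bergman n lambda) :=
  [set f | exists2 alpha, (forall j, block_degree alpha j = kappa j) &
    forall z, unit_ball z -> f z = monomial alpha z].

Definition homog_poly : Type := subsp (lspan block_monomials).

Definition homog_bergman (p : homog_poly) : bergman n lambda := subsp_val p.
Coercion homog_bergman : homog_poly >-> bergman.

HB.instance Definition _ := GRing.Lmodule.on homog_poly.

Definition homog_inner (p q : homog_poly) : C :=
  bergman_inner lambda p q.

(* T |-> T restricted to [homog_poly]; [insubd] takes a default value if T p is
   outside, which does not happen for T in the Toeplitz algebra. *)
Definition restrict_homog (T : bergman n lambda -> bergman n lambda)
    (p : homog_poly) : homog_poly :=
  insubd p (T p).

End homogeneous.
End partition.

Arguments homog_inner {R m} k lambda kappa p q.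
Arguments restrict_homog {R m} k lambda kappa T p.
Arguments block_torus R {m} k _.

(* Main.v *)
(* The operators leaving both P_kappa and its orthogonal complement invariant form
   a C*-algebra.  It contains T_a for each T^m-invariant a: for p in P_kappa the
   function a p has the same T^m-weight as p, so that its projection is orthogonal
   to the monomials of other multidegrees, and the monomials are total.

   Irreducibility: let w <> 0 lie in an invariant subspace W of P_kappa.  For q in
   P_kappa the symbol conj(w) q is T^m-invariant, and
   <T_{conj(w) q} w, q> = int |w q|^2 vanishes only for q = 0.  Hence
   q |-> T_{conj(w) q} w is an injective endomorphism of the finite-dimensional
   space P_kappa with values in W, and W = P_kappa.

   Noncommutativity: if p and q are two coordinates of one block, S = T_{conj(p) q}
   and S' = T_{conj(q) p}, then S' p = 0 by weights under rotations of q, whereas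
   <S' S p, p> = |S p|^2 and <S p, q> = int |p q|^2 > 0.

   The analysis rests on averages over the 2^N-th roots of unity.  They extract
   Taylor coefficients pointwise by Cauchy's formula and are orthogonal projections
   in L^2(v_lambda); this gives the sub-mean value inequality, hence bounded point
   evaluations and completeness, and the isotypic components used for totality. *)
Require Import Defs.
From HB Require Import structures.
From mathcomp Require Import all_boot all_order all_algebra.
From mathcomp Require Import all_classical all_reals all_analysis.
From mathcomp Require Import measurable_realfun complex ring lra.
Import Order.TTheory GRing.Theory Num.Theory.
Import numFieldNormedType.Exports.
Set Implicit Arguments.
Unset Strict Implicit.
Unset Printing Implicit Defensive.
Local Open Scope classical_set_scope.
Local Open Scope ring_scope.

(** * Functions of one complex variable *)

(** Two obstacles shape the analysis. First, [differentiable] over [R[i]] says nothing about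
    continuity of the derivative, so Cauchy's formula has to come from Goursat's argument. It is run
    in the parameters (s, t) of the contraction of a circle to the point z: there dw / (w - z)
    becomes ds / s + kappa dt, and its integrals against affine functions of w are explicit. Second,
    membership in [bergman lambda] demands holomorphy of every limit that is formed. Taylor's
    formula on complex lines bounds the error of the differential by a quadratic term depending only
    on a bound of the function, and such an estimate survives pointwise limits.

    The hypothesis -1 < lambda acts in two places: in the integrability of the weight, by a dyadic
    estimate against the volume of thin shells, which puts the monomials into the space; and in the
    positivity of the Gamma factors, without which the weight could vanish and the inner product
    degenerate. *)

Notation normc := ComplexField.Normc.normc.

Section modulus.
Context (R : realType).
Implicit Types x y z : R[i].

Lemma complex_ext x y : complex.Re x = complex.Re y ->
  complex.Im x = complex.Im y -> x = y.
Proof. by case: x y => [? ?] [? ?] /= -> ->. Qed.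

Lemma normc_norm z : `|z| = (normc z)%:C%C.
Proof. by rewrite normc_def; case: z. Qed.

Lemma normcD x y : normc (x + y) <= normc x + normc y.
Proof. exact: le_normcD. Qed.

Lemma normcM x y : normc (x * y) = normc x * normc y.
Proof. exact: ComplexField.Normc.normcM. Qed.

Lemma normc_ge0 z : 0 <= normc z.
Proof. by case: z => a b; exact: sqrtr_ge0. Qed.

Lemma normcNE z : normc (- z) = normc z.
Proof. exact: (@normcN R z). Qed.

Lemma normcB x y : normc (x - y) <= normc x + normc y.
Proof. by rewrite -(normcNE y) normcD. Qed.

Lemma ler_dist_normc x y : `|normc x - normc y| <= normc (x - y).
Proof.
have H (u v : R[i]) : normc u - normc v <= normc (u - v).
  by rewrite lerBlDr; apply: le_trans (normcD _ _); rewrite subrK.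
by rewrite ler_norml H lerNl opprB -(normcNE (x - y)) opprB H.
Qed.

Lemma normc_distC x y : normc (x - y) = normc (y - x).
Proof. by rewrite -normcNE opprB. Qed.

Lemma normc_eq0 z : (normc z == 0) = (z == 0).
Proof.
apply/eqP/eqP => [/ComplexField.Normc.eq0_normc//|->].
exact: ComplexField.Normc.normc0.
Qed.

Lemma normc_gt0 z : (0 < normc z) = (z != 0).
Proof. by rewrite lt0r normc_eq0 normc_ge0 andbT. Qed.

Lemma normcX z k : normc (z ^+ k) = normc z ^+ k.
Proof.
elim: k => [|k IH]; first exact: ComplexField.Normc.normc1.
by rewrite !exprS normcM IH.
Qed.

Lemma normcVE z : normc z^-1 = (normc z)^-1.
Proof. exact: ComplexField.Normc.normcV. Qed.

Lemma normc_real (a : R) : normc a%:C%C = `|a|.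
Proof. by rewrite /normc /= expr0n addr0 sqrtr_sqr. Qed.

Lemma normcJE z : normc z^*%C = normc z.
Proof. by case: z => a b; rewrite /normc /= sqrrN. Qed.

Lemma normc_sum I (r : seq I) (P : pred I) (F : I -> R[i]) :
  normc (\sum_(i <- r | P i) F i) <= \sum_(i <- r | P i) normc (F i).
Proof.
elim/big_rec2: _ => [|i u v _ uv]; first by rewrite ComplexField.Normc.normc0.
by rewrite (le_trans (normcD _ _))// lerD2l.
Qed.

Lemma normr_Re z : `|complex.Re z| <= normc z.
Proof. by have := normc_ge_Re z; rewrite normc_norm lecR. Qed.

Lemma normr_Im z : `|complex.Im z| <= normc z.
Proof.
by case: z => a b; rewrite /normc /= -sqrtr_sqr ler_wsqrtr// lerDr sqr_ge0.
Qed.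

Lemma normc_le_ReIm z : normc z <= `|complex.Re z| + `|complex.Im z|.
Proof.
case: z => a b /=; rewrite -[leRHS]ger0_norm; last by rewrite addr_ge0.
rewrite -sqrtr_sqr ler_wsqrtr// sqrrD !real_normK ?num_real//.
by rewrite -addrA lerD2l lerDr mulrn_wge0// mulr_ge0.
Qed.

Lemma sqabsE z : sqabs z = normc z ^+ 2.
Proof. by case: z => a b; rewrite /sqabs /= sqr_sqrtr// addr_ge0 ?sqr_ge0. Qed.

Lemma sqabsM x y : sqabs (x * y) = sqabs x * sqabs y.
Proof. by rewrite !sqabsE normcM exprMn. Qed.

Lemma mulcJ z : z * z^*%C = (sqabs z)%:C%C.
Proof.
by case: z => a b; apply/eqP; rewrite eq_complex /sqabs /=;
  apply/andP; split; apply/eqP; ring.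
Qed.

End modulus.

(** * Integrals of complex functions over an interval *)

Section complex_integral.
Context (R : realType).
Local Notation C := R[i].
Local Notation mu := (@lebesgue_measure R).
Implicit Types (f g : R -> C) (a b : R).

Lemma cvg_Re (T : Type) (F : set_system T) (FF : Filter F) (f : T -> C) (l : C) :
  f @ F --> l -> complex.Re (f x) @[x --> F] --> complex.Re l.
Proof.
move=> fl; apply/cvgrPdist_lt => e e0.
have /(@cvgrPdist_lt _ C) := fl; move=> /(_ e%:C%C).
rewrite ltcR => /(_ e0); apply: filterS => x.
rewrite normc_norm ltcR; apply: le_lt_trans.
by rewrite -raddfB normr_Re.
Qed.

Lemma cvg_Im (T : Type) (F : set_system T) (FF : Filter F) (f : T -> C) (l : C) :
  f @ F --> l -> complex.Im (f x) @[x --> F] --> complex.Im l.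
Proof.
move=> fl; apply/cvgrPdist_lt => e e0.
have /(@cvgrPdist_lt _ C) := fl; move=> /(_ e%:C%C).
rewrite ltcR => /(_ e0); apply: filterS => x.
rewrite normc_norm ltcR; apply: le_lt_trans.
by rewrite -raddfB normr_Im.
Qed.

(** A positive element of [R[i]] is real, so the radii of the topology of [R[i]] are exactly the
    [e%:C] with e > 0; all later estimates can be made in R. *)
Lemma cvg_complexP (T : Type) (F : set_system T) (FF : Filter F) (f : T -> C) (l : C) :
  (forall e : R, 0 < e -> \forall x \near F, normc (f x - l) < e) <-> f @ F --> l.
Proof.
split=> [H|/(@cvgrPdist_lt _ C) H e e0].
  apply/(@cvgrPdist_lt _ C) => e e0.
  have er : e = (complex.Re e)%:C%C by rewrite RRe_real// gtr0_real.
  have := H (complex.Re e); rewrite -ltcR -er => /(_ e0).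
  apply: filterS => x.
  by rewrite normc_norm {2}er ltcR normc_distC.
have := H e%:C%C; rewrite ltcR => /(_ e0); apply: filterS => x.
by rewrite normc_norm ltcR normc_distC.
Qed.

Lemma cvg_Complex (T : Type) (F : set_system T) (FF : Filter F) (u v : T -> R) (l m : R) :
  u @ F --> l -> v @ F --> m -> (u x +i* v x)%C @[x --> F] --> (l +i* m)%C.
Proof.
move=> /cvgrPdist_lt ul /cvgrPdist_lt vm; apply/cvg_complexP => e e0.
have e20 : 0 < e / 2 by rewrite divr_gt0.
apply: filterS2 (ul _ e20) (vm _ e20) => x h1 h2.
rewrite (le_lt_trans (normc_le_ReIm _))// [ltRHS]splitr /=.
by rewrite ltrD// -normrN opprB.
Qed.

Definition cint f a b : C :=
  ((\int[mu]_(x in `[a, b]) complex.Re (f x)) +i*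
   (\int[mu]_(x in `[a, b]) complex.Im (f x)))%C.

(** Two-sided continuity at every point, endpoints included: stronger than continuity of the
    restriction, and it passes to subintervals and through compositions without subspace
    topologies. *)
Definition ccont f a b := forall x, a <= x <= b -> f @ x --> f x.

Lemma continuous_itv_integrable (h : R -> R) a b :
  (forall x, a <= x <= b -> h @ x --> h x) ->
  mu.-integrable `[a, b] (EFin \o h).
Proof.
move=> ch; have ch' : {within `[a, b], continuous h}.
  by apply: continuous_in_subspaceT => x; rewrite inE/= in_itv/= => /ch.
exact: (continuous_compact_integrable (@segment_compact _ a b) ch').
Qed.

Lemma ccont_integrable f a b : ccont f a b ->
  mu.-integrable `[a, b] (EFin \o (fun x => complex.Re (f x))) /\
  mu.-integrable `[a, b] (EFin \o (fun x => complex.Im (f x))).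
Proof.
by move=> cf; split; apply: continuous_itv_integrable => x /cf;
  [exact: cvg_Re|exact: cvg_Im].
Qed.

Lemma eq_cint g f a b : (forall x, a <= x <= b -> f x = g x) ->
  cint f a b = cint g a b.
Proof.
by move=> fg; congr Complex; apply: eq_Rintegral => x;
  rewrite inE/= in_itv/= => /fg ->.
Qed.

Lemma cintD f g a b : ccont f a b -> ccont g a b ->
  cint (fun x => f x + g x) a b = cint f a b + cint g a b.
Proof.
move=> /ccont_integrable[fR fI] /ccont_integrable[gR gI].
apply: complex_ext => /=.
  by rewrite -RintegralD//; apply: eq_Rintegral => x _; rewrite raddfD.
by rewrite -RintegralD//; apply: eq_Rintegral => x _; rewrite raddfD.
Qed.

Lemma cintZ c f a b : ccont f a b ->
  cint (fun x => c * f x) a b = c * cint f a b.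
Proof.
case: c => c d /ccont_integrable[fR fI].
have iZ (k : R) (h : R -> R) : mu.-integrable `[a, b] (EFin \o h) ->
    mu.-integrable `[a, b] (EFin \o (fun x => k * h x)).
  move=> ih; rewrite (_ : _ \o _ = fun x => (k%:E * (h x)%:E)%E); last exact/funext.
  exact: integrableZl.
apply: complex_ext => /=.
  rewrite -!RintegralZl// -RintegralB//; try exact: iZ.
  by apply: eq_Rintegral => x _; case: (f x).
rewrite -!RintegralZl// -RintegralD//; try exact: iZ.
by apply: eq_Rintegral => x _; case: (f x).
Qed.

Lemma cint_split f a b c : a <= c <= b -> ccont f a b ->
  cint f a b = cint f a c + cint f c b.
Proof.
move=> /andP[ac cb] cf.
have [fR fI] := ccont_integrable cf.
have H (h : R -> R) : mu.-integrable `[a, b] (EFin \o h) ->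
  \int[mu]_(x in `[a, b]) h x =
  \int[mu]_(x in `[a, c]) h x + \int[mu]_(x in `[c, b]) h x.
  move=> ih.
  have /eqP := @Rintegral_itvB _ h (BLeft a) (BRight b) c ih ac cb.
  rewrite subr_eq addrC => /eqP ->; congr (_ + _).
  rewrite Rintegral_itv_obnd_cbnd//.
  by apply: integrableS ih => //; apply: subset_itvScc.
by apply: complex_ext; rewrite /= H.
Qed.

Lemma Rintegral_itv_cst (r : R) a b : a <= b ->
  \int[mu]_(x in `[a, b]) r = r * (b - a).
Proof.
move=> ab; rewrite Rintegral_cst//= lebesgue_measure_itv/= lte_fin.
have [//|ba] := ltP a b; have -> : a = b by apply/eqP; rewrite eq_le ab.
by rewrite subrr.
Qed.

(** The factor 2 comes from estimating the real and the imaginary part separately; it reappears in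
    all constants of the Cauchy estimates below. *)
Lemma cint_le f a b M : a <= b -> ccont f a b ->
  (forall x, a <= x <= b -> normc (f x) <= M) ->
  normc (cint f a b) <= 2 * M * (b - a).
Proof.
move=> ab cf fM; have [fR fI] := ccont_integrable cf.
have H (h : R -> R) : mu.-integrable `[a, b] (EFin \o h) ->
    (forall x, a <= x <= b -> `|h x| <= M) ->
    `|\int[mu]_(x in `[a, b]) h x| <= M * (b - a).
  move=> ih hM; apply: (le_trans (le_normr_Rintegral _ ih)); first by [].
  rewrite -Rintegral_itv_cst//; apply: le_Rintegral; first by [].
  - exact: (integrable_norm ih).
  - by apply: continuous_itv_integrable => x _; exact: cvg_cst.
  - by move=> x; rewrite /= in_itv/= => /hM.
rewrite (le_trans (normc_le_ReIm _))//= mulr_natl mulr2n mulrDl lerD//.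
  by apply: H => // x /fM; apply: le_trans; rewrite normr_Re.
by apply: H => // x /fM; apply: le_trans; rewrite normr_Im.
Qed.

Lemma cint_cst c a b : a <= b -> cint (fun=> c) a b = c * (b - a)%:C%C.
Proof.
move=> ab; rewrite /cint !Rintegral_itv_cst//.
by case: c => c d; apply: complex_ext => /=; ring.
Qed.

Lemma ccontD f g a b : ccont f a b -> ccont g a b ->
  ccont (fun x => f x + g x) a b.
Proof. by move=> cf cg x xab; apply: (@cvgD _ C); [exact: cf|exact: cg]. Qed.

Lemma ccontM f g a b : ccont f a b -> ccont g a b ->
  ccont (fun x => f x * g x) a b.
Proof. by move=> cf cg x xab; apply: (@cvgM C); [exact: cf|exact: cg]. Qed.

Lemma ccont_cst c a b : ccont (fun=> c) a b.
Proof. by move=> x _; exact: cvg_cst. Qed.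

Lemma ccontV f a b : ccont f a b -> (forall x, a <= x <= b -> f x != 0) ->
  ccont (fun x => (f x)^-1) a b.
Proof. by move=> cf f0 x xab; apply: (@cvgV C); [exact: f0|exact: cf]. Qed.

Lemma ccontX f k a b : ccont f a b -> ccont (fun x => f x ^+ k) a b.
Proof.
move=> cf; elim: k => [|k IH]; first exact: ccont_cst.
by under [X in ccont X]eq_fun do rewrite exprS; apply: ccontM.
Qed.

Lemma ccont_sum n (f : 'I_n -> R -> C) a b : (forall i, ccont (f i) a b) ->
  ccont (fun x => \sum_i f i x) a b.
Proof.
elim: n f => [|n IH] f cf.
  by under [X in ccont X]eq_fun do rewrite big_ord0; exact: ccont_cst.
under [X in ccont X]eq_fun do rewrite big_ord_recl.
by apply: ccontD => //; apply: IH => i; exact: cf.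
Qed.

Lemma cint_sum n (f : 'I_n -> R -> C) a b : (forall i, ccont (f i) a b) ->
  cint (fun x => \sum_i f i x) a b = \sum_i cint (f i) a b.
Proof.
elim: n f => [|n IH] f cf.
  under [X in cint X]eq_fun do rewrite big_ord0.
  rewrite big_ord0; transitivity (cint (fun=> 0 * 0) a b).
    by under [RHS]eq_cint do rewrite mul0r.
  by rewrite cintZ ?mul0r//; exact: ccont_cst.
under [X in cint X]eq_fun do rewrite big_ord_recl.
rewrite big_ord_recl cintD//; first by rewrite IH.
by apply: ccont_sum.
Qed.

End complex_integral.

Section bisection.
Context (R : realType).

(* Goursat's bisection argument, abstracted from line integrals. *)
Lemma additive_rectangle_eq0 (F : R -> R -> R -> R -> R[i]) (A B C D : R) :
  A <= B -> C <= D ->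
  (forall a m b c d, A <= a -> a <= m -> m <= b -> b <= B ->
    C <= c -> c <= d -> d <= D -> F a b c d = F a m c d + F m b c d) ->
  (forall a b c m d, A <= a -> a <= b -> b <= B ->
    C <= c -> c <= m -> m <= d -> d <= D -> F a b c d = F a b c m + F a b m d) ->
  (forall x y e : R, A <= x <= B -> C <= y <= D -> 0 < e -> exists2 s : R, 0 < s &
    forall a b c d, A <= a -> a <= x -> x <= b -> b <= B ->
      C <= c -> c <= y -> y <= d -> d <= D -> b - a < s -> d - c < s ->
      normc (F a b c d) <= e * ((b - a) + (d - c)) ^+ 2) ->
  F A B C D = 0.
Proof.
move=> AB CD Fx Fy Floc.
pose ok (q : R * R * (R * R)) := [/\ A <= q.1.1, q.1.1 <= q.1.2, q.1.2 <= B &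
  [/\ C <= q.2.1, q.2.1 <= q.2.2 & q.2.2 <= D]].
pose FF (q : R * R * (R * R)) := normc (F q.1.1 q.1.2 q.2.1 q.2.2) : R.
pose nxt (q q' : R * R * (R * R)) := [/\ ok q',
  q.1.1 <= q'.1.1, q'.1.2 <= q.1.2, q.2.1 <= q'.2.1 &
  [/\ q'.2.2 <= q.2.2, q'.1.2 - q'.1.1 = (q.1.2 - q.1.1) / 2,
   q'.2.2 - q'.2.1 = (q.2.2 - q.2.1) / 2 & FF q <= 4 * FF q']].
(* The implication sits under the existential so that [choice] yields a total map. If every quarter
   carried less than a quarter of the modulus, the four could not add up to F on the whole
   rectangle. *)
have step q : exists q', ok q -> nxt q q'.
  have [okq|nok] := pselect (ok q); last by exists q.
  move: okq; case: q => -[a b] [c d]; rewrite /ok /= => -[Aa ab bB [Cc cd dD]].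
  pose x := (a + b) / 2; pose y := (c + d) / 2.
  have [ax xb] : a <= x /\ x <= b by rewrite /x; split; lra.
  have [cy yd] : c <= y /\ y <= d by rewrite /y; split; lra.
  have Fs : F a b c d = F a x c y + F a x y d + (F x b c y + F x b y d).
    rewrite (Fx a x b)// (Fy a x c y d)// ?(Fy x b c y d)//.
    - exact: le_trans ax.
    - exact: le_trans bB.
  have Fn : normc (F a b c d) <= normc (F a x c y) + normc (F a x y d) +
      (normc (F x b c y) + normc (F x b y d)).
    by rewrite Fs (le_trans (normcD _ _))// lerD// normcD.
  have Ax : A <= x by exact: le_trans ax.
  have xB : x <= B by exact: le_trans bB.
  have Cy : C <= y by exact: le_trans cy.
  have yD : y <= D by exact: le_trans dD.
  have [h|h1] := leP (normc (F a b c d)) (4 * normc (F a x c y)).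
    by exists ((a, x), (c, y)) => _; split => //=; split => //; rewrite /x /y; lra.
  have [h|h2] := leP (normc (F a b c d)) (4 * normc (F a x y d)).
    by exists ((a, x), (y, d)) => _; split => //=; split => //; rewrite /x /y; lra.
  have [h|h3] := leP (normc (F a b c d)) (4 * normc (F x b c y)).
    by exists ((x, b), (c, y)) => _; split => //=; split => //; rewrite /x /y; lra.
  have [h|h4] := leP (normc (F a b c d)) (4 * normc (F x b y d)).
    by exists ((x, b), (y, d)) => _; split => //=; split => //; rewrite /x /y; lra.
  exfalso; lra.
have [h hP] := choice step.
pose q0 := ((A, B), (C, D)); pose q n := iter n h q0.
have okq n : ok (q n) by elim: n => [|n IH] //=; have [] := hP _ IH.
have qn n : nxt (q n) (q n.+1) by exact: hP.
have size1 n : (q n).1.2 - (q n).1.1 = (B - A) / 2 ^+ n.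
  elim: n => [|n IH]; first by rewrite expr0 divr1.
  have [_ _ _ _ [_ -> _ _]] := qn n.
  by rewrite IH exprS -mulrA -invfM (mulrC 2).
have size2 n : (q n).2.2 - (q n).2.1 = (D - C) / 2 ^+ n.
  elim: n => [|n IH]; first by rewrite expr0 divr1.
  have [_ _ _ _ [_ _ -> _]] := qn n.
  by rewrite IH exprS -mulrA -invfM (mulrC 2).
have Fq n : FF q0 <= 4 ^+ n * FF (q n).
  elim: n => [|n IH]; first by rewrite expr0 mul1r.
  rewrite (le_trans IH)// exprSr -mulrA ler_wpM2l// ?exprn_ge0//.
  by have [_ _ _ _ [_ _ _ ]] := qn n.
have mono (g : nat -> R) : (forall n, g n <= g n.+1) ->
    forall n k, g n <= g (n + k)%N.
  by move=> gS n; elim=> [|k IH]; rewrite ?addn0// addnS (le_trans IH).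
have pick (l u : nat -> R) : (forall n, l n <= l n.+1) ->
    (forall n, u n.+1 <= u n) -> (forall n, l n <= u n) ->
    exists x, forall n, l n <= x <= u n.
  move=> lS uS lu; have l_u n k : l n <= u k.
    have /mono um : forall n, - u n <= - u n.+1 by move=> i; rewrite lerN2.
    have /mono lm := lS.
    rewrite (le_trans (lm n k))// (le_trans (lu _))// -lerN2 addnC; exact: um.
  have hs : has_sup (range l).
    by split; [exists (l 0%N), 0%N|exists (u 0%N) => _ [n _ <-]].
  exists (sup (range l)) => n; apply/andP; split.
    by apply: ub_le_sup; [exact: hs.2|exists n].
  by apply: sup_le_ub; [exact: hs.1|move=> _ [k _ <-]].
have [x xq] : exists x, forall n, (q n).1.1 <= x <= (q n).1.2.
  apply: pick => n; [by have [] := qn n|by have [] := qn n|].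
  by have [] := okq n.
have [y yq] : exists y, forall n, (q n).2.1 <= y <= (q n).2.2.
  apply: pick => n; [by have [] := qn n|by have [_ _ _ _ []] := qn n|].
  by have [_ _ _ []] := okq n.
apply/eqP; rewrite -normc_eq0 eq_le normc_ge0 andbT.
pose W := (B - A) + (D - C).
have W0 : 0 <= W by rewrite addr_ge0// subr_ge0.
suff H e : 0 < e -> FF q0 <= e * W ^+ 2.
  (* Adding 1 keeps the denominator positive for a rectangle reduced to a point. *)
  have W1 : 0 < W ^+ 2 + 1 by rewrite ltr_wpDl// sqr_ge0.
  apply/ler_addgt0Pr => e e0; rewrite add0r.
  apply: (le_trans (H (e / (W ^+ 2 + 1)) _)); first by rewrite divr_gt0.
  have hW : (W ^+ 2 + 1)^-1 * W ^+ 2 <= 1.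
    by rewrite mulrC ler_pdivrMr// mul1r lerDl.
  by rewrite -mulrA ler_piMr// ltW.
move=> e0.
have [s s0 Hs] := Floc x y e (xq 0%N) (yq 0%N) e0.
have [n Hn] : exists n, W / 2 ^+ n < s.
  have [n nW] : exists n : nat, W / s < n%:R.
    exists (Num.bound (W / s)); apply: le_lt_trans (archi_boundP _) => //.
    by rewrite divr_ge0// ltW.
  exists n; rewrite ltr_pdivrMr ?exprn_gt0//.
  move: nW; rewrite ltr_pdivrMr// => /lt_le_trans; apply.
  by rewrite mulrC ler_wpM2l ?(ltW s0)// -natrX ler_nat ltnW// ltn_expl.
have p2 : 0 < (2 ^+ n)^-1 :> R by rewrite invr_gt0 exprn_gt0.
have Hq := Hs (q n).1.1 (q n).1.2 (q n).2.1 (q n).2.2.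
have [k1 k2 k3 [k4 k5 k6]] := okq n.
have /andP[x1 x2] := xq n; have /andP[y1 y2] := yq n.
have := Hq k1 x1 x2 k3 k4 y1 y2 k6.
rewrite size1 size2 => Hq'.
have {}Hq' : FF (q n) <= e * ((B - A) / 2 ^+ n + (D - C) / 2 ^+ n) ^+ 2.
  apply: Hq'.
  - by apply: le_lt_trans Hn; rewrite ler_pM2r// lerDl subr_ge0.
  - by apply: le_lt_trans Hn; rewrite ler_pM2r// lerDr subr_ge0.
apply: (le_trans (Fq n)).
(* The factor 4 ^ n lost in n bisections is offset exactly by the square of the side lengths, which
   have been divided by 2 ^ n. *)
have e4 : 4 ^+ n = (2 ^+ n) ^+ 2 :> R by rewrite exprAC; congr (_ ^+ n); ring.
rewrite e4 mulrC -ler_pdivlMr ?exprn_gt0//; apply: (le_trans Hq').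
by rewrite -mulrDl exprMn exprVn mulrA.
Qed.

End bisection.

(** * The parametrized unit circle *)

Section circle.
Context (R : realType).
Local Notation C := R[i].

Definition cis (t : R) : C := (cos t +i* sin t)%C.

Lemma normc_cis t : normc (cis t) = 1.
Proof. by rewrite /normc /= cos2Dsin2 sqrtr1. Qed.

Lemma cis_neq0 t : cis t != 0.
Proof. by rewrite -normc_gt0 normc_cis ltr01. Qed.

Lemma cisD s t : cis (s + t) = cis s * cis t.
Proof. by apply: complex_ext; rewrite /= ?cosD ?sinD//; ring. Qed.

Lemma cis0 : cis 0 = 1.
Proof. by rewrite /cis cos0 sin0. Qed.

Lemma cis2pi : cis (2 * pi) = 1.
Proof. by rewrite mulrC mulr_natr /cis cos2pi sin2pi. Qed.

Lemma cispi : cis pi = -1.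
Proof. by rewrite /cis cospi sinpi; apply: complex_ext => /=; rewrite ?oppr0. Qed.

Lemma cisM (t : R) n : cis (t *+ n) = cis t ^+ n.
Proof. by elim: n => [|n IH]; rewrite ?cis0// mulrS cisD IH exprS. Qed.

Lemma cis_cont a b : ccont cis a b.
Proof.
by move=> t _; apply: cvg_Complex; [exact: continuous_cos|exact: continuous_sin].
Qed.

(** Apart from constants, the only integral of the Cauchy theory that is computed from a primitive:
    componentwise it is the fundamental theorem of calculus for [cos] and [sin]. *)
Lemma cint_cis (a b : R) : a <= b ->
  cint (fun t => 'i%C * cis t) a b = cis b - cis a.
Proof.
rewrite le_eqVlt => /predU1P[->|ab].
  rewrite subrr cintZ; last exact: cis_cont.
  rewrite /cint set_itv1 !Rintegral_set1; apply: complex_ext => /=; ring.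
apply: complex_ext => /=.
- transitivity (\int[@lebesgue_measure R]_(t in `[a, b]) (- sin t)).
    by apply: eq_Rintegral => t _ /=; ring.
  rewrite /Rintegral (@continuous_FTC2 _ _ (@cos R) _ _ ab)//.
  + apply: continuous_subspaceT => t; apply: cvgN; exact: continuous_sin.
  + by split => [t _| |];
      [exact: derivable_cos|exact/cvg_at_right_filter/continuous_cos|
       exact/cvg_at_left_filter/continuous_cos].
  + by move=> t _; rewrite derive1E derive_val.
- transitivity (\int[@lebesgue_measure R]_(t in `[a, b]) cos t).
    by apply: eq_Rintegral => t _ /=; ring.
  rewrite /Rintegral (@continuous_FTC2 _ _ (@sin R) _ _ ab)//.
  + apply: continuous_subspaceT => t; exact: continuous_cos.
  + by split => [t _| |];
      [exact: derivable_sin|exact/cvg_at_right_filter/continuous_sin|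
       exact/cvg_at_left_filter/continuous_sin].
  + by move=> t _; rewrite derive1E derive_val.
Qed.

(** The increment is the integral of i [cis], of modulus 1; the constant 2 is that of [cint_le]. *)
Lemma cis_lipschitz s t : normc (cis t - cis s) <= 2 * `|t - s|.
Proof.
wlog st : s t / s <= t.
  move=> H; have [/H//|/ltW/H] := leP s t.
  by rewrite normc_distC distrC.
rewrite -cint_cis// ger0_norm ?subr_ge0//.
apply: le_trans (cint_le (M := 1) st _ _) _; last by rewrite mulr1.
- by apply: ccontM; [exact: ccont_cst|exact: cis_cont].
- move=> x _; rewrite normcM normc_cis mulr1 /normc /=.
  by rewrite expr0n expr1n add0r sqrtr1.
Qed.

End circle.

(** * Cauchy's formula for a circle, by Goursat's method *)

Section cauchy.
Context (R : realType).
Local Notation C := R[i].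

Definition cdiff (phi : C -> C) (z : C) := exists d : C, forall e : R, 0 < e ->
  exists2 s : R, 0 < s & forall w, normc (w - z) < s ->
    normc (phi w - phi z - d * (w - z)) <= e * normc (w - z).

Lemma cdiff_cont phi z : cdiff phi z -> phi @ z --> phi z.
Proof.
move=> [d Hd]; apply/(@cvg_complexP R _ _ (nbhs_filter z)) => e e0.
have [s s0 Hs] := Hd 1 ltr01.
have k0 : 0 < 1 + normc d by rewrite ltr_pwDl// normc_ge0.
pose t := Num.min s (e / (1 + normc d)).
have t0 : 0 < t by rewrite lt_min s0 divr_gt0.
have : (w : C) @[w --> z] --> z by exact: cvg_id.
move/(@cvg_complexP R _ _ (nbhs_filter z) id z) => /(_ t t0).
apply: filterS => w; rewrite lt_min => /andP[/Hs H1].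
rewrite ltr_pdivlMr// => H2; apply: le_lt_trans H2.
have -> : phi w - phi z = (phi w - phi z - d * (w - z)) + d * (w - z).
  by rewrite subrK.
rewrite (le_trans (normcD _ _))// normcM [leRHS]mulrDr mulr1 lerD//.
  by rewrite (le_trans H1)// mul1r.
by rewrite mulrC.
Qed.

Lemma cvg_affine (u v z w : C) : u + v * (x - z) @[x --> w] --> u + v * (w - z).
Proof.
have Hid : (fun x : C => x) @ w --> w by exact: cvg_id.
by apply: cvgD (cvg_cst u) (cvgM (cvg_cst v) (cvgB Hid (cvg_cst z))).
Qed.

Context (r : R) (z : C).
Hypotheses (r0 : 0 < r) (zr : normc z < r).

Let g t : C := r%:C%C * cis t.
(* [zeta] contracts the circle to z; pulled back along it, the closed form
   phi(w) dw / (w - z) is phi(zeta s t) (ds / s + kappa t dt). *)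
Let zeta s t := z + s%:C%C * (g t - z).
Let kappa t := 'i%C * g t / (g t - z).

Lemma normc_i : normc 'i%C = 1 :> R.
Proof. by rewrite /normc /= expr0n expr1n add0r sqrtr1. Qed.

Let gn t : normc (g t) = r.
Proof. by rewrite normcM normc_real normc_cis mulr1 gtr0_norm. Qed.

Let gzn t : r - normc z <= normc (g t - z).
Proof.
rewrite lerBlDr -(gn t); apply: le_trans (normcD _ _).
by rewrite subrK.
Qed.

Let rz0 : 0 < r - normc z. Proof. by rewrite subr_gt0. Qed.

Let gz0 t : g t - z != 0.
Proof. by rewrite -normc_gt0 (lt_le_trans rz0). Qed.

Let gz2 t : normc (g t - z) <= 2 * r.
Proof. by rewrite (le_trans (normcB _ _))// gn mulr_natl mulr2n lerD2l ltW. Qed.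

Let g_cont a b : ccont g a b.
Proof. by apply: ccontM; [exact: ccont_cst|exact: cis_cont]. Qed.

Let gz_cont a b : ccont (fun t => g t - z) a b.
Proof. by apply: ccontD => //; exact: ccont_cst. Qed.

Let kappa_cont a b : ccont kappa a b.
Proof.
apply: ccontM; last by apply: ccontV.
by apply: ccontM => //; exact: ccont_cst.
Qed.

Let K := r / (r - normc z).

Let kappaK t : normc (kappa t) <= K.
Proof.
rewrite /kappa normcM normcVE (normcM 'i%C) normc_i mul1r gn ler_pM2l//.
by rewrite lef_pV2// posrE// (lt_le_trans rz0).
Qed.

Let zeta_le s t : 0 <= s <= 1 -> normc (zeta s t) <= r.
Proof.
move=> /andP[s0 s1].
have -> : zeta s t = (1 - s)%:C%C * z + s%:C%C * g t.
  by rewrite /zeta rmorphB rmorph1; ring.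
rewrite (le_trans (normcD _ _))// (normcM _ z) (normcM s%:C%C) !normc_real gn.
rewrite (ger0_norm s0) ger0_norm ?subr_ge0//.
rewrite -[leRHS](_ : (1 - s) * r + s * r = _); last by ring.
by rewrite lerD2r ler_wpM2l ?subr_ge0// ltW.
Qed.

Let zetaB s t s' t' : 0 <= s' <= 1 ->
  normc (zeta s t - zeta s' t') <= 2 * r * (`|s - s'| + `|t - t'|).
Proof.
move=> /andP[s0 s1].
have -> : zeta s t - zeta s' t' =
    (s - s')%:C%C * (g t - z) + s'%:C%C * (r%:C%C * (cis t - cis t')).
  by rewrite /zeta /g rmorphB; ring.
rewrite (le_trans (normcD _ _))// [leRHS]mulrDr lerD//.
  by rewrite normcM normc_real mulrC ler_wpM2r.
rewrite !normcM !normc_real (ger0_norm s0) (gtr0_norm r0).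
apply: (@le_trans _ _ (1 * (r * (2 * `|t - t'|)))).
  rewrite ler_pM// ?mulr_ge0 ?normc_ge0// ?(ltW r0)//.
  by rewrite ler_wpM2l ?(ltW r0)// cis_lipschitz.
by rewrite mul1r mulrA (mulrC r).
Qed.

Section rectangle.
Variable f : C -> C.
Hypothesis cf : forall w, normc w <= r -> f @ w --> f w.

Let zt_cont s a b : ccont (zeta s) a b.
Proof.
apply: ccontD; first exact: ccont_cst.
by apply: ccontM => //; exact: ccont_cst.
Qed.

Let zs_cont t a b : ccont (zeta^~ t) a b.
Proof.
apply: ccontD; first exact: ccont_cst.
apply: ccontM; last exact: ccont_cst.
by move=> x _; apply: cvg_Complex; [exact: cvg_id|exact: cvg_cst].
Qed.

Let A s c d := cint (fun t => f (zeta s t) * kappa t) c d.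
Let B t a b := cint (fun s => f (zeta s t) * s%:C%C^-1) a b.

Lemma A_cont s c d : 0 <= s <= 1 ->
  ccont (fun t => f (zeta s t) * kappa t) c d.
Proof.
move=> s1; apply: ccontM => // t tcd.
by apply: (cvg_comp _ _ (zt_cont tcd)); apply: cf; exact: zeta_le.
Qed.

Lemma B_cont t a b : 0 < a -> b <= 1 ->
  ccont (fun s => f (zeta s t) * s%:C%C^-1) a b.
Proof.
move=> a0 b1; apply: ccontM => [s sab|].
  apply: (cvg_comp _ _ (zs_cont sab)); apply: cf; apply: zeta_le.
  move: sab => /andP[as_ sb]; rewrite (le_trans (ltW a0))// (le_trans sb)//.
apply: ccontV => [x _|x /andP[ax _]].
  by apply: cvg_Complex; [exact: cvg_id|exact: cvg_cst].
by rewrite fmorph_eq0 gt_eqF// (lt_le_trans a0).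
Qed.

(** The integral of f(zeta s t) (ds / s + kappa t dt) over the boundary of the parameter rectangle
    [a, b] x [c, d], counterclockwise: [A] belongs to the sides with s constant, [B] to those with t
    constant. *)
Definition rect_form a b c d := A b c d - A a c d - (B d a b - B c a b).

Lemma rect_splitx a m b c d : 0 < a -> a <= m -> m <= b -> b <= 1 ->
  rect_form a b c d = rect_form a m c d + rect_form m b c d.
Proof.
move=> a0 am mb b1; rewrite /rect_form.
have BS t : B t a b = B t a m + B t m b.
  by apply: cint_split; rewrite ?am//; exact: B_cont.
rewrite !BS; move: (A b c d) (A a c d) (A m c d) (B d a m) (B d m b) (B c a m) (B c m b).
by move=> *; ring.
Qed.

Lemma rect_splity a b c m d : 0 < a -> a <= b -> b <= 1 -> c <= m -> m <= d ->
  rect_form a b c d = rect_form a b c m + rect_form a b m d.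
Proof.
move=> a0 ab b1 cm md; rewrite /rect_form.
have AS s : a <= s <= b -> A s c d = A s c m + A s m d.
  move=> /andP[as_ sb]; apply: cint_split; rewrite ?cm//.
  by apply: A_cont; rewrite (le_trans (ltW a0))// (le_trans sb).
rewrite !AS ?lexx ?ab//.
move: (A b c m) (A b m d) (A a c m) (A a m d) (B d a b) (B m a b) (B c a b).
by move=> *; ring.
Qed.

(** The lower bound s0 keeps the rectangle away from s = 0, the side contracted to z, where ds / s
    is singular. *)
Lemma rect_bound a b c d s0 e : 0 < s0 -> s0 <= a -> a <= b -> b <= 1 -> c <= d ->
  0 <= e ->
  (forall s t, a <= s <= b -> c <= t <= d -> normc (f (zeta s t)) <= e) ->
  normc (rect_form a b c d) <= 4 * e * (K * (d - c) + (b - a) / s0).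
Proof.
move=> s00 s0a ab b1 cd e0 fe; have a0 := lt_le_trans s00 s0a.
have HA s : a <= s <= b -> normc (A s c d) <= 2 * (e * K) * (d - c).
  move=> /andP[as_ sb]; apply: cint_le => //.
    by apply: A_cont; rewrite (le_trans (ltW a0))//= (le_trans sb).
  by move=> t tcd; rewrite normcM ler_pM ?normc_ge0// fe// as_.
have HB t : c <= t <= d -> normc (B t a b) <= 2 * (e * s0^-1) * (b - a).
  move=> tcd; apply: cint_le => //; first exact: B_cont.
  move=> s /andP[as_ sb]; rewrite normcM ler_pM ?normc_ge0//.
    by rewrite fe// as_.
  rewrite normcVE normc_real lef_pV2 ?posrE// ?(le_trans s0a)//.
    by rewrite (le_trans as_)// ler_norm.
  by rewrite normr_gt0 gt_eqF// (lt_le_trans a0).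
have HA1 := HA b; have HA2 := HA a; have HB1 := HB d; have HB2 := HB c.
rewrite /rect_form; move: (A b c d) (A a c d) (B d a b) (B c a b) HA1 HA2 HB1 HB2.
move=> A1 A2 B1 B2; rewrite !lexx ab cd => /(_ isT) h1 /(_ isT) h2 /(_ isT) h3 /(_ isT) h4.
have h : normc (A1 - A2 - (B1 - B2)) <= (normc A1 + normc A2) + (normc B1 + normc B2).
  by rewrite (le_trans (normcB _ _))// lerD// normcB.
apply: (le_trans h); apply: (le_trans (lerD (lerD h1 h2) (lerD h3 h4))).
by rewrite le_eqVlt; apply/orP; left; apply/eqP; ring.
Qed.

End rectangle.

Lemma rect_formD (f1 f2 : C -> C) a b c d : 0 < a -> a <= b -> b <= 1 ->
  (forall w, normc w <= r -> f1 @ w --> f1 w) ->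
  (forall w, normc w <= r -> f2 @ w --> f2 w) ->
  rect_form (fun w => f1 w + f2 w) a b c d =
  rect_form f1 a b c d + rect_form f2 a b c d.
Proof.
move=> a0 ab b1 c1 c2; rewrite /rect_form.
have b0 := lt_le_trans a0 ab.
have HA s : 0 <= s <= 1 -> cint (fun t => (f1 (zeta s t) + f2 (zeta s t)) * kappa t) c d =
  cint (fun t => f1 (zeta s t) * kappa t) c d + cint (fun t => f2 (zeta s t) * kappa t) c d.
  move=> s1; rewrite -cintD; [|exact: A_cont|exact: A_cont].
  by apply: eq_cint => t _; rewrite mulrDl.
have HB t : cint (fun s => (f1 (zeta s t) + f2 (zeta s t)) * s%:C%C^-1) a b =
  cint (fun s => f1 (zeta s t) * s%:C%C^-1) a b + cint (fun s => f2 (zeta s t) * s%:C%C^-1) a b.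
  rewrite -cintD; [|exact: B_cont|exact: B_cont].
  by apply: eq_cint => s _; rewrite mulrDl.
rewrite !HA ?HB ?(ltW b0) ?(ltW a0) ?b1 ?(le_trans ab)//.
move: (cint (fun t => f1 (zeta b t) * _) c d) (cint (fun t => f2 (zeta b t) * _) c d).
move: (cint (fun t => f1 (zeta a t) * _) c d) (cint (fun t => f2 (zeta a t) * _) c d).
move: (cint (fun s => f1 (zeta s d) * _) a b) (cint (fun s => f2 (zeta s d) * _) a b).
move: (cint (fun s => f1 (zeta s c) * _) a b) (cint (fun s => f2 (zeta s c) * _) a b).
by move=> *; ring.
Qed.

(** For an affine integrand the form is u (ds / s + kappa dt) + v d(zeta). The u-terms agree on
    opposite sides, and the v-terms are increments of zeta, which add up to 0 around the
    boundary. *)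
Lemma rect_form_affine (u v : C) a b c d : 0 < a -> a <= b -> b <= 1 -> c <= d ->
  rect_form (fun w => u + v * (w - z)) a b c d = 0.
Proof.
move=> a0 ab b1 cd; rewrite /rect_form.
have HA s : cint (fun t => (u + v * (zeta s t - z)) * kappa t) c d =
    u * cint kappa c d + v * s%:C%C * (g d - g c).
  rewrite /g -mulrBr -cint_cis// -[RHS]addr0 -[in RHS]cintZ//.
  rewrite mulrA -cintZ; last first.
    by apply: ccontM; [exact: ccont_cst|exact: cis_cont].
  rewrite addr0 -cintD.
  - apply: eq_cint => t _; rewrite /zeta /kappa.
    have -> : z + s%:C%C * (g t - z) - z = s%:C%C * (g t - z) by ring.
    rewrite mulrDl; congr (_ + _).
    rewrite [RHS](_ : _ = v * s%:C%C * ('i%C * g t)); last by rewrite /g; ring.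
    by field; exact: gz0.
  - by apply: ccontM => //; exact: ccont_cst.
  - apply: ccontM; first exact: ccont_cst.
    by apply: ccontM; [exact: ccont_cst|exact: cis_cont].
have iV : ccont (fun s : R => s%:C%C^-1) a b.
  apply: ccontV => [x _|x /andP[ax _]].
    by apply: cvg_Complex; [exact: cvg_id|exact: cvg_cst].
  by rewrite fmorph_eq0 gt_eqF// (lt_le_trans a0).
have HB t : cint (fun s => (u + v * (zeta s t - z)) * s%:C%C^-1) a b =
    u * cint (fun s => s%:C%C^-1) a b + v * (g t - z) * (b - a)%:C%C.
  have h1 : ccont (fun s : R => u * s%:C%C^-1) a b.
    exact: (ccontM (@ccont_cst _ u a b) iV).
  rewrite -(cint_cst _ ab) -(cintZ _ iV) -(cintD h1 (@ccont_cst _ _ a b)).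
  apply: eq_cint => s /andP[as_ _]; rewrite /zeta.
  by field; rewrite fmorph_eq0 gt_eqF// (lt_le_trans a0).
by rewrite !HA !HB rmorphB; ring.
Qed.

Variables (phi : C -> C).
Hypothesis dphi : forall w, normc w <= r -> cdiff phi w.

(** Near a point w0 = zeta x y, phi is its affine approximation plus an error small compared with
    the distance to w0. The affine part integrates to 0, and the error contributes at most e times
    the square of the half-perimeter, as the bisection lemma requires. *)
Lemma rect_form_eq0 (s0 : R) : 0 < s0 -> s0 <= 1 ->
  rect_form phi s0 1 0 (2 * pi) = 0.
Proof.
move=> s00 s01.
have cphi w : normc w <= r -> phi @ w --> phi w by move=> /dphi/cdiff_cont.
apply: additive_rectangle_eq0 => //.
- by rewrite mulr_ge0// pi_ge0.
- move=> a m b c d sa am mb b1 _ _ _; apply: rect_splitx => //.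
  exact: lt_le_trans sa.
- move=> a b c m d sa ab b1 _ cm md _; apply: rect_splity => //.
  exact: lt_le_trans sa.
move=> x y e /andP[sx x1] _ e0; set w0 := zeta x y.
have x01 : 0 <= x <= 1 by rewrite (le_trans (ltW s00)).
have [v Hv] := dphi (zeta_le y x01).
have L0 : 0 < K + s0^-1.
  by rewrite addr_gt0 ?invr_gt0// divr_gt0.
(* The product of the 4 of [rect_bound], the Lipschitz constant 2 r of zeta, and a common bound for
   the two coefficients of the form. *)
pose L := 8 * r * (K + s0^-1).
have {}L0 : 0 < L by rewrite !mulr_gt0.
have eL : 0 < e / L by rewrite divr_gt0.
have [s spos Hs] := Hv _ eL.
(* Two sides shorter than s / (4 r) have a sum h with 2 r h < s, so that zeta stays within s of w0
   on the rectangle. *)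
exists (s / (4 * r)); first by rewrite divr_gt0// mulr_gt0.
move=> a b c d sa ax xb b1 _ cy yd _ bas dcs.
have a0 : 0 < a by exact: lt_le_trans sa.
have ab : a <= b by exact: le_trans xb.
have cd : c <= d by exact: le_trans yd.
pose u := phi w0 - v * (w0 - z); pose E w := phi w - (u + v * (w - z)).
have EE w : E w = phi w - phi w0 - v * (w - w0) by rewrite /E /u; ring.
have cE w : normc w <= r -> E @ w --> E w.
  by move=> wr; exact: cvgB (cphi _ wr) (@cvg_affine u v z w).
have -> : phi = fun w => (u + v * (w - z)) + E w.
  by apply/funext => w; rewrite /E addrC subrK.
rewrite (rect_formD _ _ a0 ab b1 _ cE); last first.
  by move=> w _; exact: cvg_affine.
rewrite rect_form_affine// add0r.
set h := (b - a) + (d - c).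
have h0 : 0 <= h by rewrite addr_ge0// subr_ge0.
have hs : 2 * r * h < s.
  have := ltrD bas dcs; rewrite -/h -mulr2n => hlt.
  have r2 : 0 < 2 * r by rewrite mulr_gt0.
  have := hlt; rewrite -(ltr_pM2l r2) => /lt_le_trans; apply.
  by rewrite le_eqVlt; apply/orP; left; apply/eqP; field; rewrite gt_eqF.
apply: (le_trans (@rect_bound E cE a b c d s0 (e / L * (2 * r * h)) _ _ _ _ _ _ _)) => //.
- by rewrite mulr_ge0// ?(ltW eL)// !mulr_ge0// ltW.
- move=> s1 t1 /andP[as1 s1b] /andP[ct1 t1d].
  have dw : normc (zeta s1 t1 - w0) <= 2 * r * h.
    apply: (le_trans (zetaB s1 t1 y x01)).
    rewrite ler_wpM2l ?mulr_ge0// ?(ltW r0)// lerD// ler_norml; apply/andP; split; lra.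
  by rewrite EE; apply: (le_trans (Hs _ (le_lt_trans dw hs))); rewrite ler_wpM2l// ltW.
apply: (@le_trans _ _ (4 * (e / L * (2 * r * h)) * ((K + s0^-1) * h))).
  apply: ler_wpM2l; first by rewrite !mulr_ge0 ?invr_ge0 ?(ltW e0) ?(ltW L0) ?(ltW r0).
  have K0 : 0 <= K by rewrite divr_ge0 ?ltW.
  have s0V : 0 <= s0^-1 by rewrite invr_ge0 ltW.
  rewrite [leRHS]mulrDl lerD//.
    by rewrite ler_wpM2l// /h lerDr subr_ge0.
  by rewrite mulrC ler_wpM2l// /h lerDl subr_ge0.
rewrite le_eqVlt; apply/orP; left; apply/eqP; rewrite /L.
field; rewrite !gt_eqF// addr_gt0// mulr_gt0// divr_gt0//.
Qed.


(** As zeta is 2 pi-periodic in t, the two sides with t constant cancel. The integral over the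
    circle s = 1 thus equals the one over s = s1, and there phi is as close to phi z as desired when
    s1 is small. *)
Lemma cauchy_kappa : cint (fun t => phi (g t) * kappa t) 0 (2 * pi) =
  phi z * cint kappa 0 (2 * pi).
Proof.
have cphi w : normc w <= r -> phi @ w --> phi w by move=> /dphi/cdiff_cont.
have pi2 : 0 <= 2 * pi :> R by rewrite mulr_ge0// pi_ge0.
apply/eqP; rewrite -subr_eq0 -normc_eq0 eq_le normc_ge0 andbT.
apply/ler_addgt0Pr => e e0; rewrite add0r.
have K0 : 0 < K by rewrite divr_gt0.
pose L := 2 * K * (2 * pi) : R.
have L0 : 0 < L by apply: mulr_gt0; [exact: mulr_gt0|apply: mulr_gt0 => //; exact: pi_gt0].
have [d /(_ 1 ltr01)[s s0 Hs]] := dphi (ltW zr).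
have D0 : 0 < 1 + normc d by rewrite ltr_pwDl// normc_ge0.
have r20 : 0 < 2 * r by rewrite mulr_gt0.
(* The distance from zeta s1 t to z is at most s1 (2 r). The inner minimum brings it below s, where
   the differential estimate applies, and below e / L / (1 + |d|), which makes phi vary by at most e
   / L. *)
pose s1 := Num.min 1 (Num.min (s / 2) (e / L / (1 + normc d)) / (2 * r)).
have s10 : 0 < s1.
  by rewrite lt_min ltr01/= divr_gt0// lt_min !divr_gt0.
have s11 : s1 <= 1 by rewrite ge_min lexx.
have := rect_form_eq0 s10 s11; rewrite /rect_form.
have -> : (fun s => phi (zeta s (2 * pi)) * s%:C%C^-1) =
          (fun s => phi (zeta s 0) * s%:C%C^-1).
  by apply/funext => x; rewrite /zeta /g cis2pi cis0.
rewrite subrr subr0 => /eqP; rewrite subr_eq0 => /eqP.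
under [X in X = _ -> _]eq_cint.
  move=> t _; rewrite (_ : zeta 1 t = g t); last by rewrite /zeta rmorph1; ring.
  over.
move=> ->.
rewrite -cintZ// -[X in normc (_ - X)]mul1r -[X in normc (_ - X)]opprK -mulNr.
rewrite opprK -cintZ//; last by apply: ccontM => //; exact: ccont_cst.
have s1i : 0 <= s1 <= 1 by rewrite ltW.
rewrite -cintD; last 2 first.
- exact: A_cont.
- by do 2 (apply: ccontM; first exact: ccont_cst).
apply: (@le_trans _ _ (2 * (e / L * K) * (2 * pi - 0))).
  apply: cint_le => //.
    apply: ccontD; first exact: A_cont.
    by do 2 (apply: ccontM; first exact: ccont_cst).
  move=> t _; rewrite mulN1r -mulrBl normcM ler_pM ?normc_ge0//.
  have dz : normc (zeta s1 t - z) <= Num.min (s / 2) (e / L / (1 + normc d)).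
    rewrite /zeta addrAC subrr add0r normcM normc_real gtr0_norm//.
    apply: (@le_trans _ _ (s1 * (2 * r))); first by rewrite ler_wpM2l// ltW.
    rewrite -ler_pdivlMr// /s1; rewrite ge_min; apply/orP; right.
    exact: lexx.
  have /Hs : normc (zeta s1 t - z) < s.
    apply: (le_lt_trans dz); rewrite gt_min; apply/orP; left.
    by rewrite ltr_pdivrMr// ltr_pMr// ltr1n.
  rewrite mul1r => H.
  have -> : phi (zeta s1 t) - phi z =
    (phi (zeta s1 t) - phi z - d * (zeta s1 t - z)) + d * (zeta s1 t - z).
    by rewrite subrK.
  rewrite (le_trans (normcD _ _))// normcM.
  apply: (@le_trans _ _ ((1 + normc d) * normc (zeta s1 t - z))).
    by rewrite mulrDl mul1r lerD2r.
  rewrite mulrC -ler_pdivlMr//; apply: (le_trans dz).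
  by rewrite ge_min lexx orbT.
rewrite subr0 le_eqVlt; apply/orP; left; apply/eqP; rewrite /L.
move: (pi : R) (pi_gt0 R) => p p0; field; rewrite !gt_eqF //.
Qed.

End cauchy.

(** * Taylor expansion with an explicit remainder *)

Section taylor.
Context (R : realType).
Local Notation C := R[i].

Lemma nbhs_complexP (z : C) (P : set C) : nbhs z P <->
  exists2 s : R, 0 < s & forall w, normc (w - z) < s -> P w.
Proof.
split=> [/nbhs_ballP[e /= e0 eP]|[s s0 sP]].
  have er : e = (complex.Re e)%:C%C by rewrite RRe_real// gtr0_real.
  exists (complex.Re e); first by rewrite -ltcR -er.
  move=> w wz; apply: eP; rewrite -ball_normE /= er normc_norm ltcR.
  by rewrite normc_distC.
apply/nbhs_ballP; exists s%:C%C => /=; first by rewrite ltcR.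
by move=> w; rewrite -ball_normE /= normc_norm ltcR normc_distC => /sP.
Qed.

Lemma derivable_cdiff (phi : C -> C) z : derivable phi z 1 -> cdiff phi z.
Proof.
move=> /cvg_ex[d]; set F := (X in X --> _ -> _) => Fd.
exists d => e e0.
move: Fd => /(@cvg_complexP _ _ _ (dnbhs_filter _)) => /(_ e e0).
rewrite /dnbhs => /nbhs_complexP[s s0 Hs]; exists s => // w ws.
have [->|wz] := eqVneq w z.
  by rewrite !subrr mulr0 subr0 ComplexField.Normc.normc0 mulr0.
have wz0 : w - z != 0 by rewrite subr_eq0.
have := Hs (w - z); rewrite subr0 => /(_ ws wz0) /=.
rewrite /GRing.scale /= mulr1 subrK => /ltW H.
rewrite -ler_pdivrMr ?normc_gt0// -normcVE -normcM.
apply: le_trans H; rewrite le_eqVlt; apply/orP; left; apply/eqP.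
by congr normc; field.
Qed.

Lemma ccont_conj (f : R -> C) a b : ccont f a b -> ccont (fun t => (f t)^*%C) a b.
Proof.
move=> cf t /cf ft; have E z : z^*%C = (complex.Re z +i* - complex.Im z)%C :> C by case: z.
under eq_fun do rewrite E; rewrite E.
by apply: cvg_Complex; [exact: cvg_Re|apply: cvgN; exact: cvg_Im].
Qed.

Lemma cint_conj (f : R -> C) a b : ccont f a b ->
  cint (fun t => (f t)^*%C) a b = (cint f a b)^*%C.
Proof.
move=> cf; have [_ fI] := ccont_integrable cf.
apply: complex_ext => /=; first by apply: eq_Rintegral => t _; case: (f t).
rewrite -mulN1r -RintegralZl//; apply: eq_Rintegral => t _.
by rewrite mulN1r; case: (f t).
Qed.

Lemma ler_geometric_eq0 (x A q : R) : 0 <= q < 1 -> 0 <= A ->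
  (forall n, x <= A * q ^+ n) -> x <= 0.
Proof.
move=> /andP[q0 q1] A0 H; apply/ler_addgt0Pr => e e0; rewrite add0r.
have : A * q ^+ n @[n --> \oo] --> A * 0.
  by apply: cvgMr; apply: cvg_expr; rewrite ger0_norm.
rewrite mulr0 => /cvgrPdist_lt/(_ e e0)[N _ /(_ N (leqnn N))].
rewrite sub0r normrN ger0_norm ?mulr_ge0 ?exprn_ge0// => /ltW.
exact: le_trans.
Qed.

Variable r : R.
Hypothesis r0 : 0 < r.
Let g t : C := r%:C%C * cis t.

Let gn t : normc (g t) = r.
Proof. by rewrite normcM normc_real normc_cis mulr1 gtr0_norm. Qed.

Let g0 t : g t != 0.
Proof. by rewrite -normc_gt0 gn. Qed.

Let g_cont a b : ccont g a b.
Proof. by apply: ccontM; [exact: ccont_cst|exact: cis_cont]. Qed.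

Let pi2 : 0 < 2 * pi :> R. Proof. by rewrite mulr_gt0// pi_gt0. Qed.

Let gzn z t : r - normc z <= normc (g t - z).
Proof. by rewrite lerBlDr -(gn t); apply: le_trans (normcD _ _); rewrite subrK. Qed.

Let gz0 z t : normc z < r -> g t - z != 0.
Proof.
by move=> zr; rewrite -normc_gt0; apply: lt_le_trans (gzn z t); rewrite subr_gt0.
Qed.

(** The Cauchy kernel: along the circle, dw / (w - z) is i [G z t] dt. *)
Let G z t := g t / (g t - z).

Let G_cont z a b : normc z < r -> ccont (G z) a b.
Proof.
move=> zr; apply: ccontM => //; apply: ccontV => [|t _]; last exact: gz0.
by apply: ccontD => //; exact: ccont_cst.
Qed.

Let GK z t : normc z < r -> normc (G z t) <= r / (r - normc z).
Proof.
move=> zr; rewrite /G normcM gn normcVE ler_pM2l// lef_pV2// ?posrE ?subr_gt0//.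
by apply: lt_le_trans (gzn z t); rewrite subr_gt0.
Qed.

Lemma cauchy_circle (phi : C -> C) (z : C) : normc z < r ->
  (forall w, normc w <= r -> cdiff phi w) ->
  cint (fun t => phi (g t) * G z t) 0 (2 * pi) =
  phi z * cint (G z) 0 (2 * pi).
Proof.
move=> zr dphi.
have i0 : 'i%C != 0 :> C by rewrite -normc_gt0 normc_i.
have cphi a b : ccont (fun t => phi (g t)) a b.
  move=> t tab; apply: (cvg_comp _ _ (g_cont tab)); apply: cdiff_cont.
  by apply: dphi; rewrite gn.
have cG a b := @G_cont z a b zr.
apply: (mulfI i0); rewrite mulrCA -(cintZ _ (cG _ _)) -cintZ; last exact: ccontM.
have -> : (fun t => 'i%C * G z t) = (fun t => 'i%C * g t / (g t - z)).
  by apply/funext => t; rewrite /G mulrA.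
apply: etrans (cauchy_kappa r0 zr dphi); apply: eq_cint => t _.
by rewrite /G /g; ring.
Qed.

(** Cauchy's formula for w ^ k at the centre, where the kernel is constantly 1. *)
Let cint_g k : (0 < k)%N -> cint (fun t => g t ^+ k) 0 (2 * pi) = 0.
Proof.
move=> k0; have z0 : normc (0 : C) < r by rewrite ComplexField.Normc.normc0.
have := @cauchy_circle (fun w => w ^+ k) 0 z0.
rewrite expr0n eqn0Ngt k0/= mul0r => <-.
  by apply: eq_cint => t _; rewrite /G subr0 divff ?mulr1.
by move=> w _; apply: derivable_cdiff; exact: exprn_derivable.
Qed.

(** On the circle 1 / g is r ^- 2 times the conjugate of g, so negative powers are conjugates of
    positive ones up to a real factor. *)
Let cint_gV k : (0 < k)%N -> cint (fun t => (g t)^-1 ^+ k) 0 (2 * pi) = 0.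
Proof.
move=> k0; have gV t : (g t)^-1 ^+ k = (r ^- (2 * k))%:C%C * (g t ^+ k)^*%C.
  rewrite exprVn; apply: (mulfI (expf_neq0 k (g0 t))).
  rewrite mulfV ?expf_neq0// mulrCA mulcJ sqabsE normcX gn -rmorphM.
  by rewrite -exprM mulnC mulVf ?rmorph1// expf_neq0// gt_eqF.
under [X in cint X]eq_fun do rewrite gV.
have gk : ccont (fun t => g t ^+ k) 0 (2 * pi) by exact: ccontX.
by rewrite (cintZ _ (ccont_conj gk)) (cint_conj gk) (cint_g k0) conjc0 mulr0.
Qed.

(** The geometric series of 1 / (1 - z / g), stopped after K terms with its exact remainder. *)
Let geom z t K : normc z < r -> G z t =
  \sum_(k < K) z ^+ k * (g t)^-1 ^+ k + (z / g t) ^+ K * G z t.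
Proof.
move=> zr; have key : G z t = 1 + z / g t * G z t.
  by rewrite /G; field; rewrite g0 gz0.
elim: K => [|K IH]; first by rewrite big_ord0 add0r expr0 mul1r.
rewrite big_ord_recr /= {1}IH -addrA -exprMn exprSr -mulrA; congr (_ + _).
by rewrite {1}key mulrDr mulr1.
Qed.

Let cont_pow z K a b : ccont (fun t => (z / g t) ^+ K) a b.
Proof.
by apply: ccontX; apply: ccontM; [exact: ccont_cst|exact: ccontV].
Qed.

Let pow_le z t K : normc ((z / g t) ^+ K) = (normc z / r) ^+ K.
Proof. by rewrite normcX normcM normcVE gn. Qed.

(** The winding number, read off the geometric expansion: only the constant term has a nonzero
    integral, and the remainder decays like (|z| / r) ^ n. *)
Let cint_G z : normc z < r -> cint (G z) 0 (2 * pi) = (2 * pi)%:C%C.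
Proof.
move=> zr; apply/eqP; rewrite -subr_eq0 -normc_eq0 eq_le normc_ge0 andbT.
apply: (@ler_geometric_eq0 _ (2 * (r / (r - normc z)) * (2 * pi)) (normc z / r)).
- by rewrite divr_ge0 ?normc_ge0 ?(ltW r0)//= ltr_pdivrMr// mul1r.
- by rewrite !mulr_ge0// ?invr_ge0 ?(ltW r0) ?pi_ge0// subr_ge0 ltW.
move=> n; have cV k a b : ccont (fun t => (g t)^-1 ^+ k) a b by apply/ccontX/ccontV.
have cS : ccont (fun t => \sum_(k < n.+1) z ^+ k * (g t)^-1 ^+ k) 0 (2 * pi).
  by apply: ccont_sum => i; exact: ccontM (@ccont_cst _ _ _ _) (@cV _ _ _).
have cR : ccont (fun t => (z / g t) ^+ n.+1 * G z t) 0 (2 * pi).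
  exact: ccontM (@cont_pow z n.+1 _ _) (@G_cont z _ _ zr).
rewrite (@eq_cint _ (fun t => \sum_(k < n.+1) z ^+ k * (g t)^-1 ^+ k +
   (z / g t) ^+ n.+1 * G z t)); last by move=> t _; exact: geom.
rewrite (cintD cS cR) cint_sum; last first.
  by move=> i; exact: ccontM (@ccont_cst _ _ _ _) (@cV _ _ _).
rewrite big_ord_recl big1 => [|i _]; last first.
  by rewrite (cintZ _ (@cV _ _ _)) (cint_gV (ltn0Sn _)) mulr0.
under eq_cint do rewrite expr0 expr0 mul1r.
rewrite cint_cst ?(ltW pi2)// mul1r subr0 addr0 addrAC subrr add0r.
have := cint_le (M := (normc z / r) ^+ n * (r / (r - normc z))) (ltW pi2) cR.
rewrite subr0 => H; apply: (le_trans (H _)).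
  move=> t _; rewrite normcM pow_le ler_pM ?normc_ge0 ?GK//.
    by rewrite exprn_ge0// divr_ge0 ?normc_ge0 ?ltW.
  rewrite exprS ler_piMl ?exprn_ge0 ?divr_ge0 ?normc_ge0 ?(ltW r0)//.
  by rewrite ler_pdivrMr// mul1r ltW.
by rewrite le_eqVlt; apply/orP; left; apply/eqP; ring.
Qed.

(** The coefficients are the Fourier coefficients of phi on the circle, divided by r ^ k; they are
    fixed before the bound M. The remainder is Cauchy's integral against the remainder of [geom]. *)
Lemma taylor (phi : C -> C) : (forall w, normc w <= r -> cdiff phi w) ->
  exists c : nat -> C, forall M, (forall t, 0 <= t <= 2 * pi ->
    normc (phi (r%:C%C * cis t)) <= M) ->
  (forall k, normc (c k) <= 2 * M / r ^+ k) /\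
  (forall z K, normc z < r -> normc (phi z - \sum_(k < K) c k * z ^+ k) <=
    2 * M * (normc z / r) ^+ K * (r / (r - normc z))).
Proof.
move=> dphi; pose p2 : C := (2 * pi)%:C%C.
have p20 : p2 != 0 by rewrite fmorph_eq0 gt_eqF.
have cphi a b : ccont (fun t => phi (g t)) a b.
  move=> t tab; apply: (cvg_comp _ _ (g_cont tab)); apply: cdiff_cont.
  by apply: dphi; rewrite gn.
have cV k a b : ccont (fun t => (g t)^-1 ^+ k) a b by apply/ccontX/ccontV.
pose c k := p2^-1 * cint (fun t => phi (g t) * (g t)^-1 ^+ k) 0 (2 * pi).
exists c => M HM; have H2 (x : C) (N : R) : normc x <= 2 * N * (2 * pi - 0) ->
    normc (p2^-1 * x) <= 2 * N.
  rewrite subr0 => xN; rewrite normcM normcVE normc_real gtr0_norm// mulrC ler_pdivrMr//.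
split=> [k|z K zr].
  rewrite -mulrA; apply: H2; apply: cint_le.
  - exact: ltW.
  - exact: ccontM (@cphi _ _) (@cV _ _ _).
  - move=> t ht; rewrite normcM normcX normcVE gn exprVn ler_wpM2r//.
      by rewrite invr_ge0 exprn_ge0// ltW.
    exact: HM.
have -> : phi z - \sum_(k < K) c k * z ^+ k =
    p2^-1 * cint (fun t => phi (g t) * ((z / g t) ^+ K * G z t)) 0 (2 * pi).
  apply: (mulfI p20); rewrite mulrBr mulVKf//.
  have -> : p2 * phi z = cint (fun t => phi (g t) * G z t) 0 (2 * pi).
    by rewrite (cauchy_circle zr dphi) (cint_G zr) mulrC.
  have -> : p2 * (\sum_(k < K) c k * z ^+ k) = cint (fun t =>
      \sum_(k < K) z ^+ k * (phi (g t) * (g t)^-1 ^+ k)) 0 (2 * pi).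
    rewrite cint_sum; last first.
      by move=> i; exact: ccontM (@ccont_cst _ _ _ _) (ccontM (@cphi _ _) (@cV _ _ _)).
    rewrite mulr_sumr; apply: eq_bigr => i _; rewrite cintZ; last exact: ccontM (@cphi _ _) (@cV _ _ _).
    by rewrite mulrA mulVKf// mulrC.
  apply/eqP; rewrite subr_eq addrC -cintD.
  - apply/eqP; apply: eq_cint => t _; rewrite [G z t in LHS](geom t K zr) mulrDr.
    congr (_ + _); rewrite mulr_sumr; apply: eq_bigr => i _; ring.
  - by apply: ccont_sum => i; exact: ccontM (@ccont_cst _ _ _ _) (ccontM (@cphi _ _) (@cV _ _ _)).
  - exact: ccontM (@cphi _ _) (ccontM (@cont_pow z K _ _) (@G_cont z _ _ zr)).
rewrite -mulrA -mulrA; apply: H2; apply: cint_le.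
- exact: ltW.
- exact: ccontM (@cphi _ _) (ccontM (@cont_pow z K _ _) (@G_cont z _ _ zr)).
- move=> t ht; rewrite normcM normcM pow_le !ler_pM ?normc_ge0 ?mulr_ge0 ?normc_ge0 ?GK//.
  + by rewrite exprn_ge0// divr_ge0 ?normc_ge0 ?ltW.
  + exact: HM.
  + by rewrite exprn_ge0// divr_ge0 ?normc_ge0 ?ltW.
Qed.

End taylor.

(** * Averages over roots of unity of order a power of 2 *)

Section dyadic.
Context (R : realType).
Local Notation C := R[i].

Definition droot n : C := cis (2 * pi / 2 ^+ n).

Lemma droot0 : droot 0 = 1.
Proof. by rewrite /droot expr0 divr1 cis2pi. Qed.

Lemma droot_sqr n : droot n.+1 ^+ 2 = droot n.
Proof.
rewrite /droot expr2 -cisD; congr cis; rewrite exprSr invfM mulrA -mulrDr.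
by rewrite (_ : 2^-1 + 2^-1 = 1 :> R) ?mulr1//; lra.
Qed.

Lemma normc_droot n : normc (droot n) = 1.
Proof. exact: normc_cis. Qed.

Lemma droot_neq0 n : droot n != 0.
Proof. exact: cis_neq0. Qed.

Lemma droot_pow m n : droot (n + m) ^+ (2 ^ m) = droot n.
Proof.
elim: m n => [|m IH] n; first by rewrite addn0 expr1.
by rewrite expnS exprM addnS droot_sqr.
Qed.

Lemma droot_half n : droot n.+1 ^+ (2 ^ n) = -1.
Proof.
rewrite -add1n droot_pow /droot expr1 -cispi; congr cis.
by rewrite mulrAC mulfV ?mul1r// pnatr_eq0.
Qed.

Lemma droot_exp2 n : droot n ^+ (2 ^ n) = 1.
Proof. by rewrite -{1}[n]add0n droot_pow droot0. Qed.

(** The exponents differ by an odd multiple of 2 ^ n, and the 2 ^ n-th power of [droot n.+1] is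
    -1. *)
Lemma droot_opp n k l : l = k %[mod 2 ^ n] -> l <> k %[mod 2 ^ n.+1] ->
  droot n.+1 ^+ l = - droot n.+1 ^+ k.
Proof.
wlog lek : l k / (l <= k)%N.
  move=> H lk lk'; have [/H|/ltnW/H h] := leqP l k; first exact.
  by rewrite (h (esym lk)) ?opprK// => /esym.
move=> lk lk'; have /dvdnP[q qE] : (2 ^ n %| k - l)%N.
  by rewrite -eqn_mod_dvd//; apply/eqP.
have -> : k = (l + q * 2 ^ n)%N by rewrite -qE subnKC.
rewrite exprD mulnC exprM droot_half; suff oq : odd q.
  by rewrite -signr_odd oq mulrN1 opprK.
apply/negPn/negP => /negbTE eq; apply: lk'; apply/eqP.
rewrite eq_sym eqn_mod_dvd// qE expnS dvdn_pmul2r ?expn_gt0//.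
by rewrite dvdn2 eq.
Qed.

Section average.
Context (X : Type) (act : C -> X -> X) (k : nat).

(* The mean of w^-k f(w x) over the 2^n-th roots of unity w, a substitute for the
   Fourier integral over the circle that needs no measurability. *)
Fixpoint dyavg n (f : X -> C) (x : X) : C :=
  if n is n'.+1 then
    2^-1 * (dyavg n' f x + droot n ^- k * dyavg n' f (act (droot n) x))
  else f x.

Lemma dyavgD n f g x : dyavg n (fun x => f x + g x) x = dyavg n f x + dyavg n g x.
Proof. by elim: n x => [//|n IH] x /=; rewrite !IH; ring. Qed.

Lemma dyavgZ n c f x : dyavg n (fun x => c * f x) x = c * dyavg n f x.
Proof. by elim: n x => [//|n IH] x /=; rewrite !IH; ring. Qed.

Lemma dyavg_sum n I (r : seq I) (F : I -> X -> C) x :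
  dyavg n (fun x => \sum_(i <- r) F i x) x = \sum_(i <- r) dyavg n (F i) x.
Proof.
elim: r => [|i r IH].
  under [X in dyavg n X]eq_fun do rewrite big_nil.
  rewrite big_nil; transitivity (dyavg n (fun=> 0 * 0) x).
    by congr dyavg; apply/funext => y; rewrite mul0r.
  by rewrite dyavgZ mul0r.
under [X in dyavg n X]eq_fun do rewrite big_cons.
by rewrite dyavgD IH big_cons.
Qed.

Lemma dyavg_le n f (P : X -> Prop) (e : R) :
  (forall x w, P x -> normc w = 1 -> P (act w x)) ->
  (forall x, P x -> normc (f x) <= e) -> forall x, P x -> normc (dyavg n f x) <= e.
Proof.
move=> Pact fe; elim: n => [//|n IH] x Px /=.
rewrite normcM normcVE (_ : normc 2 = 2); last first.
  by rewrite -[2]/(2%:R) -(rmorph_nat (real_complex R)) normc_real ger0_norm.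
rewrite mulrC ler_pdivrMr// mulr_natr mulr2n.
rewrite (le_trans (normcD _ _))// lerD ?IH//.
rewrite normcM normcVE normcX normc_droot expr1n invr1 mul1r IH//.
by apply: Pact => //; exact: normc_droot.
Qed.

End average.

(** Along a single orbit every action looks like multiplication on C, where power series are
    available. *)
Lemma dyavg_slice (X : Type) (act : C -> X -> X) k n f x z :
  (forall u v, act u (act v x) = act (u * v) x) ->
  dyavg act k n f (act z x) = dyavg *%R k n (fun w => f (act w x)) z.
Proof. by move=> actM; elim: n z => [//|n IH] z /=; rewrite actM !IH. Qed.

(** Orthogonality of characters, by doubling: at each level the exponents congruent to k mod 2 ^ n
    split, and those that fail mod 2 ^ n.+1 take opposite signs in the two halves of the average. *)
Lemma dyavg_pow k n l z : dyavg *%R k n (fun w => w ^+ l) z =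
  if l == k %[mod 2 ^ n] then z ^+ l else 0.
Proof.
elim: n z => [|n IH] z /=; first by rewrite expn0 !modn1.
rewrite !IH; case: ifP => [/eqP lk|lk]; last first.
  case: ifP => [/eqP lk'|_]; last by rewrite !mulr0 addr0 mulr0.
  move: lk; rewrite -(modn_dvdm l (dvdn_exp2l 2 (leqnSn n))) lk'.
  by rewrite modn_dvdm ?eqxx// dvdn_exp2l.
have w0 := droot_neq0 n.+1; have wN := droot_exp2 n.+1.
rewrite exprMn; case: ifP => [/eqP lk'|/eqP lk'].
  have -> : droot n.+1 ^+ l = droot n.+1 ^+ k.
    by rewrite -(expr_mod l wN) lk' expr_mod.
  by rewrite mulKf ?expf_neq0// -mulr2n -(mulr_natl (z ^+ l)) mulKf// pnatr_eq0.
rewrite (droot_opp lk lk') mulNr mulrN mulKf ?expf_neq0// subrr mulr0//.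
Qed.

(** Among the exponents below 2 ^ n the average keeps only k, so its error is at most the truncation
    error of the expansion on the unit circle. *)
Lemma dyavg_lim k n (phi : C -> C) (c : nat -> C) (B : R) z :
  (k < 2 ^ n)%N -> normc z = 1 ->
  (forall w, normc w = 1 ->
    normc (phi w - \sum_(l < 2 ^ n) c l * w ^+ l) <= B) ->
  normc (dyavg *%R k n phi z - c k * z ^+ k) <= B.
Proof.
move=> kn z1 HB; pose S w := \sum_(l < 2 ^ n) c l * w ^+ l.
have -> : dyavg *%R k n phi z - c k * z ^+ k = dyavg *%R k n (fun w => phi w - S w) z.
  have -> : (fun w => phi w - S w) = (fun w => phi w + (-1) * S w).
    by apply/funext => w; rewrite mulN1r.
  rewrite dyavgD dyavgZ mulN1r; congr (_ - _).
  rewrite /S dyavg_sum (bigD1 (Ordinal kn))//= big1 ?addr0 => [|l lk].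
    by rewrite dyavgZ dyavg_pow eqxx.
  rewrite dyavgZ dyavg_pow !modn_small// ifF ?mulr0//.
  by apply/negP => /eqP lk'; move/eqP: lk; apply; exact: val_inj.
apply: (@dyavg_le _ _ _ _ _ (fun w => normc w = 1)) => // x w x1 w1.
by rewrite normcM x1 w1 mulr1.
Qed.

End dyadic.

(** * Functions of several complex variables *)

Section several_variables.
Context (R : realType) (n : nat).
Local Notation C := R[i].
Local Notation Cn := 'cV[C]_n.
Implicit Types (z h : Cn) (f : Cn -> C).

Lemma nbhs_colP z (P : set Cn) : nbhs z P <->
  exists2 s : R, 0 < s & forall w : Cn, (forall i, normc (w i 0 - z i 0) < s) -> P w.
Proof.
split=> [/nbhs_ballP[e /= e0 eP]|[s s0 sP]].
  have er : e = (complex.Re e)%:C%C by rewrite RRe_real// gtr0_real.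
  exists (complex.Re e); first by rewrite -ltcR -er.
  move=> w wz; apply: eP; split=> // i j; rewrite ord1 -ball_normE /= er normc_norm ltcR.
  by rewrite normc_distC.
apply/nbhs_ballP; exists s%:C%C => /=; first by rewrite ltcR.
move=> w [_ Hw]; apply: sP => i; have := Hw i 0.
by rewrite -ball_normE /= normc_norm ltcR normc_distC.
Qed.

Definition colnorm z : R := complex.Re `|z|.

Lemma colnormE z : `|z| = (colnorm z)%:C%C.
Proof. by rewrite /colnorm RRe_real// ger0_real. Qed.

Lemma colnorm_lt z (e : R) : 0 < e -> (colnorm z < e) <-> (forall i, normc (z i 0) < e).
Proof.
move=> e0; have -> : (colnorm z < e) <-> ball (0 : Cn) e%:C%C z.
  by rewrite -ball_normE /= sub0r normrN colnormE ltcR.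
split=> [[_ H] i|H].
  by have := H i 0; rewrite -ball_normE /= mxE sub0r normrN normc_norm ltcR.
split=> [|i j]; first by rewrite ltcR.
by rewrite ord1 -ball_normE /= mxE sub0r normrN normc_norm ltcR.
Qed.

Lemma colnorm_ge0 z : 0 <= colnorm z.
Proof. by rewrite -lecR -colnormE normr_ge0. Qed.

Lemma normc_le_colnorm z i : normc (z i 0) <= colnorm z.
Proof.
apply/ler_addgt0Pr => e e0; apply/ltW.
have ze : 0 < colnorm z + e by rewrite ltr_wpDl// colnorm_ge0.
by have [H _] := colnorm_lt z ze; apply: H; rewrite ltrDl.
Qed.

(** A quadratic error with a fixed constant is a closed condition under pointwise limits, which a
    little-o is not. The estimate is assumed for a majorant t of the coordinates of h, to be
    specialized to t = [colnorm h]. *)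
Lemma frechet_differentiable f z (L : 'I_n -> C) (d M : R) : 0 < d ->
  (forall (t : R) (h : Cn), 0 <= t <= d -> (forall i, normc (h i 0) <= t) ->
     normc (f (z + h) - f z - \sum_i L i * h i 0) <= M * t ^+ 2) ->
  differentiable f z.
Proof.
move=> d0 H; pose l h := \sum_i L i * h i 0.
have l_lin : linear l.
  move=> c x y; rewrite /l scaler_sumr -big_split; apply: eq_bigr => i _.
  by rewrite !mxE /GRing.scale /=; ring.
pose lL := HB.pack_for {linear Cn -> C} l (GRing.isLinear.Build C Cn C _ l l_lin).
have l_cont : continuous lL.
  apply/linear_bounded_continuous/linear_boundedP.
  exists (\sum_i normc (L i))%:C%C; split; first by rewrite realE lecR sumr_ge0// => i _; exact: normc_ge0.
  move=> x; rewrite ltcE => /andP[/eqP /= xI xR] y.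
  have -> : x = (complex.Re x)%:C%C by apply: complex_ext.
  rewrite normc_norm colnormE -rmorphM lecR.
  rewrite (le_trans (normc_sum _ _ _))//.
  apply: (@le_trans _ _ ((\sum_i normc (L i)) * colnorm y)).
    rewrite mulr_suml ler_sum// => i _; rewrite normcM.
    by rewrite ler_wpM2l ?normc_ge0// normc_le_colnorm.
  by rewrite ler_wpM2r ?colnorm_ge0// ltW.
have := @diff_unique C Cn C f lL z l_cont.
match goal with |- (?P -> _) -> _ => suff Hl : P end.
  by move=> /(_ Hl) fl; apply/diff_locallyP; rewrite fl.
apply/eqaddoP => e e0.
  have er : e = (complex.Re e)%:C%C by rewrite RRe_real// gtr0_real.
  set e' := complex.Re e in er; have e'0 : 0 < e' by rewrite -ltcR -er.
  have M0 : 0 < `|M| + 1 by rewrite ltr_wpDl.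
  pose s := Num.min d (e' / (`|M| + 1)).
  have s0 : 0 < s by rewrite lt_min d0 divr_gt0.
  apply/nbhs_colP; exists s => // h hs.
  have hs' : colnorm h < s.
    by apply/colnorm_lt => // i; have := hs i; rewrite mxE subr0.
  rewrite er normc_norm colnormE -rmorphM lecR.
  have := H (colnorm h) h; rewrite colnorm_ge0/=.
  have hd : colnorm h <= d by rewrite ltW// (lt_le_trans hs')// ge_min lexx.
  move=> /(_ hd (normc_le_colnorm h)).
  rewrite (addrC z h) => h1.
  rewrite [X in normc X](_ : _ = f (h + z) - f z - l h); last first.
    by rewrite -addrA -opprD.
  apply: (le_trans h1).
  apply: (@le_trans _ _ ((`|M| + 1) * colnorm h ^+ 2)).
    rewrite ler_wpM2r ?sqr_ge0// (le_trans (ler_norm _))// lerDl//.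
  rewrite expr2 mulrA ler_wpM2r ?colnorm_ge0// mulrC -ler_pdivlMr//.
  by rewrite ltW// (lt_le_trans hs')// ge_min lexx orbT.
Qed.

End several_variables.

Section sequences.
Context (R : realType).
Local Notation C := R[i].
Implicit Types (u v : nat -> C) (l : C).

Lemma cvg_seqP u l : u m @[m --> \oo] --> l <->
  forall e : R, 0 < e -> exists N, forall m, (N <= m)%N -> normc (u m - l) < e.
Proof.
split=> [/(@cvg_complexP _ _ _ _) ul e e0|H].
  by have [N _ HN] := ul _ e0; exists N => k Nk; exact: HN.
apply/(@cvg_complexP _ _ _ _) => e e0; have [N HN] := H _ e0.
by exists N => // k Nk; exact: HN.
Qed.

Lemma cvg_seq_sum I (r : seq I) (F : I -> nat -> C) (l : I -> C) :
  (forall i, F i m @[m --> \oo] --> l i) ->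
  \sum_(i <- r) F i m @[m --> \oo] --> \sum_(i <- r) l i.
Proof.
move=> H; elim: r => [|i r IH].
  by under eq_fun do rewrite big_nil; rewrite big_nil; exact: cvg_cst.
under eq_fun do rewrite big_cons.
by rewrite big_cons; apply: cvgD; [exact: H|exact: IH].
Qed.

Lemma cvg_seq_le u l (B : R) : u m @[m --> \oo] --> l ->
  (\forall m \near \oo, normc (u m) <= B) -> normc l <= B.
Proof.
move=> /cvg_seqP ul [N0 _ HB]; apply/ler_addgt0Pr => e /ul[N HN].
have := HN (maxn N N0) (leq_maxl _ _).
have := HB (maxn N N0) (leq_maxr _ _) => /= h1 h2.
have -> : l = u (maxn N N0) - (u (maxn N N0) - l) by rewrite opprB addrC subrK.
by rewrite (le_trans (normcB _ _))// lerD// ltW.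
Qed.

Lemma cvg_seq_unique u l (m : C) : u k @[k --> \oo] --> l -> u k @[k --> \oo] --> m -> l = m.
Proof.
move=> /cvg_seqP ul /cvg_seqP um; apply/eqP; rewrite -subr_eq0 -normc_eq0.
rewrite eq_le normc_ge0 andbT; apply/ler_addgt0Pr => e e0; rewrite add0r.
have e2 : 0 < e / 2 by rewrite divr_gt0.
have [N1 H1] := ul _ e2; have [N2 H2] := um _ e2.
have := H1 (maxn N1 N2) (leq_maxl _ _); have := H2 (maxn N1 N2) (leq_maxr _ _).
set x := u _ => h1 h2; have -> : l - m = (x - m) - (x - l) by ring.
by rewrite (le_trans (normcB _ _))// [leRHS]splitr ltW// ltrD.
Qed.

Lemma cauchy_seq_cvg u :
  (forall e : R, 0 < e -> exists N, forall p q, (N <= p)%N -> (N <= q)%N ->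
     normc (u p - u q) < e) -> exists l, u m @[m --> \oo] --> l.
Proof.
move=> H.
have key (v : nat -> R) : (forall p q, `|v p - v q| <= normc (u p - u q)) ->
    exists l : R, v m @[m --> \oo] --> l.
  move=> vu; apply/cvg_ex; apply: cauchy_cvg; apply: cauchy_exP => e e0.
  have [N HN] := H _ e0; exists (v N), N => // k /= Nk.
  by rewrite -ball_normE /=; apply: le_lt_trans (vu _ _) _; exact: HN.
have [a Ha] : exists l : R, complex.Re (u m) @[m --> \oo] --> l.
  by apply: key => p q; rewrite -raddfB normr_Re.
have [b Hb] : exists l : R, complex.Im (u m) @[m --> \oo] --> l.
  by apply: key => p q; rewrite -raddfB normr_Im.
have uE : u = fun m => (complex.Re (u m) +i* complex.Im (u m))%C.
  by apply/funext => m; case: (u m).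
by exists (a +i* b)%C; rewrite uE; apply: cvg_Complex.
Qed.

End sequences.

(** * Second-order estimates on complex lines, and limits of holomorphic functions *)

Section slices.
Context (R : realType) (n : nat).
Local Notation C := R[i].
Local Notation Cn := 'cV[C]_n.
Implicit Types (z h w : Cn) (f : Cn -> C).

Lemma colnormZ (c : C) z : colnorm (c *: z) = normc c * colnorm z.
Proof. by rewrite /colnorm normrZ normc_norm (colnormE z) -rmorphM. Qed.

Lemma differentiable_eps f w : differentiable f w -> forall e : R, 0 < e ->
  exists2 s : R, 0 < s & forall k, colnorm k < s ->
    normc (f (k + w) - f w - 'd f w k) <= e * colnorm k.
Proof.
move=> /diff_locallyP[_ /eqaddoP fw] e e0.
have /fw : 0 < e%:C%C by rewrite ltcR.
move=> /nbhs_colP[s s0 Hs]; exists s => // k /colnorm_lt ks.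
have := Hs k; rewrite normc_norm colnormE -rmorphM lecR => H.
rewrite [X in normc X](_ : _ = (f \o shift w \- (cst (f w) + 'd f w)) k); last first.
  by rewrite /= /shift -addrA -opprD.
by apply: H => i; rewrite mxE subr0; exact: ks.
Qed.

Lemma slice_eps f z h (x : C) : differentiable f (z + x *: h) ->
  forall e : R, 0 < e -> exists2 s : R, 0 < s & forall y, normc (y - x) < s ->
    normc (f (z + y *: h) - f (z + x *: h) - 'd f (z + x *: h) h * (y - x)) <=
    e * normc (y - x).
Proof.
move=> df e e0; have h0 : 0 < colnorm h + 1 by rewrite ltr_wpDl// colnorm_ge0.
have eh : 0 < e / (colnorm h + 1) by rewrite divr_gt0.
have [s s0 Hs] := differentiable_eps df eh.
exists (s / (colnorm h + 1)); first by rewrite divr_gt0.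
move=> y; rewrite ltr_pdivlMr// => yx.
have ks : colnorm ((y - x) *: h) < s.
  by rewrite colnormZ (le_lt_trans _ yx)// ler_wpM2l ?normc_ge0// lerDl.
have dfE : 'd f (z + x *: h) ((y - x) *: h) = 'd f (z + x *: h) h * (y - x).
  by rewrite linearZ /= mulrC.
have := Hs _ ks; rewrite dfE colnormZ.
have -> : (y - x) *: h + (z + x *: h) = z + y *: h.
  by rewrite scalerBl addrCA subrK.
move=> /le_trans; apply.
rewrite mulrCA mulrC ler_wpM2r ?normc_ge0//.
by rewrite mulrAC ler_pdivrMr// ler_pM2l// lerDl.
Qed.

Lemma slice_cdiff f z h (x : C) : differentiable f (z + x *: h) ->
  cdiff (fun y => f (z + y *: h)) x.
Proof. by move=> df; exists ('d f (z + x *: h) h) => e e0; exact: slice_eps. Qed.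

Definition coord_vec (i : 'I_n) : Cn := delta_mx i 0.

(** Restriction to the complex line in the direction h / t gives a function of one variable on the
    disc of radius 2 d, to which [taylor] applies with two terms. The constant depends on M and d
    only, hence is uniform over bounded families. *)
Lemma second_order f z (d M : R) : 0 < d ->
  (forall h, (forall i, normc (h i 0) <= 2 * d) -> differentiable f (z + h)) ->
  (forall h, (forall i, normc (h i 0) <= 2 * d) -> normc (f (z + h)) <= M) ->
  exists L : 'I_n -> C, forall (t : R) h, 0 <= t <= d ->
    (forall i, normc (h i 0) <= t) ->
    normc (f (z + h) - f z - \sum_i L i * h i 0) <= M / d ^+ 2 * t ^+ 2.
Proof.
move=> d0 df fM; exists (fun i => 'd f z (coord_vec i)) => t h /andP[t0 td] ht.
have M0 : 0 <= M.
  apply: le_trans (fM 0 _); first exact: normc_ge0.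
  by move=> i; rewrite mxE ComplexField.Normc.normc0 mulr_ge0// ltW.
have -> : \sum_i 'd f z (coord_vec i) * h i 0 = 'd f z h.
  rewrite [in RHS](matrix_sum_delta h) linear_sum; apply: eq_bigr => i _.
  by rewrite big_ord1 linearZ /= mulrC.
have [t00|tn0] := eqVneq t 0.
  have -> : h = 0.
    apply/matrixP => i j; rewrite ord1 mxE; apply/eqP.
    by rewrite -normc_eq0 eq_le normc_ge0 -t00 ht.
  by rewrite addr0 subrr linear0 subr0 ComplexField.Normc.normc0 t00 expr0n mulr0.
have {tn0}t0 : 0 < t by rewrite lt_neqAle eq_sym tn0.
pose h' : Cn := t^-1%:C%C *: h.
have hh : h = t%:C%C *: h'.
  by rewrite /h' scalerA -rmorphM mulfV ?rmorph1 ?scale1r// gt_eqF.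
have h'1 i : normc (h' i 0) <= 1.
  rewrite mxE normcM normc_real ger0_norm ?invr_ge0 ?(ltW t0)//.
  by rewrite mulrC ler_pdivrMr// mul1r.
have box (x : C) : normc x <= 2 * d -> forall i, normc ((x *: h') i 0) <= 2 * d.
  by move=> xd i; rewrite mxE normcM (le_trans _ xd)// ler_piMr ?normc_ge0.
have d20 : 0 < 2 * d by rewrite mulr_gt0.
pose phi x := f (z + x *: h').
have dphi x : normc x <= 2 * d -> cdiff phi x.
  by move=> xd; apply: slice_cdiff; apply: df; exact: box.
have [c Hc] := taylor d20 dphi.
have fM' (s : R) : 0 <= s <= 2 * pi -> normc (phi ((2 * d)%:C%C * cis s)) <= M.
  move=> _; apply: fM; apply: box.
  by rewrite normcM normc_cis mulr1 normc_real gtr0_norm.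
have [_ {}Hc] := Hc M fM'.
have E2 x : normc x <= d -> normc (phi x - c 0%N - c 1%N * x) <= M / d ^+ 2 * normc x ^+ 2.
  move=> xd; have xd2 : normc x < 2 * d by rewrite (le_lt_trans xd)// ltr_pMl// ltr1n.
  have := Hc x 2 xd2; rewrite big_ord_recr big_ord1 /= expr0 mulr1 expr1 opprD addrA.
  move/le_trans; apply.
  (* For |x| <= d the factor 2 d / (2 d - |x|) of the remainder is at most 2. *)
  apply: (@le_trans _ _ (2 * M * (normc x / (2 * d)) ^+ 2 * 2)).
    apply: ler_wpM2l.
      by apply: mulr_ge0; [exact: mulr_ge0|exact: sqr_ge0].
    rewrite ler_pdivrMr ?subr_gt0// mulrBr; lra.
  by rewrite le_eqVlt; apply/orP; left; apply/eqP; field; rewrite gt_eqF.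
have c0 : c 0%N = phi 0.
  apply/eqP; rewrite eq_sym -subr_eq0 -normc_eq0 eq_le normc_ge0 andbT.
  have := E2 0; rewrite ComplexField.Normc.normc0 mulr0 subr0 expr0n mulr0; apply.
  exact: ltW.
have phi0 : phi 0 = f z by rewrite /phi scale0r addr0.
(* Two first-order expansions of f along the line, one from Taylor and one from the differential,
   are compared at a small real parameter x. *)
have c1 : c 1%N = 'd f z h'.
  apply/eqP; rewrite -subr_eq0 -normc_eq0 eq_le normc_ge0 andbT.
  apply/ler_addgt0Pr => e e0; rewrite add0r.
  have dfz : differentiable f (z + 0 *: h').
    by apply: df => i; rewrite scale0r mxE ComplexField.Normc.normc0 ltW.
  have e2 : 0 < e / 2 by rewrite divr_gt0.
  have [s s0] := slice_eps dfz e2; rewrite scale0r addr0 => Hs.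
  pose A := M / d ^+ 2.
  have A0 : 0 <= A by rewrite divr_ge0// exprn_ge0// ltW.
  pose x := Num.min (Num.min (s / 2) d) (e / 2 / (A + 1)).
  have A1 : 0 < A + 1 by rewrite ltr_wpDl.
  have x0 : 0 < x by rewrite !lt_min !divr_gt0// d0.
  have xs : x < s.
    apply: (@le_lt_trans _ _ (s / 2)); first by rewrite !ge_min lexx.
    by rewrite ltr_pdivrMr// ltr_pMr// ltr1n.
  have xd : x <= d by rewrite !ge_min lexx orbT.
  have nx : normc x%:C%C = x by rewrite normc_real gtr0_norm.
  have := Hs x%:C%C; rewrite subr0 nx => /(_ xs) h1.
  have := E2 x%:C%C; rewrite nx => /(_ xd); rewrite c0 phi0 -/A => h2.
  rewrite -(ler_pM2r x0) -{1}nx -normcM.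
  have -> : (c 1%N - 'd f z h') * x%:C%C =
     (f (z + x%:C%C *: h') - f z - 'd f z h' * x%:C%C) -
     (phi x%:C%C - f z - c 1%N * x%:C%C) by rewrite /phi; ring.
  rewrite (le_trans (normcB _ _))//; apply: (le_trans (lerD h1 h2)).
  have : A * x <= e / 2.
    apply: (@le_trans _ _ ((A + 1) * x)); first by rewrite ler_wpM2r ?lerDl ?ltW.
    by rewrite mulrC -ler_pdivlMr// /x ge_min lexx orbT.
  rewrite -(ler_pM2r x0) expr2 mulrA => h3; lra.
have -> : 'd f z h = 'd f z h' * t%:C%C by rewrite {1}hh linearZ /= mulrC.
have nt : normc t%:C%C = t by rewrite normc_real gtr0_norm.
have := E2 t%:C%C; rewrite nt => /(_ td).
by rewrite c0 c1 phi0 /phi -hh.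
Qed.

(** Weierstrass's theorem for locally bounded pointwise limits. The differentials at z converge
    because they differ from difference quotients, which converge, by an error linear in the step;
    then the uniform second-order estimate passes to the limit. *)
Lemma differentiable_limit (F : nat -> Cn -> C) f z (d M : R) : 0 < d ->
  (forall m h, (forall i, normc (h i 0) <= 2 * d) -> differentiable (F m) (z + h)) ->
  (forall m h, (forall i, normc (h i 0) <= 2 * d) -> normc (F m (z + h)) <= M) ->
  (forall h, (forall i, normc (h i 0) <= 2 * d) ->
     F m (z + h) @[m --> \oo] --> f (z + h)) ->
  differentiable f z.
Proof.
move=> d0 dF FM Ff.
have /choice[L HL] m := second_order d0 (dF m) (FM m).
set A := M / d ^+ 2 in HL.
have M0 : 0 <= M.
  apply: le_trans (FM 0%N 0 _); first exact: normc_ge0.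
  by move=> i; rewrite mxE ComplexField.Normc.normc0 mulr_ge0// ltW.
have A0 : 0 <= A by rewrite divr_ge0// exprn_ge0// ltW.
have box (t : R) h : t <= d -> (forall i, normc (h i 0) <= t) ->
    forall i, normc (h i 0) <= 2 * d.
  by move=> td ht i; have := ht i; move: td d0; lra.
have Fz : F m z @[m --> \oo] --> f z.
  have h0 i : normc ((0 : Cn) i 0) <= 2 * d.
    by rewrite mxE ComplexField.Normc.normc0 mulr_ge0// ltW.
  by have := Ff 0 h0; rewrite addr0.
have LC i : exists l : C, L m i @[m --> \oo] --> l.
  refine (@cauchy_seq_cvg R (fun m => L m i) _) => e e0.
  (* The step t makes the two second-order errors A t ^ 2 add up to at most e t / 2; the four
     convergence errors below e t / 8 account for the other half. *)
  pose t := Num.min d (e / 4 / (A + 1)).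
  have A1 : 0 < A + 1 by rewrite ltr_wpDl.
  have t0 : 0 < t by rewrite lt_min d0 !divr_gt0.
  have td : t <= d by rewrite ge_min lexx.
  pose h : Cn := t%:C%C *: coord_vec i.
  have nt : normc t%:C%C = t by rewrite normc_real gtr0_norm.
  have ht j : normc (h j 0) <= t.
    rewrite !mxE eqxx andbT normcM nt; case: eqP => _.
      by rewrite ComplexField.Normc.normc1 mulr1.
    by rewrite ComplexField.Normc.normc0 mulr0 ltW.
  have Lh m : \sum_j L m j * h j 0 = L m i * t%:C%C.
    rewrite (bigD1 i)//= big1 ?addr0 => [|j ji]; rewrite !mxE eqxx andbT ?eqxx ?mulr1//.
    by rewrite (negbTE ji) !mulr0.
  have HLt m := HL m t h (introT andP (conj (ltW t0) td)) ht.
  have /cvg_seqP Fh := Ff h (box t h td ht); move/cvg_seqP: Fz => Fz.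
  have et : 0 < e * t / 8 by rewrite divr_gt0// mulr_gt0.
  have [N1 H1] := Fh _ et; have [N2 H2] := Fz _ et.
  exists (maxn N1 N2) => p q; rewrite !geq_max => /andP[p1 p2] /andP[q1 q2].
  rewrite -(ltr_pM2r t0) -{1}nt -normcM.
  have -> : (L p i - L q i) * t%:C%C =
    ((F p (z + h) - f (z + h)) - (F q (z + h) - f (z + h)) -
     ((F p z - f z) - (F q z - f z))) -
    ((F p (z + h) - F p z - \sum_j L p j * h j 0) -
     (F q (z + h) - F q z - \sum_j L q j * h j 0)) by rewrite !Lh; ring.
  have a1 := H1 p p1; have a2 := H1 q q1; have a3 := H2 p p2; have a4 := H2 q q2.
  have a5 := HLt p; have a6 := HLt q.
  have AB (x y : C) (a b : R) : normc x < a -> normc y < b -> normc (x - y) < a + b.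
    by move=> xa yb; rewrite (le_lt_trans (normcB _ _))// ltrD.
  have b1 := AB _ _ _ _ (AB _ _ _ _ a1 a2) (AB _ _ _ _ a3 a4).
  have b2 := le_trans (normcB _ _) (lerD a5 a6).
  apply: (le_lt_trans (normcB _ _)).
  apply: (lt_le_trans (ltr_leD b1 b2)).
  have : A * t <= e / 4.
    apply: (@le_trans _ _ ((A + 1) * t)); first by rewrite ler_wpM2r ?lerDl ?ltW.
    by rewrite mulrC -ler_pdivlMr// /t ge_min lexx orbT.
  rewrite -(ler_pM2r t0) expr2 mulrA => h3; lra.
have [l Hl] := choice LC.
apply: (@frechet_differentiable _ _ f z l d A d0) => t h ht hle.
have td : t <= d by case/andP: ht.
apply: (@cvg_seq_le R (fun m => F m (z + h) - F m z - \sum_j L m j * h j 0)).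
  have Fh := Ff h (box t h td hle).
  have SL : \sum_j L m j * h j 0 @[m --> \oo] --> \sum_j l j * h j 0.
    apply: (@cvg_seq_sum R _ _ (fun j m => L m j * h j 0)) => j.
    exact: cvgM (Hl j) (cvg_cst _).
  exact: cvgB (cvgB Fh Fz) SL.
by apply: nearW => m; exact: HL.
Qed.

End slices.

(** * Lebesgue measure on the ball *)

Section measure_preserving.
Context d (T : measurableType d) (R : realType) (mu : {measure set T -> \bar R}).

Definition mscales (k : R) (g : T -> T) := measurable_fun setT g /\
  forall A, measurable A -> mu (g @^-1` A) = (k%:E * mu A)%E.

Lemma mscales_ge0_integral k g (D : set T) (f : T -> \bar R) : 0 <= k ->
  mscales k g -> measurable D -> measurable_fun D f ->
  (forall x, D x -> 0 <= f x)%E ->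
  (\int[mu]_(x in g @^-1` D) f (g x) = k%:E * \int[mu]_(x in D) f x)%E.
Proof.
move=> k0 [mg Hg] mD mf f0.
rewrite -(@ge0_integral_pushforward _ _ _ _ _ g mg mu D f mD mf); last first.
  by move=> x; rewrite inE; exact: f0.
rewrite -(@ge0_integral_mscale _ _ _ mu D mD (NngNum k0))//.
by apply: eq_measure_integral => A mA _; rewrite /mscale /= -[RHS](Hg A mA).
Qed.

Definition mpres (g : T -> T) := measurable_fun setT g /\
  forall A, measurable A -> mu (g @^-1` A) = mu A.

Lemma mpres_comp g h : mpres g -> mpres h -> mpres (g \o h).
Proof.
move=> [mg Hg] [mh Hh]; split; first exact: measurableT_comp.
move=> A mA; rewrite comp_preimage Hh ?Hg//.
by rewrite -[X in measurable X]setTI; exact: mg.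
Qed.

Lemma mpres_mscales g : mpres g <-> mscales 1 g.
Proof.
by split=> -[mg Hg]; split => // A mA; rewrite Hg// mul1e.
Qed.

Lemma mpres_ge0_integral g (D : set T) (f : T -> \bar R) : mpres g ->
  measurable D -> measurable_fun D f -> (forall x, D x -> 0 <= f x)%E ->
  (\int[mu]_(x in g @^-1` D) f (g x) = \int[mu]_(x in D) f x)%E.
Proof.
move=> /mpres_mscales Hg mD mf f0.
by rewrite (mscales_ge0_integral ler01 Hg)// mul1e.
Qed.

Lemma mpres_integral g (D : set T) (f : T -> \bar R) : mpres g ->
  measurable D -> measurable_fun D f ->
  (\int[mu]_(x in g @^-1` D) f (g x) = \int[mu]_(x in D) f x)%E.
Proof.
move=> Hg mD mf; rewrite integralE [RHS]integralE; congr (_ - _)%E.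
  rewrite -[RHS](mpres_ge0_integral Hg mD (measurable_funepos mf)).
    by apply: eq_integral => x _; rewrite -[LHS]/(((f \o g)^\+)%E x) funepos_comp.
  by move=> x _; exact: funepos_ge0.
rewrite -[RHS](mpres_ge0_integral Hg mD (measurable_funeneg mf)).
    by apply: eq_integral => x _; rewrite -[LHS]/(((f \o g)^\-)%E x) funeneg_comp.
  by move=> x _; exact: funeneg_ge0.
Qed.

Lemma mpres_Rintegral g (D : set T) (f : T -> R) : mpres g ->
  measurable D -> measurable_fun D f ->
  \int[mu]_(x in g @^-1` D) f (g x) = \int[mu]_(x in D) f x.
Proof.
move=> Hg mD /measurable_EFinP mf; rewrite /Rintegral.
by rewrite -(mpres_integral Hg mD mf).
Qed.

End measure_preserving.

(** * Lebesgue measure under translations, shears, dilations and rotations *)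

Section planar.
Context (R : realType).
Local Notation T := (measurableTypeR R).
Local Notation leb := (@lebesgue_measure R).

Lemma mpres_translation (c : R) : mpres leb (fun x => x + c).
Proof.
have mt : measurable_fun setT (fun x : T => x + c : T).
  by apply: measurable_funD.
split=> // A mA; apply/esym.
apply: (@lebesgue_measure_unique R (pushforward leb (fun x : T => x + c : T))) => //.
move=> _ [[a b] _ <-]; transitivity (leb `]a - c, b - c]%classic).
  rewrite !lebesgue_measure_itv/= !lte_fin ltrD2r; case: ifP => // _.
  by rewrite -!EFinB; congr EFin; ring.
congr (leb _); apply/seteqP; split => x /=; rewrite !in_itv/= ltrBlDr lerBrDr//.
Qed.

End planar.

Section product_preserving.
Context d1 d2 (T1 : measurableType d1) (T2 : measurableType d2) (R : realType).
Variable m1 : {sigma_finite_measure set T1 -> \bar R}.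
Variable m2 : {sigma_finite_measure set T2 -> \bar R}.

(** The section over x of the preimage of A is the preimage under h x of the section of A over g x.
    The fibre factor k2 comes out of the integral and the base map gives k1. Letting h depend on x
    is what covers shears. *)
Lemma mscales_fiber (k1 k2 : R) (g : T1 -> T1) (h : T1 -> T2 -> T2) :
  0 <= k1 -> 0 <= k2 ->
  mscales m1 k1 g -> measurable_fun setT (fun p : T1 * T2 => h p.1 p.2) ->
  (forall x, mscales m2 k2 (h x)) ->
  mscales (prod_measure m1 m2) (k1 * k2) (fun p => (g p.1, h p.1 p.2)).
Proof.
move=> k10 k20 [mg Hg] mh Hh.
have mgh : measurable_fun setT (fun p : T1 * T2 => (g p.1, h p.1 p.2)).
  by apply: measurable_fun_pair => //; exact: measurableT_comp.
split=> // A mA; rewrite /prod_measure /product_measure1.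
have mA2 : measurable_fun setT (m2 \o xsection A) by exact: measurable_fun_xsection.
rewrite mulrC EFinM -muleA -(@mscales_ge0_integral _ _ _ m1 k1 g)//.
rewrite preimage_setT -ge0_integralZl//=; last exact: measurableT_comp mA2 mg.
apply: eq_integral => x _ /=.
rewrite -(Hh x).2; last exact: measurable_xsection.
congr (m2 _); apply/seteqP; split => y /=; rewrite /xsection /= !inE//.
Qed.

Lemma mpres_fiber (g : T1 -> T1) (h : T1 -> T2 -> T2) :
  mpres m1 g -> measurable_fun setT (fun p : T1 * T2 => h p.1 p.2) ->
  (forall x, mpres m2 (h x)) ->
  mpres (prod_measure m1 m2) (fun p => (g p.1, h p.1 p.2)).
Proof.
move=> /mpres_mscales Hg mh Hh; apply/mpres_mscales; rewrite -[X in mscales _ X](mulr1 1).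
by apply: mscales_fiber => // x; apply/mpres_mscales.
Qed.

End product_preserving.

Section planar_preserving.
Context (R : realType).
Local Notation T := (measurableTypeR R).
Local Notation leb := (@lebesgue_measure R).
Local Notation leb2 := (prod_measure leb leb).

Lemma mpres_shear2 (h : R -> R) : measurable_fun setT (h : T -> T) ->
  mpres leb2 (fun p : T * T => (p.1, p.2 + h p.1)).
Proof.
move=> mh; apply: (@mpres_fiber _ _ T T R leb leb id (fun x y => y + h x)).
- by split => // A mA.
- by apply: measurable_funD => //; exact: measurableT_comp.
- by move=> x; exact: mpres_translation.
Qed.

Lemma mscales_dilation (c : R) : 0 < c ->
  mscales leb c^-1 (fun x => c * x).
Proof.
move=> c0; have mt : measurable_fun setT (fun x : T => c * x : T) by exact: measurable_funM.
have c0' : 0 <= c by exact: ltW.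
split=> // A mA.
have [P PE] : exists P : {measure set T -> \bar R}, forall A,
    P A = leb ((fun x : T => c * x : T) @^-1` A).
  by unshelve eexists (pushforward leb (fun x : T => c * x : T)).
suff E : leb A = mscale (NngNum c0') P A.
  rewrite -[RHS]/(c^-1%:E * leb A)%E E.
  by rewrite /mscale /= PE muleA -EFinM mulVf ?mul1e// gt_eqF.
apply: lebesgue_measure_unique => //.
move=> _ [[a b] _ <-]; transitivity (c%:E * leb [set` `]a / c, b / c]%R])%E.
  rewrite !lebesgue_measure_itv/= !lte_fin ltr_pM2r ?invr_gt0//; case: ifP => _.
    by rewrite -!EFinB -EFinM; congr EFin; rewrite mulrBr !mulrA; field; rewrite gt_eqF.
  by rewrite mule0.
rewrite /= /mscale /= PE.
congr (_ * leb _)%E; apply/seteqP; split => x /=; rewrite !in_itv/=;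
  by rewrite ltr_pdivrMr// ler_pdivlMr// mulrC.
Qed.

Lemma mscales_dilation2 (c : R) : 0 < c ->
  mscales leb2 (c ^- 2) (fun p : T * T => (c * p.1, c * p.2)).
Proof.
move=> c0; rewrite expr2 invfM.
apply: (@mscales_fiber _ _ T T R leb leb _ _ (fun x => c * x) (fun _ y => c * y)).
- by rewrite invr_ge0 ltW.
- by rewrite invr_ge0 ltW.
- exact: mscales_dilation.
- by apply: measurable_funM => //.
- by move=> x; exact: mscales_dilation.
Qed.

Lemma mpres_swap : mpres leb2 (fun p : T * T => (p.2, p.1)).
Proof.
have ms : measurable_fun setT (fun p : T * T => (p.2, p.1)).
  exact: measurable_fun_pair.
split=> // A mA.
apply: (esym (@product_measure_unique _ _ T T R leb leb
  (pushforward leb2 (fun p : T * T => (p.2, p.1))) _ A mA)).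
move=> B D mB mD; transitivity (leb2 (D `*` B)).
  by congr (leb2 _); apply/seteqP; split => -[x y] /= [].
by rewrite /= /prod_measure product_measure1E// muleC.
Qed.

Lemma mpres_shear1 (h : R -> R) : measurable_fun setT (h : T -> T) ->
  mpres leb2 (fun p : T * T => (p.1 + h p.2, p.2)).
Proof.
move=> mh.
exact: (mpres_comp mpres_swap (mpres_comp (mpres_shear2 mh) mpres_swap)).
Qed.

Lemma mpres_translation2 (a b : R) :
  mpres leb2 (fun p : T * T => (p.1 + a, p.2 + b)).
Proof.
have h1 : mpres leb2 (fun p : T * T => (p.1 + a, p.2)).
  exact: (@mpres_shear1 (fun=> a)).
have h2 : mpres leb2 (fun p : T * T => (p.1, p.2 + b)).
  exact: (@mpres_shear2 (fun=> b)).
exact: (mpres_comp h1 h2).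
Qed.

Definition rot2 (u : R[i]) (p : T * T) : T * T :=
  (complex.Re u * p.1 - complex.Im u * p.2, complex.Im u * p.1 + complex.Re u * p.2).

Lemma rot2M u v p : rot2 u (rot2 v p) = rot2 (u * v) p.
Proof. by case: u v => [a b] [c d]; rewrite /rot2 /=; congr pair; ring. Qed.

Lemma mpres_rot2 u : normc u = 1 -> mpres leb2 (rot2 u).
Proof.
move=> u1; have key (v : R[i]) : normc v = 1 -> 1 + complex.Re v != 0 ->
    mpres leb2 (rot2 v).
  case: v => c s v1 /= c1; have cs : c ^+ 2 + s ^+ 2 = 1.
    by have := sqabsE (c +i* s)%C; rewrite v1 expr1n.
  (* The tangent of half the rotation angle. *)
  pose t := s / (1 + c).
  have mM (k : R) : measurable_fun setT (fun x : T => k * x : T) by exact: measurable_funM.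
  have H1 := mpres_shear1 (mM (- t)); have H2 := mpres_shear2 (mM s).
  (* a rotation by an angle other than pi is a product of three shears *)
  have := mpres_comp H1 (mpres_comp H2 H1).
  congr mpres; apply/funext => -[x y]; rewrite /rot2 /= /t.
  have s2 : s ^+ 2 = (1 - c) * (1 + c) by rewrite mulrDr mulr1 mulrBl mul1r; lra.
  have st : s * (s / (1 + c)) = 1 - c by rewrite mulrA -expr2 s2 mulfK.
  have tc : s / (1 + c) * (1 + c) = s by rewrite mulfVK.
  move: (s / (1 + c)) st tc => q st tc.
  have st' : q * s = 1 - c by rewrite mulrC.
  congr pair.
    rewrite [LHS](_ : _ = (1 - q * s) * x - q * (2 - s * q) * y); last by ring.
    rewrite st st' [_ * (2 - _)](_ : _ = q * (1 + c)); last by congr (_ * _); ring.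
    by rewrite tc; ring.
  rewrite [LHS](_ : _ = s * x + (1 - s * q) * y); last by ring.
  by rewrite st; ring.
(* Only u = -1 remains, the square of the rotation by i. *)
have [c1|c1] := eqVneq (1 + complex.Re u) 0; last exact: key.
have uN : u = 'i%C * 'i%C.
  case: u u1 c1 => c s /= u1 c1; have cN : c = -1 by lra.
  have := sqabsE (c +i* s)%C; rewrite /= u1 expr1n /sqabs /= cN => h.
  have /eqP : s ^+ 2 = 0 by lra.
  by rewrite sqrf_eq0 => /eqP ->; apply: complex_ext => /=; ring.
have -> : rot2 u = rot2 'i%C \o rot2 'i%C.
  by apply/funext => p /=; rewrite rot2M uN.
have i1 : normc ('i%C : R[i]) = 1 by rewrite /normc /= expr0n expr1n add0r sqrtr1.
by apply: mpres_comp; apply: key => //=; rewrite addr0 oner_eq0.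
Qed.

End planar_preserving.

Section tuple_preserving.
Context d (T : measurableType d) (R : realType).
Variable mu : {sigma_finite_measure set T -> \bar R}.

Lemma mscales_tuple n (k : R) (g : 'I_n -> T -> T) : 0 <= k ->
  (forall i, mscales mu k (g i)) ->
  mscales (power_measure mu n) (k ^+ n)
    (fun t : n.-tuple T => [tuple g i (tnth t i) | i < n]).
Proof.
move=> k0; elim: n g => [|n IH] g Hg.
  have -> : (fun t : 0.-tuple T => [tuple g i (tnth t i) | i < 0]) = id.
    by apply/funext => t; apply/eq_from_tnth => -[].
  by split=> // A mA; rewrite expr0 mul1e.
pose G t := [tuple g i (tnth t i) | i < n.+1].
pose h t := [tuple g (lift ord0 i) (tnth t i) | i < n].
have {}IH : mscales (power_measure mu n) (k ^+ n) h := IH _ (fun i => Hg (lift ord0 i)).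
have Gcons p : G (tcons p) = tcons (g ord0 p.1, h p.2).
  apply/eq_from_tnth => i; rewrite tnth_mktuple.
  have [j ->|->] := unliftP ord0 i; last by [].
  by rewrite /tcons !tnthS /= /h tnth_mktuple.
have mG : measurable_fun setT G.
  apply/measurable_fun_tnthP => i.
  have -> : (@tnth _ _)^~ i \o G = g i \o (@tnth _ _)^~ i.
    by apply/funext => t /=; rewrite tnth_mktuple.
  by apply: measurableT_comp; [exact: (Hg i).1|exact: measurable_tnth].
split=> // A mA.
rewrite /= /cons_measure /pushforward.
have Hp : mscales (prod_measure mu (power_measure mu n)) (k * k ^+ n)
    (fun p => (g ord0 p.1, h p.2)).
  apply: (@mscales_fiber _ _ T (n.-tuple T) R mu (power_measure mu n) k (k ^+ n)
    (g ord0) (fun _ => h)) => //.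
    by rewrite exprn_ge0.
  by apply: measurableT_comp => //; exact: IH.1.
rewrite exprS -Hp.2; last first.
  by rewrite -[X in measurable X]setTI; exact: (@measurable_tcons _ T n measurableT A mA).
by congr (prod_measure _ _ _); apply/seteqP; split => p /=; rewrite -/(G _) Gcons.
Qed.

Lemma mpres_tuple n (g : 'I_n -> T -> T) : (forall i, mpres mu (g i)) ->
  mpres (power_measure mu n) (fun t : n.-tuple T => [tuple g i (tnth t i) | i < n]).
Proof.
move=> Hg; apply/mpres_mscales; rewrite -[X in mscales _ X](expr1n _ n).
by apply: mscales_tuple => // i; apply/mpres_mscales.
Qed.

End tuple_preserving.

(** * Integrability of powers by dyadic level sets *)

Section layer_cake.
Context d (X : measurableType d) (R : realType) (mu : {measure set X -> \bar R}).

(** For lambda >= 0 the integrand is at most 1. For lambda < 0 put q = 2 ^ (- lambda): between the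
    levels 2 ^- j.+1 and 2 ^- j the integrand is at most q ^ j.+1, on a set of measure at most K 2
    ^- j. The series is geometric of ratio q / 2, and q < 2 is the condition -1 < lambda. *)
Lemma integral_powR_lty (D : set X) (u : X -> R) (K lambda : R) :
  measurable D -> measurable_fun D u -> (forall x, D x -> 0 < u x <= 1) ->
  0 <= K -> -1 < lambda ->
  (forall s, 0 < s <= 1 -> (mu (D `&` [set x | (u x <= s)%R]) <= (K * s)%:E)%E) ->
  (\int[mu]_(x in D) (u x `^ lambda)%:E < +oo)%E.
Proof.
move=> mD mu_ u01 K0 l1 Hs.
have mp : measurable_fun D (fun x => (u x `^ lambda)%:E).
  by apply/measurable_EFinP; apply: (measurableT_comp (measurable_powR _)).
have [l0|l0] := leP 0 lambda.
  apply: (@le_lt_trans _ _ (\int[mu]_(x in D) (cst 1%:E x))%E).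
    apply: ge0_le_integral => //.
    - by move=> x _; rewrite lee_fin powR_ge0.
    - move=> x /u01/andP[ux0 ux1] /=; rewrite lee_fin.
      rewrite -[leRHS](powRr0 (u x)); apply: ger_powR => //.
      by rewrite ux0.
  rewrite integral_cst// mul1e (le_lt_trans _ (ltry (K * 1)))//.
  have := Hs 1; rewrite ltr01 lexx => /(_ isT); apply: le_trans.
  apply: le_measure; rewrite ?inE//; last by move=> x Dx; split => //=; case/andP: (u01 x Dx).
  rewrite (_ : _ `&` _ = D)//; apply/seteqP; split => [x []//|x Dx].
  by split => //=; case/andP: (u01 x Dx).
pose q : R := 2 `^ (- lambda).
have q0 : 0 < q by rewrite powR_gt0.
have q2 : q < 2.
  rewrite -[ltRHS](powRr1 (a := 2))// /q.
  rewrite /powR !ifF ?pnatr_eq0// ltr_expR ltr_pM2r; first by lra.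
  by rewrite ln_gt0// ltr1n.
pose g (j : nat) (x : X) : \bar R :=
  ((q ^+ j.+1) * \1_(D `&` [set x | (u x <= 2 ^- j)%R]) x)%:E.
have mDj j : measurable (D `&` [set x | (u x <= 2 ^- j)%R]).
  rewrite (_ : [set x | _] = u @^-1` `]-oo, 2 ^- j]%classic); last first.
    by apply/seteqP; split => x /=; rewrite in_itv.
  exact: mu_.
have g0 j x : (0 <= g j x)%E.
  by rewrite lee_fin mulr_ge0// exprn_ge0// ltW.
have mg j : measurable_fun D (g j).
  by apply/measurable_EFinP; apply: measurable_funM => //; exact: measurable_indic.
apply: (@le_lt_trans _ _ (\int[mu]_(x in D) (\sum_(j <oo) g j x))%E).
  apply: ge0_le_integral => //.
  - by move=> x _; rewrite lee_fin powR_ge0.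
  - by apply: ge0_emeasurable_sum.
  - move=> x Dx; have /andP[ux0 ux1] := u01 x Dx.
    have ex : exists N, 2 ^- N < u x.
      exists (Num.bound (u x)^-1); rewrite invf_plt ?posrE// ?exprn_gt0//.
      apply: (@lt_trans _ _ (Num.bound (u x)^-1)%:R).
        by apply: archi_boundP; rewrite invr_ge0 ltW.
      by rewrite -natrX ltr_nat ltn_expl.
    (* The least N with 2 ^- N < u x is positive because u x <= 1; writing it j.+1 puts x in the
       j-th level set, whose term alone dominates the integrand. *)
    case: (ex_minnP ex) => -[|j] Hj minj.
      by move: Hj; rewrite expr0 invr1 ltNge ux1.
    have uj : u x <= 2 ^- j.
      by rewrite leNgt; apply/negP => /minj; rewrite ltnn.
    apply: (@le_trans _ _ (g j x)); last first.
      apply: le_trans (nneseries_lim_ge j.+1 _) => //.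
      by rewrite big_nat_recr//= leeDr// sume_ge0.
    rewrite lee_fin indicE mem_set ?mulr1; last by split.
    have -> : q ^+ j.+1 = ((2 ^- j.+1) `^ (- lambda))^-1.
      rewrite -powR_invn// -powRrM mulNr mulrN opprK -powR_mulrn ?powR_ge0//.
      by rewrite /q -powRrM -powRN mulNr mulrC.
    rewrite -[in leLHS](opprK lambda) [leLHS]powRN lef_pV2 ?posrE ?powR_gt0//.
    apply: ge0_ler_powR; rewrite ?nnegrE ?oppr_ge0 ?invr_ge0 ?exprn_ge0 ?(ltW l0)//.
      exact: ltW.
    exact: ltW.
rewrite integral_nneseries//.
have q21 : q / 2 < 1 by rewrite ltr_pdivrMr// mul1r.
have q1 : 0 < 1 - q / 2 by rewrite subr_gt0.
apply: (@le_lt_trans _ _ (q * K / (1 - q / 2))%:E); last exact: ltry.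
apply: lime_le.
  by apply: is_cvg_nneseries => j _ _; exact: integral_ge0.
apply: nearW => N.
apply: (@le_trans _ _ (\sum_(0 <= j < N) (q * K * (q / 2) ^+ j)%:E)%E).
  apply: lee_sum => j _.
  rewrite /g; under eq_integral do rewrite EFinM.
  have mI : measurable_fun D (fun x => (\1_(D `&` [set x | (u x <= 2 ^- j)%R]) x)%:E : \bar R).
    by apply/measurable_EFinP; exact: measurable_indic.
  rewrite ge0_integralZl// ?lee_fin ?exprn_ge0 ?(ltW q0)//.
  rewrite integral_indic// setIAC setIid.
  have /Hs h : 0 < (2 ^- j : R) <= 1.
    rewrite invr_gt0 exprn_gt0//= invf_le1 ?exprn_gt0// exprn_ege1// ler1n//.
  apply: (@le_trans _ _ ((q ^+ j.+1)%:E * (K * 2 ^- j)%:E)%E).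
    by rewrite lee_pmul2l// lte_fin exprn_gt0.
  by rewrite -EFinM lee_fin exprS exprMn exprVn le_eqVlt; apply/orP; left; apply/eqP; ring.
rewrite sumEFin lee_fin -mulr_sumr; apply: ler_wpM2l.
  by rewrite mulr_ge0// ltW.
rewrite -[leRHS]mul1r ler_pdivlMr// big_mkord mulrC.
have := subrX1 (q / 2) N; rewrite -opprB => /eqP; rewrite eqr_oppLR -mulNr opprB => /eqP <-.
by rewrite lerBlDr lerDl exprn_ge0// divr_ge0// ltW.
Qed.

End layer_cake.

(** * Positivity of the Gamma function *)

Section gamma_function.
Context (R : realType).
Local Notation mu := (@lebesgue_measure R).

(** Half of the exponential absorbs the power: with k > |x - 1|, the inequality 1 + y <= exp y at y
    = t / (2 k), raised to the power k, bounds t ^ k by (2 k) ^ k exp (t / 2). *)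
Lemma expRN_powR_le (x : R) : exists2 K : R, 0 < K & forall t, 1 < t ->
  t `^ (x - 1) * expR (- t) <= K * expR (- (t / 2)).
Proof.
pose k := (Num.bound `|x - 1|).+1.
have k0 : 0 < k%:R :> R by rewrite ltr0n.
exists ((2 * k%:R) ^+ k); first by rewrite exprn_gt0// mulr_gt0.
move=> t t1; have t0 : 0 < t by rewrite (lt_trans ltr01).
have xk : t `^ (x - 1) <= t ^+ k.
  rewrite -powR_mulrn ?(ltW t0)// ler_powR ?(ltW t1)//.
  rewrite (le_trans (ler_norm _))// ltW// (lt_trans (archi_boundP _))// ltr_nat.
  exact: ltnSn.
have et : t ^+ k <= (2 * k%:R) ^+ k * expR (t / 2).
  have -> : expR (t / 2) = expR (t / (2 * k%:R)) ^+ k.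
    by rewrite -expRM_natl; congr expR; field; rewrite gt_eqF.
  have k20 : 0 <= 2 * k%:R :> R by rewrite mulr_ge0// ltW.
  rewrite -exprMn; apply: lerXn2r.
  - by rewrite nnegrE ltW.
  - by rewrite nnegrE mulr_ge0 ?expR_ge0.
  apply: (@le_trans _ _ ((2 * k%:R) * (1 + t / (2 * k%:R)))).
    rewrite mulrDr mulr1 mulrCA mulfV ?mulr1 ?lerDr//.
    by rewrite gt_eqF// mulr_gt0.
  by rewrite ler_wpM2l ?expR_ge1Dx.
have -> : expR (- t) = expR (- (t / 2)) * expR (- (t / 2)).
  by rewrite -expRD; congr expR; lra.
rewrite mulrA ler_wpM2r ?expR_ge0//.
apply: (le_trans (ler_wpM2r (expR_ge0 _) (le_trans xk et))).
by rewrite -mulrA -expRD subrr expR0 mulr1.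
Qed.

(** The integrand is twice the density of the exponential law of rate 1 / 2. *)
Lemma integral_expR_half_lty : (\int[mu]_(t in `]1%R, +oo[) (expR (- (t / 2)))%:E < +oo)%E.
Proof.
have h2 : 0 < 2^-1 :> R by rewrite invr_gt0.
have := integral_exponential_pdf h2 => H.
apply: (@le_lt_trans _ _ (\int[mu]_(t in `]1%R, +oo[) (2%:E * (exponential_pdf (2^-1) t)%:E))%E).
  apply: ge0_le_integral => //.
  - by apply/measurable_EFinP; apply: measurableT_comp => //; apply: measurableT_comp => //; exact: measurable_funM.
  - by apply: emeasurable_funM => //; apply/measurable_EFinP; apply: measurable_funTS; exact: measurable_exponential_pdf.
  - move=> t; rewrite /= in_itv/= andbT => t1; rewrite -EFinM lee_fin.
    rewrite /exponential_pdf patchE mem_set /= ?in_itv/= ?andbT; last first.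
      by rewrite ltW// (lt_trans _ t1).
    by rewrite mulrA mulfV// mul1r mulNr (mulrC t).
have mE : measurable_fun setT (fun t : R => (exponential_pdf (2^-1) t)%:E).
  by apply/measurable_EFinP; exact: measurable_exponential_pdf.
have mE1 (D : set (measurableTypeR R)) : measurable_fun D (fun t : measurableTypeR R => (exponential_pdf (2^-1) t)%:E).
  exact: measurable_funTS.
have E0 t : (0 <= (exponential_pdf 2^-1 t)%:E)%E.
  by rewrite lee_fin exponential_pdf_ge0// ltW.
rewrite ge0_integralZl//.
rewrite lte_mul_pinfty//; apply: (@le_lt_trans _ _ 1%E); last exact: ltry.
by rewrite -H; apply: ge0_subset_integral.
Qed.

(** [Gamma] is the [fine] value of an extended integral, which would be 0 if the integral were
    infinite; so finiteness is part of the claim. Near 0 it is the layer-cake estimate with exponent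
    x - 1 > -1, at infinity an exponential bound. *)
Lemma Gamma_gt0 (x : R) : 0 < x -> 0 < Gamma x.
Proof.
move=> x0; pose f (t : R) := t `^ (x - 1) * expR (- t).
have mf : measurable_fun setT (fun t : R => (f t)%:E).
  apply/measurable_EFinP; apply: measurable_funM; first exact: measurable_powR.
  by apply: measurableT_comp => //; exact: measurable_oppr.
have f0 t : (0 <= (f t)%:E)%E by rewrite lee_fin mulr_ge0 ?powR_ge0 ?expR_ge0.
have U : `]0%R, +oo[%classic = `]0%R, 1%R] `|` `]1%R, +oo[ :> set R.
  apply/seteqP; split=> t /=; rewrite !in_itv/= !andbT.
    by move=> t0; have [t1|t1] := leP t 1; [left; rewrite t0|right].
  by move=> [/andP[]//|]; exact: lt_trans.
have foo : (\int[mu]_(t in `]0%R, +oo[) (f t)%:E < +oo)%E.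
  rewrite U ge0_integral_setU//; last 2 first.
  - exact: measurable_funTS.
  - apply/disj_setPS => t [] /=; rewrite !in_itv/= andbT => /andP[_ t1].
    by rewrite ltNge t1.
  apply: lte_add_pinfty.
    apply: (@le_lt_trans _ _ (\int[mu]_(t in `]0%R, 1%R]) (t `^ (x - 1))%:E)%E).
      apply: ge0_le_integral => //.
      + exact: measurable_funTS.
      + by apply/measurable_EFinP; apply: measurable_funTS; exact: measurable_powR.
      + move=> t; rewrite /= in_itv/= => /andP[t0 _]; rewrite lee_fin.
        by rewrite ler_piMr ?powR_ge0// -expR0 ler_expR oppr_le0 ltW.
    apply: (@integral_powR_lty _ _ _ mu _ idfun 1) => //.
    - exact: measurable_id.
    - by rewrite ltrBrDr addrC subrr.
    - move=> s /andP[s0 s1]; rewrite mul1r.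
      apply: (@le_trans _ _ (mu `]0%R, s]%classic)).
        apply: le_measure; rewrite ?inE//.
          apply: measurableI => //.
          by have := @measurable_itv R `]-oo, s]; congr measurable; apply/seteqP; split => t /=; rewrite in_itv.
        by move=> t [] /=; rewrite !in_itv/= => /andP[-> _].
      by rewrite lebesgue_measure_itv/= lte_fin s0 sube0.
  have [K K0 HK] := expRN_powR_le x.
  apply: (@le_lt_trans _ _ (\int[mu]_(t in `]1%R, +oo[) (K%:E * (expR (- (t / 2)))%:E))%E).
    apply: ge0_le_integral => //.
    + exact: measurable_funTS.
    + apply: emeasurable_funM => //; apply/measurable_EFinP; apply: measurableT_comp => //.
      by apply: measurableT_comp => //; exact: measurable_funM.
    + by move=> t; rewrite /= in_itv/= andbT => t1; rewrite lee_fin HK.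
  have mE1 (D : set (measurableTypeR R)) : measurable_fun D (fun t : measurableTypeR R => (expR (- (t / 2)))%:E).
    apply/measurable_EFinP; apply: measurableT_comp => //.
    by apply: measurableT_comp => //; exact: measurable_funM.
  have E0 t : (0 <= (expR (- (t / 2)) : R)%:E)%E by rewrite lee_fin expR_ge0.
  rewrite ge0_integralZl// ?lee_fin ?(ltW K0)//.
  by rewrite lte_mul_pinfty ?lee_fin ?(ltW K0)//; exact: integral_expR_half_lty.
rewrite /Gamma /Rintegral fine_gt0// foo andbT.
(* A lower bound of the integrand on ]1, 2], valid for either sign of x - 1. *)
pose c : R := (2 `^ `|x - 1|)^-1 * expR (- 2).
have c0 : 0 < c by rewrite mulr_gt0 ?expR_gt0// invr_gt0 powR_gt0.
apply: (@lt_le_trans _ _ (\int[mu]_(t in `]1%R, 2%R]) (cst c%:E t))%E).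
  by rewrite integral_cst//= lebesgue_measure_itv/= lte_fin ltr1n -EFinD -EFinM lte_fin mulr_gt0// subr_gt0 ltr1n.
apply: (@le_trans _ _ (\int[mu]_(t in `]1%R, 2%R]) (f t)%:E)%E).
  apply: ge0_le_integral => //.
  - by move=> t _; rewrite lee_fin ltW.
  - exact: measurable_funTS.
  - move=> t; rewrite /= in_itv/= => /andP[t1 t2]; rewrite lee_fin.
    have t0 : 0 < t by rewrite (lt_trans _ t1).
    rewrite ler_pM ?invr_ge0 ?powR_ge0 ?expR_ge0// ?ler_expR ?lerN2//.
    apply: (@le_trans _ _ (t `^ (- `|x - 1|))).
      rewrite powRN lef_pV2 ?posrE ?powR_gt0//.
      by apply: ge0_ler_powR; rewrite ?nnegrE// ltW.
    by rewrite ler_powR ?(ltW t1)// lerNl (le_trans (ler_norm _))// normrN.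
apply: ge0_subset_integral => //; first exact: measurable_funTS.
by move=> t /=; rewrite !in_itv/= andbT => /andP[t1 _]; rewrite (lt_trans _ t1).
Qed.

End gamma_function.

Section boxes.
Context d (T : measurableType d) (R : realType).
Variable mu : {sigma_finite_measure set T -> \bar R}.

Definition box n (A : set T) : set (n.-tuple T) := [set t | forall i, A (tnth t i)].

Lemma measurable_box n A : measurable A -> measurable (@box n A).
Proof.
move=> mA; rewrite (_ : box _ = \bigcap_(i in [set: 'I_n]) ((fun t => tnth t i) @^-1` A)).
  apply: fin_bigcap_measurable => // i _.
  by rewrite -[X in measurable X]setTI; exact: measurable_tnth.
by apply/seteqP; split => [t H i _|t H i]; [exact: H|exact: (H i I)].
Qed.

Lemma power_measure_box n A (a : R) : measurable A -> mu A = a%:E ->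
  power_measure mu n (box A) = (a ^+ n)%:E.
Proof.
move=> mA muA; elim: n => [|n IH].
  by rewrite /= diracE mem_set// => -[].
rewrite /= /cons_measure /pushforward.
transitivity (prod_measure mu (power_measure mu n) (A `*` box A)).
  congr (prod_measure _ _ _); apply/seteqP; split=> -[x t] /=.
    move=> H; split; first exact: (H ord0).
    by move=> i; have := H (lift ord0 i); rewrite tnthS.
  move=> [Ax Ht] i; have [j ->|->] := unliftP ord0 i; last by [].
  by rewrite tnthS; exact: Ht.
rewrite /prod_measure product_measure1E//; last exact: measurable_box.
by rewrite [X in (X * _)%E]muA [X in (_ * X)%E]IH -EFinM exprS.
Qed.

End boxes.

(** * Volume of the ball and integrability of the weight *)

Section ball_measure.
Context (R : realType) (n : nat).
Local Notation C := R[i].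
Local Notation Cn := 'cV[C]_n.
Local Notation T := (measurableTypeR R).
Local Notation leb := (@lebesgue_measure R).
Local Notation leb2 := (prod_measure leb leb).
Local Notation R2n := (n.-tuple (T * T)%type).
Local Notation V := (vol R n).

Definition disc (e : R) : set (T * T) := [set p | (p.1 ^+ 2 + p.2 ^+ 2 < e ^+ 2)%R].

Lemma measurable_disc e : measurable (disc e).
Proof.
have m : measurable_fun setT (fun p : T * T => p.1 ^+ 2 + p.2 ^+ 2 : T).
  by apply: measurable_funD; apply: measurable_funX.
have := m measurableT `]-oo, e ^+ 2[%classic (measurable_itv _).
by rewrite setTI; congr measurable; apply/seteqP; split => p /=; rewrite in_itv.
Qed.

(** The disc lies between the squares of half-sides e / 2 and e, which gives positivity and
    finiteness. *)
Lemma disc_measure (e : R) : 0 < e -> exists2 a : R, 0 < a & leb2 (disc e) = a%:E.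
Proof.
move=> e0; have md := measurable_disc e.
have sq (a : R) : 0 < a ->
    leb2 (`]- a, a[%classic `*` `]- a, a[%classic) = ((2 * a) ^+ 2)%:E.
  move=> a0; rewrite /prod_measure product_measure1E//= !lebesgue_measure_itv/= lte_fin gtrN//.
  by rewrite opprK -EFinD -EFinM expr2; congr EFin; ring.
have lb : (((2 * (e / 2)) ^+ 2)%R%:E <= leb2 (disc e))%E.
  rewrite -sq ?divr_gt0//; apply: le_measure; rewrite ?inE//.
    exact: measurableX.
  move=> -[x y] [] /=; rewrite !in_itv/= => hx hy; rewrite /disc /=.
  have h (u : R) : (- (e / 2) < u < e / 2)%R -> (u ^+ 2 <= (e / 2) ^+ 2)%R.
    by move=> ?; rewrite -ler_sqrt ?sqr_ge0// !sqrtr_sqr (ger0_norm (ltW (divr_gt0 e0 _)))// ler_norml; apply/andP; split; lra.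
  have := h _ hx; have := h _ hy; rewrite !expr2; have := mulr_gt0 e0 e0; lra.
have ub : (leb2 (disc e) <= ((2 * e) ^+ 2)%:E)%E.
  rewrite -sq//; apply: le_measure; rewrite ?inE//; first exact: measurableX.
  move=> -[x y]; rewrite /disc /= => H; rewrite !in_itv/=.
  have h (u v : R) : (u ^+ 2 + v ^+ 2 < e ^+ 2)%R -> (- e < u < e)%R.
    move=> ?; rewrite -ltr_norml -[ltRHS](ger0_norm (ltW e0)) -!sqrtr_sqr ltr_sqrt ?exprn_gt0//.
    by have := sqr_ge0 v; lra.
  by split; [exact: h H|apply: (h _ x); rewrite addrC].
have fin : leb2 (disc e) \is a fin_num.
  by rewrite ge0_fin_numE ?measure_ge0// (le_lt_trans ub)// ltry.
exists (fine (leb2 (disc e))); last by rewrite fineK.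
rewrite -lte_fin fineK//; apply: lt_le_trans lb.
by rewrite lte_fin exprn_gt0// mulr_gt0// divr_gt0.
Qed.

Definition polydisc e : set R2n := box (disc e).

Lemma measurable_polydisc e : measurable (polydisc e).
Proof. by apply: measurable_box; exact: measurable_disc. Qed.

Lemma polydisc_measure (e : R) : 0 < e -> exists2 a : R, 0 < a & V (polydisc e) = a%:E.
Proof.
move=> /disc_measure[a a0 Ha]; exists (a ^+ n); first exact: exprn_gt0.
by apply: power_measure_box => //; exact: measurable_disc.
Qed.

Lemma sqnorm_ge0 (z : Cn) : 0 <= sqnorm z.
Proof. by apply: sumr_ge0 => i _; exact: sqabs_ge0. Qed.

Lemma le_sqnorm (z : Cn) i : sqabs (z i 0) <= sqnorm z.
Proof. by rewrite /sqnorm (bigD1 i)//= lerDl sumr_ge0// => j _; exact: sqabs_ge0. Qed.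

Definition coords (z : Cn) : R2n := [tuple (complex.Re (z i 0), complex.Im (z i 0)) | i < n].

Lemma of_real_coordsK t : coords (of_real_coords t) = t.
Proof.
by apply/eq_from_tnth => i; rewrite tnth_mktuple mxE /=; case: (tnth t i).
Qed.

Lemma vol_ball_fin : exists2 a : R, 0 <= a & V (@ball_coords R n) = a%:E.
Proof.
have mB := @measurable_ball_coords R n.
have [a a0 Ha] := polydisc_measure ltr01.
have ub : (V (@ball_coords R n) <= a%:E)%E.
  rewrite -Ha; apply: le_measure; rewrite ?inE//; first exact: measurable_polydisc.
  move=> t /= tB i; rewrite /disc /= expr1n.
  by apply: le_lt_trans tB; have := le_sqnorm (of_real_coords t) i; rewrite mxE.
have fin : V (@ball_coords R n) \is a fin_num.
  by rewrite ge0_fin_numE ?measure_ge0// (le_lt_trans ub)// ltry.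
by exists (fine (V (@ball_coords R n))); [rewrite fine_ge0// measure_ge0|rewrite fineK].
Qed.

Definition tmap (g : 'I_n -> T * T -> T * T) (t : R2n) : R2n :=
  [tuple g i (tnth t i) | i < n].

Lemma vol_dilation (c : R) : 0 < c ->
  mscales V (c ^- 2 ^+ n) (tmap (fun _ p => (c * p.1, c * p.2))).
Proof.
move=> c0; apply: mscales_tuple.
  by rewrite invr_ge0 sqr_ge0.
by move=> i; exact: mscales_dilation2.
Qed.

Lemma of_real_coords_tmap g (t : R2n) i :
  of_real_coords (tmap g t) i 0 =
  ((g i (tnth t i)).1 +i* (g i (tnth t i)).2)%C.
Proof. by rewrite mxE tnth_mktuple. Qed.

Lemma bernoulli_ineq (s : R) : 0 <= s <= 1 -> 1 - n%:R * s <= (1 - s) ^+ n.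
Proof.
move=> /andP[s0 s1]; elim: n => [|k IH]; first by rewrite mul0r subr0 expr0.
rewrite exprS -natr1 mulrDl mul1r.
have h : (1 - s) * (1 - k%:R * s) <= (1 - s) * (1 - s) ^+ k.
  by rewrite ler_wpM2l// subr_ge0.
apply: le_trans h; have : 0 <= s * (k%:R * s) by rewrite !mulr_ge0.
move: (k%:R * s) => q; lra.
Qed.

(** Removing the shell leaves the ball of squared radius 1 - s, whose volume is (1 - s) ^ n a by
    dilation in 2 n real dimensions; Bernoulli's inequality bounds the difference by n a s. *)
Lemma vol_shell (s a : R) : 0 < s <= 1 -> V (@ball_coords R n) = a%:E ->
  (V (@ball_coords R n `&` [set t | (1 - sqnorm (of_real_coords t) <= s)%R]) <=
   (n.+1%:R * a * s)%:E)%E.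
Proof.
move=> /andP[s0 s1] Ha.
have a0 : 0 <= a by rewrite -lee_fin -Ha measure_ge0.
have mB := @measurable_ball_coords R n.
set S := [set t : R2n | _].
have mS : measurable S.
  have m : measurable_fun setT (fun t : R2n => 1 - sqnorm (of_real_coords t) : T).
    by apply: measurable_funB => //; exact: measurable_sqnorm.
  have := m measurableT `]-oo, s]%classic (measurable_itv _).
  by rewrite setTI; congr measurable; apply/seteqP; split => p /=; rewrite in_itv.
(* At s = 1 the shell is the whole ball and no inner ball is left to dilate; the factor n + 1 in
   place of n covers this case even for n = 0. *)
have [->|s1'] := eqVneq s 1.
  apply: (@le_trans _ _ (V (@ball_coords R n))).
    by apply: le_measure; rewrite ?inE//; exact: measurableI.
  by rewrite Ha lee_fin mulr1 ler_peMl// ler1n.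
have {}s1 : 0 < 1 - s by rewrite subr_gt0 lt_neqAle s1'.
pose c := (Num.sqrt (1 - s))^-1.
have c0 : 0 < c by rewrite invr_gt0 sqrtr_gt0.
have c2 : c ^- 2 = 1 - s by rewrite /c exprVn invrK sqr_sqrtr// ltW.
have [_ /(_ _ mB)] := vol_dilation c0.
set D := tmap _ @^-1` _ => HD.
have DE : D = @ball_coords R n `\` S.
  have E (t : R2n) : sqnorm (of_real_coords (tmap (fun _ p => (c * p.1, c * p.2)) t)) =
      (1 - s)^-1 * sqnorm (of_real_coords t).
    rewrite /sqnorm mulr_sumr; apply: eq_bigr => i _.
    by rewrite of_real_coords_tmap mxE /sqabs /= !exprMn -mulrDr -c2 invrK.
  have D1 (t : R2n) : D t <-> sqnorm (of_real_coords t) < 1 - s.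
    rewrite /D /ball_coords /= /unit_ball /= E mulrC ltr_pdivrMr// mul1r//.
  apply/seteqP; split=> t.
    move=> /D1 ht; split; rewrite /ball_coords /unit_ball /S /=; first by lra.
    by apply/negP; rewrite -ltNge; lra.
  move=> [_ /negP]; rewrite /S /= -ltNge => ht; apply/D1; lra.
have H0 : a%:E = (((1 - s) ^+ n * a)%:E + V (@ball_coords R n `&` S))%E.
  rewrite -{1}Ha; apply: (etrans (measureDI V mB mS)); congr (_ + _)%E.
  by rewrite -DE; apply: (etrans HD); rewrite c2 EFinM -Ha.
have VS : V (@ball_coords R n `&` S) \is a fin_num.
  rewrite ge0_fin_numE ?measure_ge0//.
  apply: (@le_lt_trans _ _ (V (@ball_coords R n))); last by rewrite Ha ltry.
  by apply: le_measure; rewrite ?inE//; exact: measurableI.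
move: H0; rewrite -(fineK VS) -EFinD => -[h]; rewrite lee_fin.
have sb : 0 <= s <= 1 by apply/andP; split; lra.
have := bernoulli_ineq sb; move: h; set v := fine _; rewrite -natr1.
set q := (1 - s) ^+ n => h hq.
have : 0 <= a * (q - (1 - n%:R * s)) by rewrite mulr_ge0// subr_ge0.
have := mulr_ge0 a0 (ltW s0).
have -> : v = a - q * a by rewrite {1}h addrAC subrr add0r.
move: (n%:R) => N; lra.
Qed.

(** The layer-cake estimate for u = 1 - |z| ^ 2, whose level sets are the shells of [vol_shell]. *)
Lemma weight_integrable (lambda : R) : -1 < lambda ->
  (\int[V]_(t in @ball_coords R n) (weight lambda (of_real_coords t))%:E < +oo)%E.
Proof.
move=> l1; have mB := @measurable_ball_coords R n.
rewrite /weight; under eq_integral do rewrite EFinM.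
set k := Gamma _ / _.
have k0 : 0 <= k.
  have := weight_ge0 lambda (0 : Cn); rewrite /weight -/k /sqnorm big1 ?subr0 ?powR1 ?mulr1//.
  by move=> i _; rewrite mxE /sqabs /= expr0n addr0.
have msq : measurable_fun (@ball_coords R n) (fun t => 1 - sqnorm (of_real_coords t) : T).
  by apply: measurable_funB => //; apply: measurable_funTS; exact: measurable_sqnorm.
rewrite ge0_integralZl//; last 2 first.
- by apply/measurable_EFinP; apply: (measurableT_comp (measurable_powR _)).
- by move=> t _; rewrite lee_fin powR_ge0.
rewrite lte_mul_pinfty ?lee_fin//.
have [a a0 Ha] := vol_ball_fin.
apply: (@integral_powR_lty _ _ _ V _ _ (n.+1%:R * a)) => //.
- move=> t; rewrite /ball_coords /= /unit_ball /= => t1.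
  by rewrite subr_gt0 t1 lerBlDr lerDl sqnorm_ge0.
- by rewrite mulr_ge0.
- by move=> s s01; exact: vol_shell.
Qed.

Lemma weight_gt0 (lambda : R) z : -1 < lambda -> unit_ball z ->
  0 < weight lambda (z : Cn).
Proof.
move=> l1 Bz; rewrite /weight mulr_gt0 ?powR_gt0 ?subr_gt0//.
rewrite divr_gt0// ?mulr_gt0 ?exprn_gt0 ?pi_gt0//.
  by apply: Gamma_gt0; rewrite -addrA ltr_wpDl// -ltrBlDr sub0r.
by apply: Gamma_gt0; rewrite -ltrBlDr sub0r.
Qed.

End ball_measure.

Lemma mul_le_sqr (R : realDomainType) (a b : R) :
  0 <= a -> 0 <= b -> a * b <= a ^+ 2 + b ^+ 2.
Proof.
move=> a0 b0; have h1 := mulr_ge0 a0 b0; have h2 := sqr_ge0 (a - b).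
by rewrite !expr2 in h2 *; lra.
Qed.

(** * The space L^2(v_lambda) and its diagonal rotations *)

Section weighted_L2.
Context (R : realType) (n : nat) (lambda : R).
Local Notation C := R[i].
Local Notation Cn := 'cV[C]_n.
Local Notation R2n := (n.-tuple (measurableTypeR R * measurableTypeR R)%type).
Local Notation V := (vol R n).
Local Notation B := (@ball_coords R n).
Local Notation X := (@of_real_coords R n).
Local Notation W t := (weight lambda (X t)).
Local Notation L2 := (@L2 R n lambda).
Local Notation inner := (@inner R n lambda).
Implicit Types f g h : Cn -> C.

Let mB : measurable B := @measurable_ball_coords R n.
Let mW : measurable_fun B (fun t => W t) := measurable_weight lambda.
Let W0 t : 0 <= W t := weight_ge0 lambda (X t).

Let WS0 f t : 0 <= W t * sqabs (f (X t)).
Proof. by apply: mulr_ge0; [exact: W0|exact: sqabs_ge0]. Qed.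

Let aeS (P Q : R2n -> Prop) : (forall t, P t -> Q t) ->
  {ae V, forall t, P t} -> {ae V, forall t, Q t}.
Proof. by move=> PQ; apply: negligibleS => t /= nQ /PQ. Qed.

Lemma ball_measurable_sqabs f : ball_measurable f ->
  measurable_fun B (fun t => W t * sqabs (f (X t))).
Proof.
move=> [mR mI]; apply: measurable_funM => //.
by apply: measurable_funD; exact: measurable_funX.
Qed.

Lemma ball_measurableM f g : ball_measurable f -> ball_measurable g ->
  ball_measurable (fun z => f z * g z).
Proof.
move=> [mRf mIf] [mRg mIg]; split.
  rewrite (_ : (fun t => _) = (fun t => complex.Re (f (X t)) * complex.Re (g (X t)) -
     complex.Im (f (X t)) * complex.Im (g (X t)))); last first.
    by apply/funext => t; case: (f _) (g _) => [? ?] [? ?].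
  by apply: measurable_funB; apply: measurable_funM.
rewrite (_ : (fun t => _) = (fun t => complex.Re (f (X t)) * complex.Im (g (X t)) +
   complex.Im (f (X t)) * complex.Re (g (X t)))); last first.
  by apply/funext => t; case: (f _) (g _) => [? ?] [? ?].
by apply: measurable_funD; apply: measurable_funM.
Qed.

Lemma ball_measurable_conj f : ball_measurable f -> ball_measurable (fun z => (f z)^*%C).
Proof.
move=> [mRf mIf]; split.
  by rewrite (_ : (fun t => _) = (fun t => complex.Re (f (X t))))//; apply/funext => t; case: (f _).
rewrite (_ : (fun t => _) = (fun t => - complex.Im (f (X t)))); last first.
  by apply/funext => t; case: (f _).
exact: measurableT_comp.
Qed.

Lemma L2_sq_integrable f : L2 f ->
  V.-integrable B (EFin \o (fun t => W t * sqabs (f (X t)))).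
Proof.
move=> [mf foo]; apply/integrableP; split.
  by apply/measurable_EFinP; exact: ball_measurable_sqabs.
apply: le_lt_trans foo; rewrite le_eqVlt; apply/orP; left; apply/eqP.
by apply: eq_integral => t _; rewrite /= ger0_norm// mulr_ge0// sqabs_ge0.
Qed.

Lemma integrable_dominated (u : R2n -> R) f g : L2 f -> L2 g ->
  measurable_fun B u ->
  (forall t, B t -> `|u t| <= normc (f (X t)) * normc (g (X t))) ->
  V.-integrable B (EFin \o (fun t => W t * u t)).
Proof.
move=> Lf Lg mu ufg.
have iFG := integrableD mB (L2_sq_integrable Lf) (L2_sq_integrable Lg).
apply: (le_integrable mB _ _ iFG).
  by apply/measurable_EFinP; exact: measurable_funM.
move=> t Bt; rewrite /= lee_fin -mulrDr !normrM ler_wpM2l//.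
apply: (le_trans (ufg t Bt)); rewrite ger0_norm; last by apply: addr_ge0; exact: sqabs_ge0.
rewrite !sqabsE.
by apply: mul_le_sqr; exact: normc_ge0.
Qed.

Lemma inner_integrable f g : L2 f -> L2 g ->
  V.-integrable B (EFin \o (fun t => W t * complex.Re (f (X t) * (g (X t))^*%C))) /\
  V.-integrable B (EFin \o (fun t => W t * complex.Im (f (X t) * (g (X t))^*%C))).
Proof.
move=> Lf Lg; have [mR mI] := ball_measurableM Lf.1 (ball_measurable_conj Lg.1).
split; apply: (integrable_dominated Lf Lg) => // t _.
  by rewrite (le_trans (normr_Re _))// normcM normcJE.
by rewrite (le_trans (normr_Im _))// normcM normcJE.
Qed.

Lemma innerE f g : inner f g =
  ((\int[V]_(t in B) (W t * complex.Re (f (X t) * (g (X t))^*%C))) +i*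
   (\int[V]_(t in B) (W t * complex.Im (f (X t) * (g (X t))^*%C))))%C.
Proof. by []. Qed.

Lemma inner_eq f f' g g' : (forall z, unit_ball z -> f z = f' z) ->
  (forall z, unit_ball z -> g z = g' z) -> inner f g = inner f' g'.
Proof.
move=> ff gg; rewrite !innerE; congr Complex; apply: eq_Rintegral => t;
  by rewrite inE => Bt; rewrite ff// gg.
Qed.

Lemma inner_ae f f' g : ball_measurable f -> ball_measurable f' -> ball_measurable g ->
  ae_ball (fun z => f z = f' z) -> inner f g = inner f' g.
Proof.
move=> mf mf' mg H.
have [mR mI] := ball_measurableM mf (ball_measurable_conj mg).
have [mR' mI'] := ball_measurableM mf' (ball_measurable_conj mg).
rewrite !innerE; congr Complex; congr fine; apply: ae_eq_integral => //.
- by apply/measurable_EFinP; exact: measurable_funM.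
- by apply/measurable_EFinP; exact: measurable_funM.
- by apply: aeS H => t H Bt /=; rewrite H.
- by apply/measurable_EFinP; exact: measurable_funM.
- by apply/measurable_EFinP; exact: measurable_funM.
- by apply: aeS H => t H Bt /=; rewrite H.
Qed.

Lemma inner_conj f g : L2 f -> L2 g -> inner g f = (inner f g)^*%C.
Proof.
move=> Lf Lg; have [iR iI] := inner_integrable Lf Lg.
rewrite !innerE; apply: complex_ext => /=.
  apply: eq_Rintegral => t _; congr (_ * _).
  by case: (f _) (g _) => [? ?] [? ?] /=; ring.
rewrite -mulN1r -RintegralZl//; apply: eq_Rintegral => t _.
rewrite mulrCA; congr (_ * _).
by case: (f _) (g _) => [? ?] [? ?] /=; ring.
Qed.

Lemma inner_linear (c : C) f g h : L2 f -> L2 g -> L2 h ->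
  inner (c *: f + g) h = c * inner f h + inner g h.
Proof.
case: c => a b Lf Lg Lh.
have [fR fI] := inner_integrable Lf Lh; have [gR gI] := inner_integrable Lg Lh.
have iZ (k : R) (u : R2n -> R) : V.-integrable B (EFin \o u) ->
    V.-integrable B (EFin \o (fun x => k * u x)).
  move=> iu; rewrite (_ : _ \o _ = fun x => (k%:E * (u x)%:E)%E); last exact/funext.
  exact: integrableZl.
have iB (u v : R2n -> R) : V.-integrable B (EFin \o u) -> V.-integrable B (EFin \o v) ->
    V.-integrable B (EFin \o (fun x => u x - v x)).
  by move=> iu iv; have := integrableB mB iu iv.
have iD (u v : R2n -> R) : V.-integrable B (EFin \o u) -> V.-integrable B (EFin \o v) ->
    V.-integrable B (EFin \o (fun x => u x + v x)).
  by move=> iu iv; have := integrableD mB iu iv.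
have E t : ((a +i* b)%C *: f + g) (X t) = (a +i* b)%C * f (X t) + g (X t) by [].
rewrite !innerE; apply: complex_ext => /=.
  rewrite -!RintegralZl// -RintegralB//; try exact: iZ.
  rewrite -RintegralD//; last by apply: iB; exact: iZ.
  apply: eq_Rintegral => t _; rewrite E.
  by case: (f _) (g _) (h _) => [? ?] [? ?] [? ?] /=; ring.
rewrite -!RintegralZl// -RintegralD//; try exact: iZ.
rewrite -RintegralD//; last by apply: iD; exact: iZ.
apply: eq_Rintegral => t _; rewrite E.
by case: (f _) (g _) (h _) => [? ?] [? ?] [? ?] /=; ring.
Qed.

(** The squared norm as a real number. An infinite integral would also give a finite value here, so
    the link with the integral, [sqnE], is stated on [L2]. *)
Definition sqn f : R := \int[V]_(t in B) (W t * sqabs (f (X t))).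

Lemma inner_self f : inner f f = (sqn f)%:C%C.
Proof.
rewrite innerE; apply: complex_ext => /=.
  by apply: eq_Rintegral => t _; rewrite mulcJ.
by rewrite /Rintegral integral0_eq// => t _; rewrite mulcJ /= mulr0.
Qed.

Lemma sqn_ge0 f : 0 <= sqn f.
Proof. by apply: Rintegral_ge0 => t _; rewrite mulr_ge0 ?sqabs_ge0. Qed.

Lemma sqnE f : L2 f ->
  (sqn f)%:E = (\int[V]_(t in B) (W t * sqabs (f (X t)))%:E)%E.
Proof.
move=> Lf; rewrite /sqn /Rintegral fineK// ge0_fin_numE ?Lf.2//.
by apply: integral_ge0 => t _; rewrite lee_fin mulr_ge0 ?sqabs_ge0.
Qed.

Lemma L2_mul_Linfty a f : Linfty a -> L2 f -> L2 (fun z => a z * f z).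
Proof.
move=> [ma [M aM]] [mf foo]; have maf := ball_measurableM ma mf; split => //.
have mN (g : Cn -> C) : ball_measurable g ->
    measurable_fun B (fun t => (W t * sqabs (g (X t)))%:E).
  by move=> mg; apply/measurable_EFinP; exact: ball_measurable_sqabs.
apply: (@le_lt_trans _ _ (\int[V]_(t in B) ((M ^+ 2)%:E * (W t * sqabs (f (X t)))%:E))%E).
  apply: ae_ge0_le_integral => //.
  - by move=> t _; rewrite lee_fin mulr_ge0 ?sqabs_ge0.
  - exact: (mN _ maf).
  - by move=> t _; rewrite -EFinM lee_fin; apply: mulr_ge0; [exact: sqr_ge0|exact: WS0].
  - by apply: emeasurable_funM => //; exact: (mN _ mf).
  - apply: aeS aM => t aM Bt; rewrite -EFinM lee_fin sqabsM mulrCA.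
    have := aM Bt; rewrite normc_norm lecR => h.
    rewrite ler_wpM2r ?WS0// sqabsE lerXn2r ?nnegrE ?normc_ge0//.
    by rewrite (le_trans _ h)// normc_ge0.
rewrite ge0_integralZl//; [|exact: (mN _ mf)|
  by move=> t _; rewrite lee_fin mulr_ge0 ?sqabs_ge0|by rewrite lee_fin sqr_ge0].
by rewrite lte_mul_pinfty// lee_fin sqr_ge0.
Qed.

Lemma sqn_mul_Linfty a : Linfty a -> exists2 M : R, 0 <= M &
  forall f, L2 f -> sqn (fun z => a z * f z) <= M * sqn f.
Proof.
move=> La; have [ma [M aM]] := La; exists (M ^+ 2); first exact: sqr_ge0.
move=> f Lf; have Laf := L2_mul_Linfty La Lf.
have mN (g : Cn -> C) : ball_measurable g ->
    measurable_fun B (fun t => (W t * sqabs (g (X t)))%:E).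
  by move=> mg; apply/measurable_EFinP; exact: ball_measurable_sqabs.
rewrite -lee_fin EFinM !sqnE//.
rewrite -ge0_integralZl//; [|exact: (mN _ Lf.1)|
  by move=> t _; rewrite lee_fin mulr_ge0 ?sqabs_ge0|by rewrite lee_fin sqr_ge0].
apply: ae_ge0_le_integral => //.
- by move=> t _; rewrite lee_fin mulr_ge0 ?sqabs_ge0.
- exact: (mN _ Laf.1).
- by move=> t _; rewrite -EFinM lee_fin; apply: mulr_ge0; [exact: sqr_ge0|exact: WS0].
- by apply: emeasurable_funM => //; exact: (mN _ Lf.1).
- apply: aeS aM => t aM Bt; rewrite -EFinM lee_fin sqabsM mulrCA.
  have := aM Bt; rewrite normc_norm lecR => h.
  rewrite ler_wpM2r ?WS0// sqabsE lerXn2r ?nnegrE ?normc_ge0//.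
  by rewrite (le_trans _ h)// normc_ge0.
Qed.

Definition diagact (t : 'I_n -> C) (z : Cn) : Cn := \col_i (t i * z i 0).

Lemma sqnorm_diagact t z : (forall i, normc (t i) = 1) -> sqnorm (diagact t z) = sqnorm z.
Proof.
by move=> t1; apply: eq_bigr => i _; rewrite mxE !sqabsE normcM t1 mul1r.
Qed.

Lemma diagact_coords t (x : R2n) :
  diagact t (X x) = X (tmap (fun i => rot2 (t i)) x).
Proof.
apply/matrixP => i j; rewrite ord1 !mxE tnth_mktuple; case: (t i) => c s.
by case: (tnth x i) => u v; apply: complex_ext; rewrite /rot2 /=; ring.
Qed.

Lemma mpres_diagact t : (forall i, normc (t i) = 1) ->
  mpres V (tmap (fun i => rot2 (t i))).
Proof. by move=> t1; apply: mpres_tuple => i; exact: mpres_rot2. Qed.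

Lemma preimage_diagact t : (forall i, normc (t i) = 1) ->
  tmap (fun i => rot2 (t i)) @^-1` B = B.
Proof.
move=> t1; apply/seteqP; split => x; rewrite /ball_coords /= -diagact_coords;
  by rewrite /unit_ball /= sqnorm_diagact.
Qed.

Lemma ball_measurable_diagact t f : (forall i, normc (t i) = 1) ->
  ball_measurable f -> ball_measurable (f \o diagact t).
Proof.
move=> t1 [mR mI]; have [mg _] := mpres_diagact t1.
have im : [set tmap (fun i => rot2 (t i)) x | x in B] `<=` B.
  by move=> _ [x Bx <-]; have := preimage_diagact t1; rewrite predeqE => /(_ x)[_]; apply.
split.
  rewrite (_ : (fun _ => _) = (fun x => complex.Re (f (X x))) \o tmap (fun i => rot2 (t i))).
    by apply: (measurable_comp mB im mR); exact: measurable_funTS.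
  by apply/funext => x /=; rewrite diagact_coords.
rewrite (_ : (fun _ => _) = (fun x => complex.Im (f (X x))) \o tmap (fun i => rot2 (t i))).
  by apply: (measurable_comp mB im mI); exact: measurable_funTS.
by apply/funext => x /=; rewrite diagact_coords.
Qed.

Lemma weight_diagact t z : (forall i, normc (t i) = 1) ->
  weight lambda (diagact t z) = weight lambda z.
Proof. by move=> t1; rewrite /weight sqnorm_diagact. Qed.

Lemma L2_diagact t f : (forall i, normc (t i) = 1) -> L2 f -> L2 (f \o diagact t).
Proof.
move=> t1 [mf foo]; split; first exact: ball_measurable_diagact.
apply: le_lt_trans foo; rewrite le_eqVlt; apply/orP; left; apply/eqP.
rewrite -[RHS](mpres_ge0_integral (mpres_diagact t1))//; last 2 first.
- by apply/measurable_EFinP; exact: ball_measurable_sqabs.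
- by move=> x _; rewrite lee_fin mulr_ge0 ?sqabs_ge0.
rewrite preimage_diagact//; apply: eq_integral => x _.
by rewrite -diagact_coords weight_diagact.
Qed.

Lemma inner_diagact t f g : (forall i, normc (t i) = 1) ->
  ball_measurable f -> ball_measurable g ->
  inner (f \o diagact t) (g \o diagact t) = inner f g.
Proof.
move=> t1 mf mg; have [mR mI] := ball_measurableM mf (ball_measurable_conj mg).
have Hp := mpres_diagact t1.
rewrite !innerE; congr Complex.
  rewrite -[RHS](mpres_Rintegral Hp)//; last exact: measurable_funM.
  rewrite preimage_diagact//; apply: eq_Rintegral => x _.
  by rewrite -diagact_coords weight_diagact.
rewrite -[RHS](mpres_Rintegral Hp)//; last exact: measurable_funM.
rewrite preimage_diagact//; apply: eq_Rintegral => x _.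
by rewrite -diagact_coords weight_diagact.
Qed.

End weighted_L2.

(** * Convergence of the averages for functions analytic beyond the unit disc *)

Section average_limits.
Context (R : realType).
Local Notation C := R[i].

Lemma circle_bounded (phi : C -> C) (r : R) : 0 < r ->
  (forall w, normc w <= r -> cdiff phi w) ->
  exists M : R, forall t, 0 <= t <= 2 * pi -> normc (phi (r%:C%C * cis t)) <= M.
Proof.
move=> r0 dphi; pose u t := normc (phi (r%:C%C * cis t)).
have cu : {within `[0, 2 * pi], continuous u}.
  apply: continuous_subspaceT => t.
  have gt : (fun s => r%:C%C * cis s) @ t --> r%:C%C * cis t.
    have ttt : t <= t <= t by rewrite lexx.
    exact: (cvgM (cvg_cst _) (@cis_cont R t t t ttt)).
  have pt : phi @ (r%:C%C * cis t) --> phi (r%:C%C * cis t).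
    apply: cdiff_cont; apply: dphi.
    by rewrite normcM normc_cis mulr1 normc_real gtr0_norm.
  have /(@cvg_complexP _ _ _ _) H := cvg_comp _ _ gt pt.
  apply/cvgrPdist_lt => e /H; apply: filterS => s; apply: le_lt_trans.
  by rewrite distrC ler_dist_normc.
have pi2 : 0 <= 2 * pi :> R by rewrite mulr_ge0// pi_ge0.
have [c _ Hc] := EVT_max pi2 cu.
by exists (u c) => t ht; apply: Hc; rewrite in_itv.
Qed.

(** The radius r > 1 makes the Taylor error at most A r ^- K uniformly on the closed unit disc. The
    N-th average only sees the truncation at 2 ^ N terms, so it isolates the k-th term up to that
    error. *)
Lemma dyavg_cvg (phi : C -> C) (r : R) : 1 < r ->
  (forall w, normc w <= r -> cdiff phi w) ->
  exists c : nat -> C, c 0%N = phi 0 /\ forall z, normc z <= 1 ->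
   (\sum_(l < K) c l * z ^+ l @[K --> \oo] --> phi z) /\
   (forall k, dyavg *%R k N (fun w => phi (w * z)) 1 @[N --> \oo] --> c k * z ^+ k).
Proof.
move=> r1 dphi; have r0 : 0 < r by rewrite (lt_trans _ r1).
have [M HM] := circle_bounded r0 dphi.
have [c /(_ M HM)[_ Hc]] := taylor r0 dphi; exists c.
have M0 : 0 <= M.
  apply: le_trans (HM 0 _); first exact: normc_ge0.
  by rewrite lexx mulr_ge0// pi_ge0.
have rr : 0 < r - 1 by rewrite subr_gt0.
pose A := 2 * M * (r / (r - 1)); pose q := r^-1.
have q0 : 0 <= q by rewrite invr_ge0 ltW.
have q1 : q < 1 by rewrite invf_lt1.
have A0 : 0 <= A by apply: mulr_ge0; [exact: mulr_ge0|apply: divr_ge0; exact: ltW].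
have Hc' z K : normc z <= 1 ->
    normc (phi z - \sum_(k < K) c k * z ^+ k) <= A * q ^+ K.
  move=> z1; have zr : normc z < r by exact: le_lt_trans r1.
  apply: (le_trans (Hc z K zr)).
  rewrite [leRHS](_ : _ = 2 * M * (q ^+ K * (r / (r - 1)))); last by rewrite /A; ring.
  rewrite -mulrA ler_wpM2l ?mulr_ge0// ler_pM//.
  - by rewrite exprn_ge0// divr_ge0 ?normc_ge0// ltW.
  - by apply: divr_ge0; [exact: ltW|rewrite subr_ge0; exact: ltW].
  - rewrite lerXn2r ?nnegrE ?divr_ge0 ?normc_ge0 ?(ltW r0)//.
    by rewrite /q -[leRHS]mul1r ler_wpM2r.
  - by rewrite ler_wpM2l ?(ltW r0)// lef_pV2 ?posrE ?subr_gt0// lerD2l lerN2.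
have small (e : R) : 0 < e -> exists N, forall n, (N <= n)%N -> A * q ^+ n < e.
  move=> e0; have : A * q ^+ n @[n --> \oo] --> A * 0.
    by apply: cvgMr; apply: cvg_expr; rewrite ger0_norm.
  rewrite mulr0 => /cvgrPdist_lt/(_ e e0)[N _ HN]; exists N => n Nn.
  by have := HN n Nn; rewrite sub0r normrN ger0_norm// mulr_ge0 ?exprn_ge0.
split.
  have z0 : normc (0 : C) <= 1 by rewrite ComplexField.Normc.normc0.
  apply/eqP; rewrite eq_sym -subr_eq0 -normc_eq0 eq_le normc_ge0 andbT.
  apply: (@ler_geometric_eq0 _ _ A q); rewrite ?q0//.
  move=> n; have := Hc' 0 n.+1 z0.
  rewrite big_ord_recl expr0 mulr1 big1 ?addr0 => [h|i _]; last by rewrite expr0n mulr0.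
  by rewrite (le_trans h)// ler_wpM2l// exprS ler_piMl ?exprn_ge0// ltW.
move=> z z1; split.
  apply/cvg_seqP => e /small[N HN]; exists N => n Nn.
  by rewrite normc_distC (le_lt_trans (Hc' z n z1))// HN.
move=> k; apply/cvg_seqP => e /small[N HN]; exists (maxn N k) => n.
rewrite geq_max => /andP[Nn kn].
have kn2 : (k < 2 ^ n)%N by rewrite (leq_ltn_trans kn)// ltn_expl.
have := @dyavg_lim R k n (fun w => phi (w * z)) (fun l => c l * z ^+ l)
  (A * q ^+ (2 ^ n)) 1 kn2 (ComplexField.Normc.normc1 R).
rewrite expr1n mulr1 => H; apply: le_lt_trans (H _) _.
  move=> w w1; have wz : normc (w * z) <= 1 by rewrite normcM w1 mul1r.
  apply: le_trans (Hc' (w * z) (2 ^ n)%N wz); rewrite le_eqVlt; apply/orP; left.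
  apply/eqP; congr normc; congr (_ - _); apply: eq_bigr => l _.
  by rewrite exprMn mulrCA mulrC mulrA mulrAC mulrC mulrA.
by apply: HN; rewrite (leq_trans Nn)// ltnW// ltn_expl.
Qed.

End average_limits.

Section fatou_limit.
Context d (T : measurableType d) (R : realType).
Variables (mu : {measure set T -> \bar R}) (D : set T) (mD : measurable D).

Lemma fatou_cvg (u : nat -> T -> \bar R) (l : T -> \bar R) (K : \bar R) :
  (forall N, measurable_fun D (u N)) -> (forall N t, D t -> (0 <= u N t)%E) ->
  (forall t, D t -> u N t @[N --> \oo] --> l t) ->
  (forall N, (\int[mu]_(t in D) u N t <= K)%E) ->
  (\int[mu]_(t in D) l t <= K)%E.
Proof.
move=> mu_ u0 ul uK.
have -> : (\int[mu]_(t in D) l t = \int[mu]_(t in D) limn_einf (u ^~ t))%E.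
  apply: eq_integral => t; rewrite inE => Dt.
  by rewrite (cvg_limn_einf_sup (ul t Dt)).1.
apply: (le_trans (fatou mu mD mu_ u0)).
rewrite limn_einf_lim; apply: lime_le; first exact: is_cvg_einfs.
apply: nearW => N; apply: le_trans (uK N).
by apply: ereal_inf_lbound; exists N => /=.
Qed.

Lemma cvg_sqabs (g : nat -> R[i]) (l : R[i]) : g N @[N --> \oo] --> l ->
  (sqabs (g N))%:E @[N --> \oo] --> (sqabs l)%:E.
Proof.
move=> gl; apply: cvg_EFin; first exact: nearW.
have gR : complex.Re (g N) @[N --> \oo] --> complex.Re l by exact: cvg_Re.
have gI : complex.Im (g N) @[N --> \oo] --> complex.Im l by exact: cvg_Im.
rewrite /comp /sqabs /=; under eq_fun do rewrite !expr2.
by rewrite !expr2; exact: cvgD (cvgM gR gR) (cvgM gI gI).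
Qed.

End fatou_limit.

(** * Polydiscs in the ball and the sub-mean value inequality *)

Section evaluation.
Context (R : realType) (n : nat) (lambda : R).
Local Notation C := R[i].
Local Notation Cn := 'cV[C]_n.
Local Notation T := (measurableTypeR R).
Local Notation R2n := (n.-tuple (T * T)%type).
Local Notation V := (vol R n).
Local Notation X := (@of_real_coords R n).
Implicit Types (f F : Cn -> C) (z h : Cn).

(** In each coordinate the squared modulus grows by at most 2 |z_i| |h_i| + |h_i| ^ 2 <= 3 e, since
    |z_i| and e are at most 1. *)
Lemma sqnorm_perturb z h (e : R) : unit_ball z -> 0 <= e <= 1 ->
  (forall i, normc (h i 0) <= e) -> sqnorm (z + h) <= sqnorm z + 3 * n%:R * e.
Proof.
move=> Bz /andP[e0 e1] he; rewrite /sqnorm.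
have -> : 3 * n%:R * e = \sum_(i < n) 3 * e.
  by rewrite sumr_const card_ord -[RHS]mulr_natr mulrAC.
rewrite -big_split /=; apply: ler_sum => i _; rewrite mxE !sqabsE.
have z1 : normc (z i 0) <= 1.
  have := le_lt_trans (le_sqnorm z i) Bz; rewrite sqabsE => /ltW h1.
  by rewrite -(@ler_pXn2r _ 2) ?nnegrE ?normc_ge0 ?expr1n.
have := normcD (z i 0) (h i 0); have := he i.
have := normc_ge0 (h i 0); have := normc_ge0 (z i 0); have := normc_ge0 (z i 0 + h i 0).
move: z1; move: (normc (z i 0)) (normc (h i 0)) (normc (z i 0 + h i 0)) => a b c.
move=> a1 c0 a0 b0 be cab; have : c ^+ 2 <= (a + b) ^+ 2.
  by rewrite lerXn2r ?nnegrE ?addr_ge0.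
rewrite sqrrD => /le_trans; apply.
have : a * b <= e by rewrite -[leRHS]mul1r ler_pM.
have : b ^+ 2 <= e by rewrite expr2 -[leRHS]mul1r ler_pM// (le_trans be).
by rewrite -mulr_natl; move: (a * b) (a ^+ 2) (b ^+ 2) => *; lra.
Qed.

Lemma ball_box z : unit_ball z -> exists2 d : R, 0 < d &
  exists2 s : R, 0 < s <= 1 & forall h, (forall i, normc (h i 0) <= d) ->
    sqnorm (z + h) <= 1 - s.
Proof.
move=> Bz; pose s := (1 - sqnorm z) / 2.
have s0 : 0 < s by rewrite divr_gt0// subr_gt0.
pose d := Num.min 1 (s / (3 * n%:R + 1)).
have n3 : 0 < 3 * n%:R + 1 :> R by rewrite ltr_wpDl// mulr_ge0.
have d0 : 0 < d by rewrite lt_min ltr01 divr_gt0.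
exists d => //; exists s.
  by rewrite s0 /s; have := sqnorm_ge0 z; lra.
move=> h hd; have d1 : 0 <= d <= 1 by rewrite (ltW d0) ge_min lexx.
apply: (le_trans (sqnorm_perturb Bz d1 hd)).
have : 3 * n%:R * d <= s.
  apply: (@le_trans _ _ ((3 * n%:R + 1) * d)); first by rewrite ler_wpM2r ?lerDl// ltW.
  by rewrite mulrC -ler_pdivlMr// ge_min lexx orbT.
by rewrite /s; lra.
Qed.

(** The exponent |lambda| treats both signs at once: for u in ]0, 1], u ^ lambda >= u ^ |lambda|,
    and the latter increases with u. *)
Lemma weight_lower (s : R) : -1 < lambda -> 0 < s <= 1 ->
  exists2 w0 : R, 0 < w0 & forall z, sqnorm z <= 1 - s -> w0 <= weight lambda z.
Proof.
move=> l1 /andP[s0 s1].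
have W0 : 0 < weight lambda (0 : Cn).
  by apply: weight_gt0 => //; rewrite /unit_ball /= /sqnorm big1// => i _; rewrite mxE /sqabs /= expr0n addr0.
have k0 : 0 < Gamma (n%:R + lambda + 1) / (pi ^+ n * Gamma (lambda + 1)).
  move: W0; rewrite /weight /sqnorm big1 ?subr0 ?powR1 ?mulr1//.
  by move=> i _; rewrite mxE /sqabs /= expr0n addr0.
exists (Gamma (n%:R + lambda + 1) / (pi ^+ n * Gamma (lambda + 1)) * s `^ `|lambda|).
  by rewrite mulr_gt0// powR_gt0.
move=> z zs; rewrite /weight ler_wpM2l ?(ltW k0)//.
have sz : s <= 1 - sqnorm z by lra.
apply: (@le_trans _ _ ((1 - sqnorm z) `^ `|lambda|)).
  by apply: ge0_ler_powR; rewrite ?nnegrE//; lra.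
apply: ger_powR; last exact: ler_norm.
by apply/andP; split; [lra|have := sqnorm_ge0 z; lra].
Qed.

Let act (c : C) (x : Cn) : Cn := c *: x.

Section mean_value.
Variable e : R.
Local Notation D := (@polydisc R n e).

Let mD : measurable D. Proof. exact: measurable_polydisc. Qed.

Definition disc_measurable F := measurable_fun D (fun t => complex.Re (F (X t))) /\
  measurable_fun D (fun t => complex.Im (F (X t))).

Let scale_diag (c : C) (x : Cn) : act c x = diagact (fun=> c) x.
Proof. by apply/matrixP => i j; rewrite !mxE ord1. Qed.

Let preimD c : normc c = 1 -> tmap (fun _ : 'I_n => rot2 c) @^-1` D = D.
Proof.
move=> c1; have E (p : T * T) : (rot2 c p).1 ^+ 2 + (rot2 c p).2 ^+ 2 = p.1 ^+ 2 + p.2 ^+ 2.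
  have := sqabsE c; rewrite c1 expr1n /sqabs; case: c {c1} => a b /= ab.
  by rewrite -[RHS]mul1r -ab; case: p => x y /=; ring.
by apply/seteqP; split => t H i; have := H i; rewrite /disc /= tnth_mktuple E.
Qed.

Lemma disc_measurable_act c F : normc c = 1 -> disc_measurable F ->
  disc_measurable (F \o act c).
Proof.
move=> c1 [mR mI]; have [mg _] := mpres_diagact (fun _ : 'I_n => c1).
have im : [set tmap (fun _ => rot2 c) x | x in D] `<=` D.
  by move=> _ [x Dx <-]; have := preimD c1; rewrite predeqE => /(_ x)[_]; apply.
split.
  rewrite (_ : (fun _ => _) = (fun x => complex.Re (F (X x))) \o tmap (fun=> rot2 c)).
    by apply: (measurable_comp mD im mR); exact: measurable_funTS.
  by apply/funext => x /=; rewrite scale_diag diagact_coords.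
rewrite (_ : (fun _ => _) = (fun x => complex.Im (F (X x))) \o tmap (fun=> rot2 c)).
  by apply: (measurable_comp mD im mI); exact: measurable_funTS.
by apply/funext => x /=; rewrite scale_diag diagact_coords.
Qed.

Lemma disc_measurable_sqabs F : disc_measurable F ->
  measurable_fun D (fun t => (sqabs (F (X t)))%:E).
Proof.
move=> [mR mI]; apply/measurable_EFinP.
by apply: measurable_funD; exact: measurable_funX.
Qed.

Lemma sqabs_half (x y : C) (c : C) : normc c = 1 ->
  sqabs (2^-1 * (x + c * y)) <= 2^-1 * sqabs x + 2^-1 * sqabs y.
Proof.
move=> c1; rewrite !sqabsE normcM normcVE exprMn.
have -> : normc (2 : C) = 2.
  by rewrite -[2]/(2%:R) -(rmorph_nat (real_complex R)) normc_real ger0_norm.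
have := normcD x (c * y); rewrite normcM c1 mul1r.
have := normc_ge0 (x + c * y); have := normc_ge0 x; have := normc_ge0 y.
move: (normc (x + c * y)) (normc x) (normc y) => q a b b0 a0 q0 H.
have h1 : q ^+ 2 <= (a + b) ^+ 2 by rewrite lerXn2r ?nnegrE ?addr_ge0.
have h2 := sqr_ge0 (a - b).
have e1 : (a + b) ^+ 2 = a ^+ 2 + b ^+ 2 + 2 * (a * b) by ring.
have e2 : (a - b) ^+ 2 = a ^+ 2 + b ^+ 2 - 2 * (a * b) by ring.
have e3 : 2^-1 ^+ 2 = 4^-1 :> R by field.
rewrite e1 in h1; rewrite e2 in h2; rewrite e3.
by move: (a * b) (a ^+ 2) (b ^+ 2) (q ^+ 2) h1 h2 => *; lra.
Qed.

Lemma integral_dyavg N F : disc_measurable F ->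
  disc_measurable (dyavg act 0 N F) /\
  (\int[V]_(t in D) (sqabs (dyavg act 0 N F (X t)))%:E <=
   \int[V]_(t in D) (sqabs (F (X t)))%:E)%E.
Proof.
move=> mF; elim: N => [//|N [mN IH]]; set G := dyavg act 0 N F in mN IH *.
have w1 := normc_droot R N.+1; set w := droot R N.+1 in w1 *.
have mNw := disc_measurable_act w1 mN.
have GE : dyavg act 0 N.+1 F = fun x => 2^-1 * (G x + 1 * G (act w x)).
  by apply/funext => x /=; rewrite expr0 invr1.
have mH : disc_measurable (fun x => 2^-1 * (G x + 1 * G (act w x))).
  have c2 : 2^-1 = (2^-1)%:C%C :> C by rewrite fmorphV rmorph_nat.
  split.
    rewrite (_ : (fun _ => _) = (fun t => 2^-1 * (complex.Re (G (X t)) + complex.Re (G (act w (X t)))))).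
      by apply: measurable_funM => //; apply: measurable_funD; [exact: mN.1|exact: mNw.1].
    apply/funext => t; rewrite c2 mul1r; case: (G _) (G _) => [? ?] [? ?] /=; ring.
  rewrite (_ : (fun _ => _) = (fun t => 2^-1 * (complex.Im (G (X t)) + complex.Im (G (act w (X t)))))).
    by apply: measurable_funM => //; apply: measurable_funD; [exact: mN.2|exact: mNw.2].
  apply/funext => t; rewrite c2 mul1r; case: (G _) (G _) => [? ?] [? ?] /=; ring.
rewrite GE; split=> //; apply: le_trans IH.
have mG1 := disc_measurable_sqabs mN; have mG2 := disc_measurable_sqabs mNw.
have h0 : (0 <= (2^-1)%:E :> \bar R)%E by rewrite lee_fin.
have s0 (x : C) : (0 <= (sqabs x)%:E)%E by rewrite lee_fin sqabs_ge0.
apply: (@le_trans _ _ (\int[V]_(t in D) ((2^-1)%:E * (sqabs (G (X t)))%:E +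
    (2^-1)%:E * (sqabs (G (act w (X t))))%:E))%E).
  apply: ge0_le_integral => //.
  - exact: disc_measurable_sqabs mH.
  - by apply: emeasurable_funD; apply: emeasurable_funM.
  - by move=> t _; rewrite -!EFinM -EFinD lee_fin sqabs_half// ComplexField.Normc.normc1.
rewrite ge0_integralD//; last 4 first.
- by move=> t _; rewrite mule_ge0.
- exact: emeasurable_funM.
- by move=> t _; rewrite mule_ge0.
- exact: emeasurable_funM.
rewrite !ge0_integralZl//.
have -> : (\int[V]_(t in D) (sqabs (G (act w (X t))))%:E =
           \int[V]_(t in D) (sqabs (G (X t)))%:E)%E.
  rewrite -[RHS](mpres_ge0_integral (mpres_diagact (fun _ : 'I_n => w1)))//.
  by rewrite preimD//; apply: eq_integral => t _; rewrite -diagact_coords scale_diag.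
rewrite -ge0_muleDl// -EFinD.
by rewrite (_ : 2^-1 + 2^-1 = 1 :> R) ?mul1e//; lra.
Qed.

(* Each averaging step is a contraction of L^2, and the averages converge
   pointwise to F 0; conclude by Fatou. *)
Lemma sub_mean_value F : 0 < e -> disc_measurable F ->
  (forall h, (forall i, normc (h i 0) <= 2 * e) -> differentiable F h) ->
  ((sqabs (F 0))%:E * V D <= \int[V]_(t in D) (sqabs (F (X t)))%:E)%E.
Proof.
move=> e0 mF dF.
rewrite -integral_cst//.
pose u N t := (sqabs (dyavg act 0 N F (X t)))%:E.
have u0 N t : (0 <= u N t)%E by rewrite lee_fin sqabs_ge0.
have mu_ N : measurable_fun D (u N).
  by apply: disc_measurable_sqabs; exact: (integral_dyavg N mF).1.
have ucvg t : D t -> u N t @[N --> \oo] --> (sqabs (F 0))%:E.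
  move=> Dt; pose phi c := F (0 + c *: X t).
  have xe i : normc (X t i 0) <= e.
    have := Dt i; rewrite /disc /= => /ltW H.
    rewrite -(@ler_pXn2r _ 2)// ?nnegrE ?normc_ge0 ?(ltW e0)//.
    by rewrite -sqabsE mxE.
  (* Differentiability on the polydisc of radius 2 e lets the slice through a point of the polydisc
     of radius e extend to |c| <= 2, which supplies the radius above 1 for [dyavg_cvg]. *)
  have dphi c : normc c <= 2 -> cdiff phi c.
    move=> c2; apply: slice_cdiff; apply: dF => i.
    by rewrite !mxE add0r normcM ler_pM ?normc_ge0//; have := xe i; rewrite mxE.
  have r2 : 1 < 2 :> R by rewrite ltr1n.
  have [c [c0 /(_ 1)]] := dyavg_cvg r2 dphi.
  rewrite ComplexField.Normc.normc1 => /(_ (lexx _))[_ /(_ 0%N)].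
  rewrite expr0 mulr1 c0 /phi scale0r addr0 => H.
  apply: cvg_sqabs; have -> : (fun N => dyavg act 0 N F (X t)) =
      (fun N => dyavg *%R 0 N (fun w => phi (w * 1)) 1).
    apply/funext => N; rewrite -[X t in LHS]scale1r -/(act 1 (X t)).
    rewrite dyavg_slice; last by move=> a b; rewrite /act scalerA.
    by congr dyavg; apply/funext => w; rewrite /phi add0r mulr1.
  exact: H.
apply: (fatou_cvg mD mu_ _ ucvg) => // N.
exact: (integral_dyavg N mF).2.
Qed.

End mean_value.
End evaluation.

(** * The weighted Bergman space *)

Section bergman_space.
Context (R : realType) (n : nat) (lambda : R).
Hypothesis l1 : -1 < lambda.
Local Notation C := R[i].
Local Notation Cn := 'cV[C]_n.
Local Notation T := (measurableTypeR R).
Local Notation R2n := (n.-tuple (T * T)%type).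
Local Notation V := (vol R n).
Local Notation B := (@ball_coords R n).
Local Notation X := (@of_real_coords R n).
Local Notation W t := (weight lambda (X t)).
Local Notation sqn := (@sqn R n lambda).
Local Notation L2 := (@L2 R n lambda).
Local Notation A2 := (bergman n lambda).
Implicit Types (f F : Cn -> C) (z h : Cn).

Let mB : measurable B := @measurable_ball_coords R n.
Let WS0 f t : 0 <= W t * sqabs (f (X t)).
Proof. by apply: mulr_ge0; [exact: weight_ge0|exact: sqabs_ge0]. Qed.

Definition shiftmap z (t : R2n) : R2n :=
  tmap (fun i p => (p.1 + complex.Re (z i 0), p.2 + complex.Im (z i 0))) t.

Lemma of_real_coords_shift z t : X (shiftmap z t) = z + X t.
Proof.
apply/matrixP => i j; rewrite ord1 !mxE tnth_mktuple /=.
by case: (z i 0) => a b; apply: complex_ext; rewrite /= addrC.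
Qed.

Lemma shiftmapK z t : shiftmap (- z) (shiftmap z t) = t.
Proof.
rewrite -[LHS]of_real_coordsK !of_real_coords_shift addKr.
exact: of_real_coordsK.
Qed.

Lemma mpres_shiftmap z : mpres V (shiftmap z).
Proof. by apply: mpres_tuple => i; exact: mpres_translation2. Qed.

(** The sub-mean value inequality on a polydisc around z, where the weight has a positive lower
    bound w0. Uniformity for z near z0 is what later makes norm-bounded sequences locally
    bounded. *)
Lemma evaluation_bound z0 : unit_ball z0 -> exists2 d : R, 0 < d &
  exists2 K : R, 0 <= K & forall z, (forall i, normc (z i 0 - z0 i 0) <= d) ->
    unit_ball z /\ forall f, ball_measurable f -> holomorphic f ->
    ((sqabs (f z))%:E <= K%:E * \int[V]_(t in B) (W t * sqabs (f (X t)))%:E)%E.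
Proof.
move=> Bz0; have [d1 d10 [s s01 Hs]] := ball_box Bz0.
have [w0 w00 Hw] := @weight_lower R n lambda s l1 s01.
(* A shift of at most e from z0 to z followed by one of at most 2 e stays within d1. *)
pose e := d1 / 4; have e0 : 0 < e by rewrite divr_gt0.
have [a a0 Ha] := @polydisc_measure R n e e0.
exists e => //; exists (a * w0)^-1; first by rewrite invr_ge0 mulr_ge0// ltW.
move=> z zz0.
have near0 h : (forall i, normc (h i 0) <= 2 * e) -> sqnorm (z + h) <= 1 - s.
  move=> h2; have -> : z + h = z0 + ((z - z0) + h) by rewrite addrA [z0 + _]addrC subrK.
  apply: Hs => i; rewrite !mxE (le_trans (normcD _ _))//.
  have := zz0 i; have := h2 i; rewrite /e in e0 *; lra.
have inB h : (forall i, normc (h i 0) <= 2 * e) -> unit_ball (z + h).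
  move=> /near0; rewrite /unit_ball /=; case/andP: s01; lra.
have De t : polydisc e t -> forall i, normc (X t i 0) <= e.
  move=> Dt i; have := Dt i; rewrite /disc /= => /ltW H.
  rewrite -(@ler_pXn2r _ 2)// ?nnegrE ?normc_ge0 ?(ltW e0)//.
  by rewrite -sqabsE mxE.
have De2 t : polydisc e t -> forall i, normc (X t i 0) <= 2 * e.
  by move=> /De H i; rewrite (le_trans (H i))//; lra.
split.
  have := inB 0; rewrite addr0; apply => i.
  by rewrite mxE ComplexField.Normc.normc0; lra.
move=> f mf hf; pose F h := f (z + h).
have mD := @measurable_polydisc R n e.
have im : [set shiftmap z t | t in polydisc e] `<=` B.
  by move=> _ [t Dt <-]; rewrite /ball_coords /= of_real_coords_shift; exact/inB/De2.
have mF : disc_measurable e F.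
  have [mg _] := mpres_shiftmap z; split.
    rewrite (_ : (fun _ => _) = (fun x => complex.Re (f (X x))) \o shiftmap z).
      by apply: (measurable_comp mB im mf.1); exact: measurable_funTS.
    by apply/funext => t /=; rewrite of_real_coords_shift.
  rewrite (_ : (fun _ => _) = (fun x => complex.Im (f (X x))) \o shiftmap z).
    by apply: (measurable_comp mB im mf.2); exact: measurable_funTS.
  by apply/funext => t /=; rewrite of_real_coords_shift.
have dF h : (forall i, normc (h i 0) <= 2 * e) -> differentiable F h.
  move=> /inB/hf df.
  have ds : differentiable (cst z + (@id Cn)) h.
    by apply: differentiableD; [exact: differentiable_cst|exact: ex_diff].
  exact: (differentiable_comp ds df).
have := sub_mean_value e0 mF dF.
rewrite Ha {1}/F addr0 -EFinM => H.
pose E := shiftmap (- z) @^-1` polydisc e.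
have DE : shiftmap z @^-1` E = polydisc e.
  by apply/seteqP; split => t; rewrite /E /= shiftmapK.
have mE : measurable E.
  by rewrite /E -[X in measurable X]setTI; exact: (mpres_shiftmap (- z)).1.
have EB : E `<=` B.
  move=> t Et; have := @im t; apply; exists (shiftmap (- z) t) => //.
  by rewrite -{1}(opprK z) shiftmapK.
have mS : measurable_fun E (fun t => (sqabs (f (X t)))%:E).
  apply/measurable_EFinP; apply: measurable_funD; apply: measurable_funX;
  by [exact: measurable_funS mf.1|exact: measurable_funS mf.2].
have mWS : measurable_fun B (fun t => (W t * sqabs (f (X t)))%:E).
  by apply/measurable_EFinP; exact: ball_measurable_sqabs.
have H1 : ((sqabs (f z) * a)%:E <= \int[V]_(t in E) (sqabs (f (X t)))%:E)%E.
  apply: (le_trans H); rewrite -[leRHS](mpres_ge0_integral (mpres_shiftmap z) mE mS); last first.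
    by move=> t _; rewrite lee_fin sqabs_ge0.
  rewrite DE le_eqVlt; apply/orP; left; apply/eqP.
  by apply: eq_integral => t _; rewrite of_real_coords_shift.
have H2 : (w0%:E * \int[V]_(t in E) (sqabs (f (X t)))%:E <=
    \int[V]_(t in B) (W t * sqabs (f (X t)))%:E)%E.
  rewrite -ge0_integralZl//; last 2 first.
  - by move=> t _; rewrite lee_fin sqabs_ge0.
  - by rewrite lee_fin ltW.
  apply: (@le_trans _ _ (\int[V]_(t in E) (W t * sqabs (f (X t)))%:E)%E).
    apply: ge0_le_integral => //.
    - by move=> t _; rewrite -EFinM lee_fin mulr_ge0 ?sqabs_ge0// ltW.
    - by apply: emeasurable_funM.
    - exact: measurable_funS mWS.
    - move=> t Et; rewrite -EFinM lee_fin ler_wpM2r ?sqabs_ge0// Hw//.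
      have <- : z + X (shiftmap (- z) t) = X t by rewrite of_real_coords_shift addNKr.
      by apply: near0; exact: De2.
  apply: ge0_subset_integral => //.
  by move=> t _; rewrite lee_fin.
have aw : 0 < a * w0 by rewrite mulr_gt0.
rewrite -(@lee_pmul2l _ (a * w0)%:E)// ?lte_fin// [leRHS]muleA.
have -> : ((a * w0)%:E * (a * w0)^-1%:E = 1 :> \bar R)%E.
  by rewrite -EFinM mulfV// gt_eqF.
rewrite mul1e; apply: le_trans H2.
have -> : ((a * w0)%:E * (sqabs (f z))%:E = w0%:E * (sqabs (f z) * a)%:E)%E.
  by rewrite -!EFinM; congr EFin; ring.
by rewrite lee_pmul2l// lte_fin.
Qed.

Lemma bergmanP (f : A2) : [/\ L2 f, holomorphic f & forall z, ~ unit_ball z -> f z = 0].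
Proof. by case: f => f /= /asboolP. Qed.

Lemma bergman_val (f : Cn -> C) : L2 f -> holomorphic f ->
  (forall z, ~ unit_ball z -> f z = 0) -> exists g : A2, (g : Cn -> C) = f.
Proof.
move=> Lf hf f0; have fP : f \in bergman_pred lambda by apply/asboolP.
by exists (Subsp fP).
Qed.

Lemma bergman_eq (f g : A2) : (forall z, unit_ball z -> f z = g z) -> f = g.
Proof.
move=> fg; apply: val_inj; apply/funext => z.
have [Bz|Bz] := pselect (unit_ball z); first exact: fg.
have [_ _ f0] := bergmanP f; have [_ _ g0] := bergmanP g.
by rewrite [LHS]f0// [RHS]g0.
Qed.

Lemma bergman_lin (c : C) (f g : A2) : ((c *: f + g : A2) : Cn -> C) = c *: (f : Cn -> C) + g.
Proof. by []. Qed.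

Lemma bergman_evaluation z0 : unit_ball z0 -> exists2 d : R, 0 < d &
  exists2 K : R, 0 <= K & forall z, (forall i, normc (z i 0 - z0 i 0) <= d) ->
    unit_ball z /\ forall f : A2, sqabs (f z) <= K * sqn f.
Proof.
move=> /evaluation_bound[d d0 [K K0 H]]; exists d => //; exists K => // z zz0.
have [Bz Hf] := H z zz0; split=> // f; have [Lf hf _] := bergmanP f.
by rewrite -lee_fin EFinM sqnE//; apply: Hf => //; exact: Lf.1.
Qed.

Lemma bergman_sqn0 (f : A2) : sqn f = 0 -> f = 0.
Proof.
move=> f0; apply: bergman_eq => z Bz; have [d d0 [K K0 H]] := bergman_evaluation Bz.
have [|_ /(_ f)] := H z; first by move=> i; rewrite subrr ComplexField.Normc.normc0 ltW.
rewrite f0 mulr0 sqabsE => h; apply/eqP; rewrite -normc_eq0 -sqrf_eq0.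
by rewrite eq_le h sqr_ge0.
Qed.

End bergman_space.

(** * Abstract inner product spaces, Riesz representation, reducing subspaces *)

Section prehilbert.
Context (R : realType) (H : lmodType R[i]) (dot : H -> H -> R[i]).
Local Notation C := R[i].
Implicit Types (x y z : H) (c : C).

Record inner_product : Prop := InnerProduct {
  dot_lin : forall c x y z, dot (c *: x + y) z = c * dot x z + dot y z;
  dot_conj : forall x y, dot y x = (dot x y)^*%C;
  dot_ge0 : forall x, 0 <= complex.Re (dot x x);
  dot_definite : forall x, complex.Re (dot x x) = 0 -> x = 0 }.

Hypothesis ip : inner_product.

Definition nsq x : R := complex.Re (dot x x).

Lemma nsq_ge0 x : 0 <= nsq x. Proof. exact: (dot_ge0 ip). Qed.

Lemma dot0l z : dot 0 z = 0.
Proof.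
have := dot_lin ip 1 0 0 z; rewrite scaler0 addr0 mul1r => /eqP.
by rewrite -[X in X == _]addr0 (inj_eq (addrI _)) eq_sym => /eqP.
Qed.

Lemma dotDl x y z : dot (x + y) z = dot x z + dot y z.
Proof. by have := dot_lin ip 1 x y z; rewrite scale1r mul1r. Qed.

Lemma dotZl c x z : dot (c *: x) z = c * dot x z.
Proof. by have := dot_lin ip c x 0 z; rewrite addr0 dot0l addr0. Qed.

Lemma dotNl x z : dot (- x) z = - dot x z.
Proof. by rewrite -scaleN1r dotZl mulN1r. Qed.

Lemma dotBl x y z : dot (x - y) z = dot x z - dot y z.
Proof. by rewrite dotDl dotNl. Qed.

Lemma dot0r z : dot z 0 = 0.
Proof. by rewrite (dot_conj ip) dot0l conjc0. Qed.

Lemma dotDr x y z : dot z (x + y) = dot z x + dot z y.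
Proof. by rewrite (dot_conj ip) dotDl rmorphD /= -!(dot_conj ip). Qed.

Lemma dotZr c x z : dot z (c *: x) = c^*%C * dot z x.
Proof. by rewrite (dot_conj ip) dotZl rmorphM /= -(dot_conj ip). Qed.

Lemma dotNr x z : dot z (- x) = - dot z x.
Proof. by rewrite (dot_conj ip) dotNl rmorphN /= -(dot_conj ip). Qed.

Lemma dotBr x y z : dot z (x - y) = dot z x - dot z y.
Proof. by rewrite dotDr dotNr. Qed.

Lemma dot_suml I (r : seq I) (F : I -> H) z :
  dot (\sum_(i <- r) F i) z = \sum_(i <- r) dot (F i) z.
Proof.
elim: r => [|i r IH]; first by rewrite !big_nil dot0l.
by rewrite !big_cons dotDl IH.
Qed.

Lemma dot_self x : dot x x = (nsq x)%:C%C.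
Proof.
apply: complex_ext => //=; have := dot_conj ip x x.
by rewrite {1}/conjc; case: (dot x x) => a b [] /= /eqP; rewrite -addr_eq0 -mulr2n mulrn_eq0 => /eqP.
Qed.

Lemma dot_self0 x : dot x x = 0 -> x = 0.
Proof. by move=> x0; apply: (dot_definite ip); rewrite x0. Qed.

Lemma nsq0 : nsq 0 = 0. Proof. by rewrite /nsq dot0l. Qed.

Lemma Re_dotC x y : complex.Re (dot y x) = complex.Re (dot x y).
Proof. by rewrite (dot_conj ip); case: (dot x y). Qed.

Lemma nsqD x y : nsq (x + y) = nsq x + nsq y + 2 * complex.Re (dot x y).
Proof.
by rewrite /nsq dotDl !dotDr !raddfD /= (Re_dotC x y); ring.
Qed.

Lemma nsqN x : nsq (- x) = nsq x.
Proof. by rewrite /nsq dotNl dotNr opprK. Qed.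

Lemma nsqB x y : nsq (x - y) = nsq x + nsq y - 2 * complex.Re (dot x y).
Proof. by rewrite nsqD nsqN dotNr raddfN /=; ring. Qed.

Lemma nsqZ c x : nsq (c *: x) = sqabs c * nsq x.
Proof.
by rewrite /nsq dotZl dotZr mulrA mulcJ dot_self -rmorphM.
Qed.

Lemma cauchy_schwarz x y : sqabs (dot x y) <= nsq x * nsq y.
Proof.
have [y0|y0] := eqVneq (nsq y) 0.
  have -> : y = 0 by apply: (dot_definite ip).
  by rewrite dot0r /sqabs /= expr0n addr0 nsq0 mulr0.
have yp : 0 < nsq y by rewrite lt_neqAle eq_sym y0 nsq_ge0.
pose c := dot x y / (nsq y)%:C%C.
have := nsq_ge0 (x - c *: y); rewrite nsqB nsqZ dotZr.
have -> : sqabs c = sqabs (dot x y) / nsq y ^+ 2.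
  by rewrite /c sqabsM !sqabsE normcVE normc_real gtr0_norm// exprVn.
have -> : complex.Re (c^*%C * dot x y) = sqabs (dot x y) / nsq y.
  rewrite /c; have -> : (nsq y)%:C%C^-1 = (nsq y)^-1%:C%C by rewrite fmorphV.
  by case: (dot x y) => a b; rewrite /sqabs /=; ring.
move=> h; rewrite -ler_pdivrMr//.
have e : sqabs (dot x y) / nsq y ^+ 2 * nsq y = sqabs (dot x y) / nsq y by field.
by rewrite e in h; move: (sqabs _ / _) h => q; lra.
Qed.

Notation nrm := (hnorm dot).

Lemma hnorm_ge0 x : 0 <= nrm x. Proof. exact: sqrtr_ge0. Qed.

Lemma sqr_hnorm x : nrm x ^+ 2 = nsq x.
Proof. by rewrite sqr_sqrtr// nsq_ge0. Qed.

Lemma hnorm_le x (a : R) : 0 <= a -> (nrm x <= a) = (nsq x <= a ^+ 2).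
Proof.
by move=> a0; rewrite -sqr_hnorm ler_pXn2r// nnegrE hnorm_ge0.
Qed.

Lemma normc_dot x y : normc (dot x y) <= nrm x * nrm y.
Proof.
rewrite -(@ler_pXn2r _ 2)// ?nnegrE ?normc_ge0 ?mulr_ge0 ?hnorm_ge0//.
by rewrite -sqabsE exprMn !sqr_hnorm cauchy_schwarz.
Qed.

Lemma hnormD x y : nrm (x + y) <= nrm x + nrm y.
Proof.
rewrite hnorm_le ?addr_ge0 ?hnorm_ge0// nsqD sqrrD !sqr_hnorm.
have := normc_dot x y; have := le_trans (ler_norm _) (normr_Re (dot x y)).
by rewrite -mulr_natl; move: (nrm x * nrm y) => q; lra.
Qed.

Lemma hnormZ c x : nrm (c *: x) = normc c * nrm x.
Proof.
rewrite /hnorm -/(nsq _) nsqZ sqabsE sqrtrM ?sqr_ge0// sqrtr_sqr ger0_norm//.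
exact: normc_ge0.
Qed.

Lemma hnorm0 : nrm 0 = 0.
Proof. by rewrite /hnorm dot0l /= sqrtr0. Qed.

Lemma bounded_lin c T S : bounded_op dot T -> bounded_op dot S ->
  bounded_op dot (fun x => c *: T x + S x).
Proof.
move=> [lT [M HM]] [lS [N HN]]; split.
  by move=> a x y; rewrite lT lS !scalerDr !scalerA (mulrC c) addrACA -!scalerA.
exists (normc c * M + N) => x; rewrite (le_trans (hnormD _ _))// hnormZ mulrDl lerD//.
by rewrite -mulrA ler_wpM2l// normc_ge0.
Qed.

Lemma bounded_comp T S : bounded_op dot T -> bounded_op dot S ->
  bounded_op dot (T \o S).
Proof.
move=> [lT [M HM]] [lS [N HN]]; split; first by move=> a x y /=; rewrite lS lT.
exists (`|M| * N) => x /=; apply: (le_trans (HM _)).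
apply: (@le_trans _ _ (`|M| * nrm (S x))).
  by rewrite ler_wpM2r ?hnorm_ge0// ler_norm.
by rewrite -mulrA ler_wpM2l.
Qed.

Lemma bounded0 : bounded_op dot (fun=> 0).
Proof.
split; first by move=> a x y; rewrite scaler0 addr0.
by exists 0 => x; rewrite hnorm0 mul0r.
Qed.

Section riesz.

Hypothesis complete : forall u : nat -> H,
  (forall e : R, 0 < e -> exists N, forall p q, (N <= p)%N -> (N <= q)%N ->
     nsq (u p - u q) <= e) ->
  exists x, forall e : R, 0 < e -> exists N, forall p, (N <= p)%N -> nsq (u p - x) <= e.

(* The vector representing l minimizes |x|^2 - 2 Re (l x). *)
Lemma riesz (l : H -> C) (K : R) : (forall c x y, l (c *: x + y) = c * l x + l y) ->
  (forall x, sqabs (l x) <= K * nsq x) -> exists g, forall x, l x = dot x g.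
Proof.
move=> llin lK; pose J x := nsq x - 2 * complex.Re (l x).
have l0 : l 0 = 0.
  have := llin 1 0 0; rewrite scaler0 addr0 mul1r => /eqP.
  by rewrite -[X in X == _]addr0 (inj_eq (addrI _)) eq_sym => /eqP.
have lD x y : l (x + y) = l x + l y by have := llin 1 x y; rewrite scale1r mul1r.
have lZ c x : l (c *: x) = c * l x by have := llin c x 0; rewrite addr0 l0 addr0.
(* 2 Re (l x) <= |K| + |x| ^ 2, because the square of the left side is at most 4 |K| |x| ^ 2. *)
have Jge x : - `|K| <= J x.
  have h1 : complex.Re (l x) ^+ 2 <= `|K| * nsq x.
    apply: (@le_trans _ _ (sqabs (l x))); first by rewrite /sqabs lerDl sqr_ge0.
    by apply: (le_trans (lK x)); rewrite ler_wpM2r ?nsq_ge0// ler_norm.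
  have : (2 * complex.Re (l x)) ^+ 2 <= (`|K| + nsq x) ^+ 2.
    have := sqr_ge0 (`|K| - nsq x).
    have -> : (`|K| - nsq x) ^+ 2 = (`|K| + nsq x) ^+ 2 - 4 * (`|K| * nsq x) by ring.
    by rewrite exprMn (_ : 2 ^+ 2 = 4 :> R); [lra|ring].
  rewrite -ler_sqrt ?sqr_ge0// !sqrtr_sqr (@ger0_norm _ (`|K| + nsq x)) ?addr_ge0 ?nsq_ge0//.
  by move=> h; have := le_trans (ler_norm _) h; rewrite /J; lra.
have hi : has_inf (range J).
  split; first by exists (J 0), 0.
  by exists (- `|K|) => _ [x _ <-]; exact: Jge.
set m := inf (range J).
have Jm x : m <= J x by apply: ge_inf; [exact: hi.2|exists x].
have /choice[u Hu] n : exists x, J x <= m + n.+1%:R^-1.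
  have n0 : 0 < n.+1%:R^-1 :> R by rewrite invr_gt0.
  by have [_ [x _ <-] h] := inf_adherent n0 hi; exists x; exact: ltW.
(* The parallelogram law together with m <= J at the midpoint: minimizing sequences are Cauchy. *)
have Jmid x y : nsq (x - y) <= 2 * (J x + J y) - 4 * m.
  have := Jm (2^-1 *: (x + y)); rewrite /J nsqZ lZ lD nsqD nsqB.
  have -> : sqabs (2^-1 : C) = 4^-1.
    have -> : 2^-1 = (2^-1)%:C%C :> C by rewrite fmorphV rmorph_nat.
    by rewrite /sqabs /= expr0n addr0; field.
  have -> : complex.Re (2^-1 * (l x + l y)) = 2^-1 * (complex.Re (l x) + complex.Re (l y)).
    have -> : 2^-1 = (2^-1)%:C%C :> C by rewrite fmorphV rmorph_nat.
    by case: (l x) (l y) => [? ?] [? ?] /=; ring.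
  by rewrite mulrDr; lra.
have small (e : R) : 0 < e -> exists N, forall p, (N <= p)%N -> (p.+1%:R^-1 : R) <= e.
  move=> e0; exists (Num.bound e^-1) => p Np.
  rewrite -[leRHS]invrK lef_pV2 ?posrE ?invr_gt0//.
  apply/ltW; apply: (lt_le_trans (archi_boundP _)); first by rewrite invr_ge0 ltW.
  by rewrite ler_nat leqW.
have [g Hg] : exists x, forall e : R, 0 < e -> exists N, forall p, (N <= p)%N -> nsq (u p - x) <= e.
  apply: complete => e e0; have e4 : 0 < e / 4 by rewrite divr_gt0.
  have [N HN] := small _ e4; exists N => p q Np Nq.
  apply: (le_trans (Jmid _ _)); have := Hu p; have := Hu q; have := HN p Np; have := HN q Nq.
  move: (J (u p)) (J (u q)) (p.+1%:R^-1) (q.+1%:R^-1) => a b c d; lra.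
exists g.
(* The limit of J (u p + w) - J (u p) >= - 1 / (p + 1) as u p tends to g. *)
have var w : 0 <= nsq w + 2 * complex.Re (dot w g - l w).
  apply/ler_addgt0Pr => e e0.
  have e3 : 0 < e / 2 by rewrite divr_gt0.
  have [N1 H1] := small _ e3.
  have w1 : 0 < nsq w + 1 by rewrite ltr_wpDl ?nsq_ge0.
  have [N2 H2] := Hg ((e / 4) ^+ 2 / (nsq w + 1)) (divr_gt0 (exprn_gt0 _ (divr_gt0 e0 (ltr0n _ 4))) w1).
  pose p := maxn N1 N2; have := H1 p (leq_maxl _ _); have := H2 p (leq_maxr _ _).
  move=> h2 h1.
  have := Jm (u p + w); have := Hu p; rewrite /J nsqD lD raddfD /=.
  have h3 : `|complex.Re (dot w (u p - g))| <= e / 4.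
    apply: (le_trans (normr_Re _)); rewrite -(@ler_pXn2r _ 2)// ?nnegrE ?normc_ge0 ?divr_ge0 ?(ltW e0)//.
    rewrite -sqabsE; apply: (le_trans (cauchy_schwarz _ _)).
    apply: (@le_trans _ _ ((nsq w + 1) * ((e / 4) ^+ 2 / (nsq w + 1)))).
      by rewrite ler_pM ?nsq_ge0// lerDl.
    by rewrite mulrC mulfVK// gt_eqF.
  move: h3; rewrite dotBr raddfB /= ler_norml => /andP[h3 h4].
  have -> : complex.Re (dot w g - l w) = complex.Re (dot w g) - complex.Re (l w) by rewrite raddfB.
  rewrite (Re_dotC w (u p)).
  move: (complex.Re (dot w (u p))) (complex.Re (dot w g)) h3 h4 (p.+1%:R^-1) h1 => a b h3 h4 c h1.
  by move: (nsq (u p)) (nsq w) (complex.Re (l (u p))) (complex.Re (l w)) => ? ? ? ?; lra.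
(* [var] is applied to real multiples t w. The choice t = - q / (nsq w + 1) makes the expression
   negative unless q = 0; adding 1 keeps it defined for w = 0. *)
have re w : complex.Re (dot w g - l w) = 0.
  set q := complex.Re _; have vt (t : R) : 0 <= t ^+ 2 * nsq w + 2 * (t * q).
    have := var (t%:C%C *: w); rewrite nsqZ dotZl lZ -mulrBr.
    rewrite (_ : sqabs t%:C%C = t ^+ 2); last by rewrite /sqabs /= expr0n addr0.
    rewrite (_ : complex.Re (t%:C%C * _) = t * q)// /q.
    by case: (dot w g - l w) => a b /=; ring.
  have w1 : 0 < nsq w + 1 by rewrite ltr_wpDl ?nsq_ge0.
  have := vt (- q / (nsq w + 1)); set N := nsq w in w1 *.
  have -> : (- q / (N + 1)) ^+ 2 * N + 2 * (- q / (N + 1) * q) =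
     - (q ^+ 2 * ((N + 2) / (N + 1) ^+ 2)) by field; rewrite gt_eqF.
  rewrite oppr_ge0 pmulr_lle0; last first.
    by rewrite divr_gt0 ?exprn_gt0// ltr_wpDl ?nsq_ge0.
  move=> q2; apply/eqP; rewrite -sqrf_eq0 eq_le q2 sqr_ge0//.
move=> x; apply/eqP; rewrite eq_sym -subr_eq0; apply/eqP.
apply: complex_ext; first exact: re.
have := re ('i%C *: x); rewrite dotZl lZ -mulrBr.
by case: (dot x g - l x) => a b /= h; lra.
Qed.

End riesz.

Section reducing_subspaces.
Variables (I : Type) (P : I -> set H).
(** [P i] contains its double orthogonal complement. This is the form in which being a closed
    subspace is used, for linear combinations and for norm limits alike. *)
Hypothesis biorth : forall i x,
  (forall y, (forall p, P i p -> dot p y = 0) -> dot x y = 0) -> P i x.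

Definition orth (i : I) : set H := [set y | forall p, P i p -> dot p y = 0].

Definition reducing : set (H -> H) := [set T | bounded_op dot T /\
  forall i, (forall p, P i p -> P i (T p)) /\ (forall y, orth i y -> orth i (T y))].

Let orth_lin i c x y : orth i x -> orth i y -> orth i (c *: x + y).
Proof. by move=> ox oy p Pp; rewrite dotDr dotZr ox// oy// mulr0 addr0. Qed.

Let P_lin i c x y : P i x -> P i y -> P i (c *: x + y).
Proof. by move=> Px Py; apply: biorth => z oz; rewrite (dot_lin ip) !oz// mulr0 addr0. Qed.

Let eps0 (z : C) (K : R) : 0 <= K -> (forall e : R, 0 < e -> normc z <= e * K) -> z = 0.
Proof.
move=> K0 h; apply/eqP; rewrite -normc_eq0 eq_le normc_ge0 andbT.
have K1 : 0 < K + 1 by rewrite ltr_wpDl.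
apply/ler_addgt0Pr => e e0; rewrite add0r.
apply: (le_trans (h (e / (K + 1)) _)); first by rewrite divr_gt0.
by rewrite mulrAC ler_pdivrMr// ler_pM2l// lerDl.
Qed.

(** Passing to the adjoint exchanges the two invariances, which is why they are required together.
    For norm limits, the pairings of T p with y and of p with T y vanish because they are
    arbitrarily small by Cauchy-Schwarz. *)
Lemma reducing_cstar : cstar_algebra dot reducing.
Proof.
split.
- by move=> T [].
- split; first exact: bounded0.
  move=> i; split => [p Pp|y oy p Pp]; last by rewrite dot0r.
  by apply: biorth => y _; rewrite dot0l.
- move=> c T S [bT HT] [bS HS]; split; first exact: bounded_lin.
  move=> i; have [T1 T2] := HT i; have [S1 S2] := HS i; split => [p Pp|y oy].
    by apply: P_lin; [exact: T1|exact: S1].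
  by apply: orth_lin; [exact: T2|exact: S2].
- move=> T S [bT HT] [bS HS]; split; first exact: bounded_comp.
  move=> i; have [T1 T2] := HT i; have [S1 S2] := HS i; split => [p Pp|y oy] /=.
    by apply: T1; exact: S1.
  by apply: T2; exact: S2.
- move=> T S [bT HT] bS TS; split => // i; have [T1 T2] := HT i; split.
    move=> p Pp; apply: biorth => y oy.
    by rewrite (dot_conj ip) -TS (dot_conj ip) T2// conjc0 conjc0.
  by move=> y oy p Pp; rewrite -TS oy//; exact: T1.
- move=> T bT HT; split => // i; split => [p Pp|y oy p Pp].
    apply: biorth => y oy; apply: (@eps0 _ (nrm p * nrm y)).
      by rewrite mulr_ge0 ?hnorm_ge0.
    move=> e /HT[S [bS HS] TS]; have [S1 S2] := HS i.
    have -> : dot (T p) y = dot (T p - S p) y by rewrite dotBl (oy (S p)) ?subr0//; exact: S1.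
    apply: (le_trans (normc_dot _ _)); rewrite mulrA ler_wpM2r ?hnorm_ge0//.
  apply: (@eps0 _ (nrm p * nrm y)); first by rewrite mulr_ge0 ?hnorm_ge0.
  move=> e /HT[S [bS HS] TS]; have [S1 S2] := HS i.
  have -> : dot p (T y) = dot p (T y - S y) by rewrite dotBr (S2 y oy p Pp) subr0.
  apply: (le_trans (normc_dot _ _)); rewrite mulrCA ler_wpM2l ?hnorm_ge0//.
Qed.

End reducing_subspaces.

End prehilbert.

(** * Completeness of the Bergman space; existence of Toeplitz operators *)

Section bergman_hilbert.
Context (R : realType) (n : nat) (lambda : R).
Hypothesis l1 : -1 < lambda.
Local Notation C := R[i].
Local Notation Cn := 'cV[C]_n.
Local Notation V := (vol R n).
Local Notation B := (@ball_coords R n).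
Local Notation X := (@of_real_coords R n).
Local Notation W t := (weight lambda (X t)).
Local Notation sqn := (@sqn R n lambda).
Local Notation L2 := (@L2 R n lambda).
Local Notation inner := (@inner R n lambda).
Local Notation A2 := (bergman n lambda).
Local Notation dot := (@bergman_inner R n lambda).
Implicit Types (f F : Cn -> C) (z h : Cn).

Lemma bergman_L2 (f : A2) : L2 f.
Proof. by have [] := bergmanP f. Qed.

Lemma bergman_ip : inner_product dot.
Proof.
split.
- by move=> c f g h; exact: inner_linear (bergman_L2 _) (bergman_L2 _) (bergman_L2 _).
- by move=> f g; exact: inner_conj (bergman_L2 _) (bergman_L2 _).
- by move=> f; rewrite /bergman_inner inner_self sqn_ge0.
- by move=> f; rewrite /bergman_inner inner_self /=; exact: bergman_sqn0.
Qed.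

Lemma nsq_bergman (f : A2) : nsq dot f = sqn f.
Proof. by rewrite /nsq /bergman_inner inner_self. Qed.

(** Fatou's lemma keeps the norm bound, and the locally uniform evaluation bounds feed
    [differentiable_limit] to keep holomorphy. *)
Lemma bergman_limit (v : nat -> A2) f (M : R) : (forall p, sqn (v p) <= M) ->
  (forall z, unit_ball z -> v p z @[p --> \oo] --> f z) ->
  (forall z, ~ unit_ball z -> f z = 0) ->
  exists2 g : A2, (g : Cn -> C) = f & sqn g <= M.
Proof.
move=> vM vf f0.
have mf : ball_measurable f.
  split.
    apply: (@measurable_fun_cvg _ _ _ B (fun p t => complex.Re (v p (X t)))).
      by move=> p; exact: (bergman_L2 (v p)).1.1.
    by move=> t Bt; apply: cvg_Re; exact: vf.
  apply: (@measurable_fun_cvg _ _ _ B (fun p t => complex.Im (v p (X t)))).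
    by move=> p; exact: (bergman_L2 (v p)).1.2.
  by move=> t Bt; apply: cvg_Im; exact: vf.
have intM : (\int[V]_(t in B) (W t * sqabs (f (X t)))%:E <= M%:E)%E.
  apply: (@fatou_cvg _ _ _ V B _ (fun p t => (W t * sqabs (v p (X t)))%:E)).
  - exact: measurable_ball_coords.
  - move=> p; apply/measurable_EFinP; apply: ball_measurable_sqabs.
    exact: (bergman_L2 (v p)).1.
  - by move=> p t _; rewrite lee_fin mulr_ge0 ?sqabs_ge0 ?weight_ge0.
  - move=> t Bt; rewrite EFinM; under eq_fun do rewrite EFinM.
    by apply: cvgeZl => //; apply: cvg_sqabs; exact: vf.
  - by move=> p; rewrite -sqnE ?lee_fin//; exact: bergman_L2.
have Lf : L2 f by split => //; exact: le_lt_trans intM (ltry _).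
have hf : holomorphic f.
  move=> z Bz; have [d d0 [K K0 H]] := bergman_evaluation l1 Bz.
  have d2 : 0 < d / 2 by rewrite divr_gt0.
  have box h : (forall i, normc (h i 0) <= 2 * (d / 2)) ->
      forall i, normc ((z + h) i 0 - z i 0) <= d.
    by move=> hd i; rewrite mxE addrC addKr (le_trans (hd i))// mulrC divfK.
  (* Evaluation bounds |v p| ^ 2 by K M, and x <= 1 + x ^ 2 turns this into a bound for |v p|
     itself. *)
  apply: (@differentiable_limit _ _ (fun p => v p : Cn -> C) f z (d / 2) (1 + K * M)) => //.
  - move=> p h /box /H[Bzh _]; have [_ hv _] := bergmanP (v p); exact: hv.
  - move=> p h /box /H[_ /(_ (v p))]; rewrite sqabsE => E.
    have E2 : normc (v p (z + h)) ^+ 2 <= K * M.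
      by apply: (le_trans E); rewrite ler_wpM2l.
    move: E2; move: (normc _) (K * M) => x y; have := sqr_ge0 (x - 2^-1).
    rewrite expr2 mulrBl !mulrBr -expr2 => h1 h2.
    by move: h1 h2; set x2 := x ^+ 2; lra.
  - by move=> h /box /H[Bzh _]; exact: vf.
have [g gf] := bergman_val Lf hf f0; exists g => //.
by rewrite gf -lee_fin sqnE.
Qed.

(** Evaluations give a pointwise limit f. Applying [bergman_limit] to the tails u p - u (q + N),
    with p fixed, shows that u p - f lies in the space with small norm. *)
Lemma bergman_complete (u : nat -> A2) :
  (forall e : R, 0 < e -> exists N, forall p q, (N <= p)%N -> (N <= q)%N ->
     nsq dot (u p - u q) <= e) ->
  exists x, forall e : R, 0 < e -> exists N, forall p, (N <= p)%N -> nsq dot (u p - x) <= e.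
Proof.
move=> Hu; have Hu1 := Hu; have ip := bergman_ip.
have cvgE z : exists l : C, (unit_ball z -> u p z @[p --> \oo] --> l) /\
    (~ unit_ball z -> l = 0).
  have [Bz|Bz] := pselect (unit_ball z); last by exists 0; split.
  have [d d0 [K K0 H]] := bergman_evaluation l1 Bz.
  have [|_ Hz] := H z; first by move=> i; rewrite subrr ComplexField.Normc.normc0 ltW.
  have [e e0|l ul] := @cauchy_seq_cvg _ (fun p => u p z); last by exists l.
  have K1 : 0 < K + 1 by rewrite ltr_wpDl.
  have e2 : 0 < (e / 2) ^+ 2 / (K + 1) by rewrite divr_gt0// exprn_gt0// divr_gt0.
  have [N HN] := Hu _ e2; exists N => p q Np Nq.
  apply: (@le_lt_trans _ _ (e / 2)); last by rewrite ltr_pdivrMr// ltr_pMr// ltr1n.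
  rewrite -(@ler_pXn2r _ 2)// ?nnegrE ?normc_ge0 ?divr_ge0 ?(ltW e0)// -sqabsE.
  apply: (le_trans (Hz (u p - u q))).
  apply: (@le_trans _ _ ((K + 1) * sqn (u p - u q : A2))).
    by rewrite ler_wpM2r ?sqn_ge0// lerDl.
  by rewrite mulrC -ler_pdivlMr// -nsq_bergman HN.
have /choice[f Hf] := cvgE.
have f0 z : ~ unit_ball z -> f z = 0 by exact: (Hf z).2.
have uf z : unit_ball z -> u p z @[p --> \oo] --> f z by exact: (Hf z).1.
have tail (e : R) N (p : nat) : (forall q, (N <= q)%N -> nsq dot (u p - u q) <= e) ->
    exists2 g : A2, (g : Cn -> C) = (u p : Cn -> C) - f & sqn g <= e.
  move=> H; apply: (@bergman_limit (fun q => u p - u (q + N)%N)).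
  - by move=> q; rewrite -nsq_bergman; apply: H; rewrite leq_addl.
  - move=> z Bz.
    have uN : u (q + N)%N z @[q --> \oo] --> f z.
      by have := uf z Bz; rewrite -(cvg_shiftn N).
    apply/cvg_seqP => r /((cvg_seqP _ _).1 uN)[K HK]; exists K => q /HK.
    have -> : (u p - u (q + N)%N : A2) z = u p z - u (q + N)%N z by [].
    have -> : ((u p : Cn -> C) - f) z = u p z - f z by [].
    by rewrite normc_distC; congr (normc _ < _); ring.
  - move=> z Bz; have [_ _ u0] := bergmanP (u p).
    have -> : ((u p : Cn -> C) - f) z = u p z - f z by [].
    by rewrite [u p z]u0// f0// subr0.
have [N0 HN0] := Hu 1 ltr01.
(* f is recovered inside the space as u N0 - g0. *)
have [g0 g0E _] : exists2 g : A2, (g : Cn -> C) = (u N0 : Cn -> C) - f & sqn g <= 1.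
  by apply: (@tail 1 N0) => q Nq; apply: HN0.
exists (u N0 - g0) => e e0; have [N HN] := Hu e e0; exists N => p Np.
have [g gE gl] : exists2 g : A2, (g : Cn -> C) = (u p : Cn -> C) - f & sqn g <= e.
  by apply: (@tail e N) => q Nq; apply: HN.
have -> : u p - (u N0 - g0) = g.
  apply: bergman_eq => z _; rewrite gE.
  have -> : (u p - (u N0 - g0) : A2) z = u p z - (u N0 z - g0 z) by [].
  have -> : g0 z = u N0 z - f z by rewrite g0E.
  have -> : ((u p : Cn -> C) - f) z = u p z - f z by [].
  by ring.
by rewrite nsq_bergman.
Qed.

Lemma sqnD (c : C) f g : L2 f -> L2 g ->
  sqn (c *: f + g) = sqabs c * sqn f + 2 * complex.Re (c * inner f g) + sqn g.
Proof.
move=> Lf Lg; have Lh := L2_lin c Lf Lg.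
have : (sqn (c *: f + g))%:C%C = c * (c * inner f f + inner g f)^*%C +
    (c * inner f g + inner g g)^*%C.
  rewrite -inner_self inner_linear// (inner_conj Lh Lf) (inner_conj Lh Lg).
  by rewrite !inner_linear.
rewrite !inner_self (inner_conj Lf Lg).
move: (inner f g) => q /(congr1 (@complex.Re R)) /= ->.
by case: c {Lh} q => [a b] [x y]; rewrite /sqabs /=; ring.
Qed.

(** On functions, as opposed to classes, the form is only semidefinite: sqn f = 0 does not give f =
    0. That case is settled by a value of t at which the quadratic inequality would read 0 <= -1. *)
Lemma L2_cauchy_schwarz f g : L2 f -> L2 g -> sqabs (inner f g) <= sqn f * sqn g.
Proof.
move=> Lf Lg; set q := inner f g; have fn := sqn_ge0 lambda f.
have H (t : R) : 0 <= t ^+ 2 * sqabs q * sqn f - 2 * (t * sqabs q) + sqn g.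
  have := sqn_ge0 lambda ((- t%:C%C * q^*%C) *: f + g); rewrite sqnD// -/q.
  rewrite (_ : sqabs (- t%:C%C * q^*%C) = t ^+ 2 * sqabs q); last first.
    by case: q => a b; rewrite /sqabs /=; ring.
  rewrite (_ : complex.Re (- t%:C%C * q^*%C * q) = - (t * sqabs q)) ?mulrN//.
  by case: q => a b; rewrite /sqabs /=; ring.
have [f0|f0] := eqVneq (sqn f) 0.
  have := H ((sqn g + 1) / (2 * sqabs q)); rewrite f0 mulr0 add0r mul0r.
  have [q0|q0] := eqVneq (sqabs q) 0; first by rewrite q0.
  have -> : 2 * ((sqn g + 1) / (2 * sqabs q) * sqabs q) = sqn g + 1 by field.
  lra.
have fp : 0 < sqn f by rewrite lt_neqAle eq_sym f0.
have := H (sqn f)^-1.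
have -> : (sqn f)^-1 ^+ 2 * sqabs q * sqn f = sqabs q / sqn f by field.
rewrite [_^-1 * sqabs q]mulrC => h.
by rewrite mulrC -ler_pdivrMr//; move: (_ / _) h => x; lra.
Qed.

Lemma bergman_projectsP f (g : A2) : L2 f ->
  bergman_projects f g <-> forall h : A2, inner f h = dot g h.
Proof.
move=> Lf; have E (h : A2) : inner (f - (g : Cn -> C)) h = inner f h - dot g h.
  have -> : f - (g : Cn -> C) = -1 *: (g : Cn -> C) + f by rewrite scaleN1r addrC.
  by rewrite inner_linear ?mulN1r 1?addrC//; exact: bergman_L2.
split=> H h; first by apply/eqP; rewrite -subr_eq0 -E H.
by rewrite E H subrr.
Qed.

(** The Riesz representative of h |-> <h, f>, bounded by Cauchy-Schwarz in L^2, is the projection of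
    f. *)
Lemma projection_exists f : L2 f -> exists g : A2, bergman_projects f g.
Proof.
move=> Lf.
have [| |g Hg] := @riesz _ _ _ bergman_ip bergman_complete (fun h : A2 => inner h f) (sqn f).
- by move=> c x y; exact: inner_linear (bergman_L2 _) (bergman_L2 _) Lf.
- move=> x; rewrite nsq_bergman mulrC; exact: L2_cauchy_schwarz (bergman_L2 _) Lf.
exists g; apply/bergman_projectsP => // h.
by rewrite (inner_conj (bergman_L2 h) Lf) Hg -(dot_conj bergman_ip).
Qed.

Lemma toeplitz_exists a : Linfty a -> exists S : A2 -> A2, is_toeplitz a S.
Proof.
move=> La; have /choice[S HS] (f : A2) : exists g : A2, bergman_projects (fun z => a z * f z) g.
  by apply: projection_exists; exact: L2_mul_Linfty La (bergman_L2 f).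
by exists S.
Qed.

Lemma toeplitz_dot a (S : A2 -> A2) (f h : A2) : Linfty a -> is_toeplitz a S ->
  dot (S f) h = inner (fun z => a z * f z) h.
Proof.
move=> La HS; have := HS f; move/bergman_projectsP => ->//.
exact: L2_mul_Linfty La (bergman_L2 f).
Qed.

(** [is_toeplitz] only prescribes pairings, so linearity is derived: the defect pairs to 0 with
    itself. For the norm, |S f| ^ 2 = <a f, S f> and Cauchy-Schwarz give |S f| <= |a f|. *)
Lemma toeplitz_bounded a (S : A2 -> A2) : Linfty a -> is_toeplitz a S ->
  bounded_op dot S.
Proof.
move=> La HS; have ip := bergman_ip; have La2 (f : A2) := L2_mul_Linfty La (bergman_L2 f).
split=> [c f g|].
  apply/eqP; rewrite -subr_eq0; apply/eqP; apply: (dot_definite ip).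
  set y := _ - _; suff -> : dot y y = 0 by [].
  rewrite {1}/y (dotBl ip) (dot_lin ip) !(toeplitz_dot _ _ La HS).
  rewrite -inner_linear ?subr_eq0//; last exact: bergman_L2.
  apply/eqP; rewrite subr_eq0; apply/eqP; apply: inner_eq => // z _.
  rewrite bergman_lin !fctE /GRing.scale /= mulrDr; congr (_ + _).
  by rewrite mulrCA.
have [M M0 HM] := sqn_mul_Linfty lambda La; exists (Num.sqrt M) => f.
rewrite -[_ * _]/(_ * Num.sqrt _) -sqrtrM// ler_sqrt ?mulr_ge0 ?(dot_ge0 ip)//.
rewrite -!/(nsq dot _) !nsq_bergman.
apply: (@le_trans _ _ (sqn (fun z => a z * (f : A2) z))); last exact: HM (bergman_L2 f).
have := L2_cauchy_schwarz (La2 f) (bergman_L2 (S f)).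
rewrite -(toeplitz_dot f (S f) La HS) /bergman_inner inner_self [sqabs _]/sqabs /= expr0n addr0.
rewrite expr2; have [->|S0] := eqVneq (sqn (S f)) 0; first by rewrite sqn_ge0.
by rewrite ler_pM2r// lt_neqAle eq_sym S0 sqn_ge0.
Qed.

End bergman_hilbert.

(** * Totality of the monomials *)

Section orbit_averages.
Context (R : realType) (H : lmodType R[i]) (dot : H -> H -> R[i]).
Hypothesis ip : inner_product dot.
Hypothesis complete : forall u : nat -> H,
  (forall e : R, 0 < e -> exists N, forall p q, (N <= p)%N -> (N <= q)%N ->
     nsq dot (u p - u q) <= e) ->
  exists x, forall e : R, 0 < e -> exists N, forall p, (N <= p)%N -> nsq dot (u p - x) <= e.

Variable V : nat -> H -> H.
Hypothesis V_lin : forall j c x y, V j (c *: x + y) = c *: V j x + V j y.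
Hypothesis V_iso : forall j x y, dot (V j x) (V j y) = dot x y.
Hypothesis V0 : forall x, V 0 x = x.
Hypothesis VV : forall j x, V j.+1 (V j.+1 x) = V j x.

(** The mean of the vectors V_n ^ l y for l < 2 ^ n, built by doubling since V_n squares to
    V_(n-1). *)
Fixpoint orbit_average (y : H) (n : nat) : H :=
  if n is n'.+1 then
    2^-1 *: (orbit_average y n' + V n'.+1 (orbit_average y n'))
  else y.

Let VD j x y : V j (x + y) = V j x + V j y.
Proof. by have := V_lin j 1 x y; rewrite !scale1r. Qed.

Let V00 j : V j 0 = 0.
Proof. by have := VD j 0 0; rewrite addr0 -[X in X = _]addr0 => /addrI. Qed.

Let VZ j c x : V j (c *: x) = c *: V j x.
Proof. by have := V_lin j c x 0; rewrite !addr0 V00 addr0. Qed.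

(** V_n exchanges the two halves of the n-th average, because its square fixes the previous one; V_j
    with j < n is an iterated square of V_n. *)
Lemma orbit_average_fixed y n j : (j <= n)%N -> V j (orbit_average y n) = orbit_average y n.
Proof.
have F m : V m (orbit_average y m) = orbit_average y m.
  elim: m => [|m IH] /=; first by rewrite V0.
  by rewrite VZ VD VV IH addrC.
move=> jn; rewrite -(subKn jn); elim: (n - j)%N => [|d IH]; first by rewrite subn0.
have [nd|dn] := leqP n d.
  by move: IH; rewrite (eqP nd) (_ : (n - d.+1 = 0)%N)//; apply/eqP; exact: leqW.
by rewrite -VV subnSK// !IH.
Qed.

Lemma dot_orbit_average y h n : (forall j, (j <= n)%N -> V j h = h) ->
  dot h (orbit_average y n) = dot h y.
Proof.
elim: n => [//|n IH] Hh /=; rewrite (dotZr ip) (dotDr ip).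
rewrite -{2}(Hh n.+1)// V_iso IH => [|j jn]; last by apply: Hh; exact: leqW.
have -> : (2^-1)^*%C = 2^-1 :> R[i].
  have -> : 2^-1 = (2^-1)%:C%C :> R[i] by rewrite fmorphV rmorph_nat.
  by apply: complex_ext; rewrite //= oppr0.
by field.
Qed.

(* The n-th average q_n is fixed by V_j for j <= n, hence <q_m, q_n> = |q_m|^2 for
   n <= m, and (q_n) is Cauchy because |q_n| decreases. *)
Lemma orbit_average_cvg y : exists2 g,
  forall e : R, 0 < e -> exists N, forall p, (N <= p)%N ->
    nsq dot (orbit_average y p - g) <= e &
  forall h, (forall j, V j h = h) -> dot g h = dot y h.
Proof.
set q := orbit_average y.
have qq m n : (n <= m)%N -> dot (q m) (q n) = dot (q m) (q m).
  move=> nm; transitivity (dot (q m) y); last apply: esym;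
  by apply: dot_orbit_average => j jn; apply: orbit_average_fixed; rewrite ?(leq_trans jn).
have qB m n : (n <= m)%N -> nsq dot (q n - q m) = nsq dot (q n) - nsq dot (q m).
  move=> nm; rewrite (nsqB ip) (Re_dotC ip) qq// /nsq; ring.
have mono m n : (n <= m)%N -> nsq dot (q m) <= nsq dot (q n).
  by move=> nm; rewrite -subr_ge0 -qB// nsq_ge0.
pose A := range (fun n => nsq dot (q n)).
have hi : has_inf A.
  split; first by exists (nsq dot (q 0%N)), 0%N.
  by exists 0 => _ [n _ <-]; exact: nsq_ge0.
have [|g Hg] := complete (u := q).
  move=> e e0; have [_ [N _ <-] HN] := inf_adherent e0 hi.
  have gap p r : (N <= p)%N -> (p <= r)%N -> nsq dot (q p) - nsq dot (q r) <= e.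
    move=> Np pr; have : inf A <= nsq dot (q r) by apply: ge_inf; [exact: hi.2|exists r].
    have := mono _ _ Np; move: HN; move: (nsq _ _) (nsq _ _) (nsq _ _) (inf A) => a b c d; lra.
  exists N => p r Np Nr; have [pr|/ltnW rp] := leqP p r; first by rewrite qB// gap.
  by rewrite -(nsqN ip) opprB qB// gap.
exists g => // h Vh.
have qh p : dot (q p) h = dot y h.
  by rewrite (dot_conj ip) dot_orbit_average// -(dot_conj ip).
apply/eqP; rewrite -subr_eq0 -normc_eq0 eq_le normc_ge0 andbT.
apply/ler_addgt0Pr => e e0; rewrite add0r.
have h1 : 0 < nsq dot h + 1 by rewrite ltr_wpDl ?nsq_ge0.
have [N HN] := Hg (e ^+ 2 / (nsq dot h + 1)) (divr_gt0 (exprn_gt0 _ e0) h1).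
rewrite -(qh N) -(dotBl ip) -(@ler_pXn2r _ 2)// ?nnegrE ?normc_ge0 ?(ltW e0)// -sqabsE.
apply: (le_trans (cauchy_schwarz ip _ _)).
apply: (@le_trans _ _ (e ^+ 2 / (nsq dot h + 1) * (nsq dot h + 1))).
  apply: ler_pM; rewrite ?nsq_ge0 ?lerDl//.
  by rewrite -(nsqN ip) opprB HN.
by rewrite divfK// gt_eqF.
Qed.

End orbit_averages.

Section differentiability.
Context (R : realType) (n : nat).
Local Notation C := R[i].
Local Notation Cn := 'cV[C]_n.
Implicit Types (f g : Cn -> C) (z h : Cn).

Lemma differentiable_fun_mul f g z : differentiable f z -> differentiable g z ->
  differentiable (fun x => f x * g x) z.
Proof. by move=> df dg; exact: (differentiableM df dg). Qed.

Lemma differentiable_coordinate i z : differentiable (fun x : Cn => x i 0) z.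
Proof. exact: differentiable_coord. Qed.

Lemma differentiable_monomial (I : Type) (r : seq I) (s : I -> 'I_n) (a : I -> nat) z :
  differentiable (fun x : Cn => \prod_(i <- r) x (s i) 0 ^+ a i) z.
Proof.
have dX i k : differentiable (fun x : Cn => x i 0 ^+ k) z.
  elim: k => [|k IH]; first exact: differentiable_cst.
  under eq_fun do rewrite exprS.
  exact: differentiable_fun_mul (differentiable_coordinate i z) IH.
elim: r => [|i r IH].
  by under eq_fun do rewrite big_nil; exact: differentiable_cst.
under eq_fun do rewrite big_cons.
exact: differentiable_fun_mul (dX _ _) IH.
Qed.

Lemma differentiable_diagact (t : 'I_n -> C) z : (forall i, normc (t i) = 1) ->
  differentiable (diagact t) z.
Proof.
move=> t1; have lin : linear (diagact t).
  move=> c x y; apply/matrixP => i j; rewrite !mxE; ring.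
pose lL := HB.pack_for {linear Cn -> Cn} (diagact t) (GRing.isLinear.Build C Cn Cn _ _ lin).
suff cL : continuous lL by exact: (@linear_differentiable C Cn Cn lL z cL).
apply/linear_bounded_continuous/linear_boundedP; exists 1; split => // x x1 y.
have : `|lL y| <= `|y|.
  rewrite !colnormE lecR; apply/ler_addgt0Pr => e e0; apply/ltW/colnorm_lt => [|i].
    by rewrite ltr_wpDl ?colnorm_ge0.
  by rewrite mxE normcM t1 mul1r (le_lt_trans (normc_le_colnorm _ i))// ltrDl.
by move/le_trans; apply; rewrite -[leLHS]mul1r ler_wpM2r// ltW.
Qed.

End differentiability.

(** * Rotations and monomials in the Bergman space *)

Section monomial_basis.
Context (R : realType) (n : nat) (lambda : R).
Hypothesis l1 : -1 < lambda.
Local Notation C := R[i].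
Local Notation Cn := 'cV[C]_n.
Local Notation X := (@of_real_coords R n).
Local Notation L2 := (@L2 R n lambda).
Local Notation A2 := (bergman n lambda).
Local Notation dot := (@bergman_inner R n lambda).
Implicit Types (f g : A2) (z h : Cn) (a : 'I_n -> nat) (t : 'I_n -> C).

(** The case of a constant sequence in [differentiable_limit]; it serves functions extended by 0
    outside the ball, such as [mono a]. *)
Lemma differentiable_local (F G : Cn -> C) (M : R) : (forall z, unit_ball z -> differentiable G z) ->
  (forall z, unit_ball z -> normc (G z) <= M) -> (forall z, unit_ball z -> F z = G z) ->
  forall z, unit_ball z -> differentiable F z.
Proof.
move=> dG GM FG z Bz; have [d d0 [s /andP[s0 _] Hs]] := ball_box Bz.
have d2 : 0 < d / 2 by rewrite divr_gt0.
have inB h : (forall i, normc (h i 0) <= 2 * (d / 2)) -> unit_ball (z + h).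
  move=> hd; rewrite /unit_ball /=; apply: (@le_lt_trans _ _ (1 - s)); last by lra.
  by apply: Hs => i; have := hd i; rewrite mulrC divfK.
apply: (@differentiable_limit _ _ (fun=> G) F z (d / 2) M) => //.
- by move=> _ h /inB; exact: dG.
- by move=> _ h /inB; exact: GM.
- by move=> h /inB Bzh; rewrite FG//; exact: cvg_cst.
Qed.

Lemma unit_ball_diagact t z : (forall i, normc (t i) = 1) ->
  unit_ball (diagact t z) <-> unit_ball z.
Proof. by move=> t1; rewrite /unit_ball /= sqnorm_diagact. Qed.

(** The composition lies in the space when every t i has modulus 1 ([rotE]), so the default 0 is not
    met in that case. *)
Definition bergman_rot t f : A2 := insubd 0 ((f : Cn -> C) \o diagact t).

Lemma rotE t f z : (forall i, normc (t i) = 1) -> bergman_rot t f z = f (diagact t z).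
Proof.
move=> t1; have [Lf hf f0] := bergmanP f.
have P : (f : Cn -> C) \o diagact t \in bergman_pred lambda.
  apply/asboolP; split; first exact: L2_diagact.
  - move=> x /(unit_ball_diagact x t1) Bx; apply: differentiable_comp (hf _ Bx).
    exact: differentiable_diagact.
  - by move=> x Bx /=; apply: f0 => /(unit_ball_diagact x t1).
by rewrite /bergman_rot /bergman_fun -/(\val _) insubdK.
Qed.

Lemma dot_rot t f g : (forall i, normc (t i) = 1) -> dot (bergman_rot t f) (bergman_rot t g) = dot f g.
Proof.
move=> t1; rewrite /bergman_inner -[RHS](inner_diagact _ t1 (bergman_L2 f).1 (bergman_L2 g).1).
by apply: inner_eq => z _; rewrite rotE.
Qed.

Lemma rot_lin t (c : C) f g : (forall i, normc (t i) = 1) ->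
  bergman_rot t (c *: f + g) = c *: bergman_rot t f + bergman_rot t g.
Proof.
by move=> t1; apply: bergman_eq => z _; rewrite !bergman_lin rotE// bergman_lin !fctE !rotE.
Qed.

Definition mono a : A2 :=
  insubd 0 (fun z => if `[< unit_ball z >] then \prod_i z i 0 ^+ a i else 0).

Lemma normc_coord_le1 z i : unit_ball z -> normc (z i 0) <= 1.
Proof.
move=> Bz; rewrite -(@ler_pXn2r _ 2)// ?nnegrE ?normc_ge0// expr1n -sqabsE.
by apply: le_trans (ltW Bz); exact: le_sqnorm.
Qed.

Lemma normc_prod (I : Type) (r : seq I) (F : I -> C) :
  normc (\prod_(i <- r) F i) = \prod_(i <- r) normc (F i).
Proof.
elim: r => [|i r IH]; first by rewrite !big_nil ComplexField.Normc.normc1.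
by rewrite !big_cons normcM IH.
Qed.

Lemma L2_bounded (F : Cn -> C) : ball_measurable F ->
  (forall z, unit_ball z -> normc (F z) <= 1) -> L2 F.
Proof.
move=> mF F1; split => //; apply: le_lt_trans (weight_integrable _ l1).
have mS := ball_measurable_sqabs lambda mF.
apply: ge0_le_integral.
- exact: measurable_ball_coords.
- by move=> t _; rewrite lee_fin mulr_ge0 ?sqabs_ge0 ?weight_ge0.
- exact/measurable_EFinP.
- by apply/measurable_EFinP; exact: measurable_weight.
- move=> t Bt; rewrite lee_fin -[leRHS]mulr1 ler_wpM2l ?weight_ge0// sqabsE.
  by rewrite expr_le1// ?normc_ge0// F1.
Qed.

Lemma ball_measurable_prod (I : Type) (r : seq I) (F : I -> Cn -> C) :
  (forall i, ball_measurable (F i)) -> ball_measurable (fun z => \prod_(i <- r) F i z).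
Proof.
move=> mF; elim: r => [|i r IH].
  by under eq_fun do rewrite big_nil; split; exact: measurable_cst.
by under eq_fun do rewrite big_cons; exact: ball_measurableM.
Qed.

Lemma ball_measurable_coord i : ball_measurable (fun z : Cn => z i 0).
Proof.
have [m1 m2] := @measurable_tnthR2 R n i; split.
  apply: measurable_funTS; apply: eq_measurable_fun m1 => t _; by rewrite mxE.
apply: measurable_funTS; apply: eq_measurable_fun m2 => t _; by rewrite mxE.
Qed.

Lemma ball_measurable_exp (F : Cn -> C) k : ball_measurable F ->
  ball_measurable (fun z => F z ^+ k).
Proof.
move=> mF; elim: k => [|k IH]; first by split; exact: measurable_cst.
by under eq_fun do rewrite exprS; exact: ball_measurableM.
Qed.

Lemma ball_measurable_eq (F G : Cn -> C) : (forall z, unit_ball z -> F z = G z) ->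
  ball_measurable G -> ball_measurable F.
Proof.
move=> FG [mR mI]; split.
  by apply: eq_measurable_fun mR => t; rewrite inE => Bt; rewrite FG.
by apply: eq_measurable_fun mI => t; rewrite inE => Bt; rewrite FG.
Qed.

Lemma normc_monomial_le1 a z : unit_ball z -> normc (\prod_i z i 0 ^+ a i) <= 1.
Proof.
move=> Bz; rewrite normc_prod; apply: prodr_ile1 => i _.
by rewrite normc_ge0 normcX exprn_ile1// ?normc_ge0// normc_coord_le1.
Qed.

Lemma monoE a z : unit_ball z -> mono a z = \prod_i z i 0 ^+ a i.
Proof.
set F := fun z : Cn => if `[< unit_ball z >] then \prod_i z i 0 ^+ a i else 0.
have FE x : unit_ball x -> F x = \prod_i x i 0 ^+ a i by move=> Bx; rewrite /F asboolT.
have P : F \in bergman_pred lambda.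
  apply/asboolP; split.
  - apply: L2_bounded => [|x Bx]; last by rewrite FE// normc_monomial_le1.
    apply: (ball_measurable_eq FE); apply: ball_measurable_prod => i.
    by apply: ball_measurable_exp; exact: ball_measurable_coord.
  - move=> x; apply: (differentiable_local _ _ FE) => y; last exact: normc_monomial_le1.
    move=> _; exact: (differentiable_monomial _ id).
  - by move=> x Bx; rewrite /F asboolF.
by move=> Bz; rewrite -(FE z Bz) /mono /bergman_fun -/(\val _) insubdK.
Qed.

Lemma rot_mono t a : (forall i, normc (t i) = 1) ->
  bergman_rot t (mono a) = (\prod_i t i ^+ a i) *: mono a.
Proof.
move=> t1; apply: bergman_eq => z Bz; rewrite rotE//.
have -> : ((\prod_i t i ^+ a i) *: mono a : A2) z = (\prod_i t i ^+ a i) * mono a z by [].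
rewrite !monoE//; last exact/unit_ball_diagact.
by rewrite -big_split /=; apply: eq_bigr => i _; rewrite mxE exprMn.
Qed.

(** A point of the ball without zero coordinate, where no monomial vanishes: n / (n + 1) ^ 2 < 1. *)
Definition corner : Cn := const_mx n.+1%:R^-1%:C%C.

Lemma corner_in_ball : unit_ball corner.
Proof.
rewrite /unit_ball /= /sqnorm; under eq_bigr do rewrite mxE sqabsE normc_real.
rewrite sumr_const card_ord -[X in X < 1]mulr_natl.
rewrite ger0_norm ?invr_ge0 ?ler0n// exprVn ltr_pdivrMr ?exprn_gt0 ?ltr0n// mul1r.
by rewrite -natrX ltr_nat; exact: leq_pmulr.
Qed.

Lemma mono_neq0 a : mono a <> 0.
Proof.
move=> /(congr1 (fun f : A2 => f corner)); rewrite monoE; last exact: corner_in_ball.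
move=> /eqP; rewrite prodf_seq_eq0 => /hasP[i _ /=].
by rewrite mxE expf_eq0 => /andP[_]; rewrite fmorphV /= invr_eq0 rmorph_nat pnatr_eq0.
Qed.

End monomial_basis.

(** * Homogeneous parts in one variable, and totality *)

Section totality.
Context (R : realType) (n : nat) (lambda : R).
Hypothesis l1 : -1 < lambda.
Local Notation C := R[i].
Local Notation Cn := 'cV[C]_n.
Local Notation A2 := (bergman n lambda).
Local Notation dot := (@bergman_inner R n lambda).
Local Notation bergman_rot := (@bergman_rot R n lambda).
Local Notation mono := (@mono R n lambda).
Implicit Types (f g y : A2) (z h : Cn) (a : 'I_n -> nat) (t : 'I_n -> C) (i j : 'I_n).

Definition coord_scale i (c : C) : 'I_n -> C := fun j => if j == i then c else 1.

Definition coord_act i (c : C) z : Cn := diagact (coord_scale i c) z.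

Lemma normc_coord_scale i (c : C) : normc c = 1 -> forall j, normc (coord_scale i c j) = 1.
Proof. by move=> c1 j; rewrite /coord_scale; case: ifP; rewrite ?ComplexField.Normc.normc1. Qed.

Lemma coord_actM i (c d : C) z : coord_act i (c * d) z = coord_act i c (coord_act i d z).
Proof.
by apply/matrixP => j o; rewrite !mxE /coord_scale; case: ifP; rewrite ?mul1r ?mulrA.
Qed.

Lemma coord_act1 i z : coord_act i 1 z = z.
Proof. by apply/matrixP => j o; rewrite !mxE /coord_scale ord1; case: ifP; rewrite mul1r. Qed.

Lemma coord_actC i j (c d : C) z :
  coord_act i c (coord_act j d z) = coord_act j d (coord_act i c z).
Proof. by apply/matrixP => o o'; rewrite !mxE mulrCA. Qed.

(** Scaling one coordinate moves the point along a complex line through the point with that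
    coordinate set to 0, which gives access to [slice_cdiff]. *)
Lemma coord_act_affine i (c : C) z :
  coord_act i c z = coord_act i 0 z + c *: (z - coord_act i 0 z).
Proof.
apply/matrixP => j o; rewrite !mxE ord1 /coord_scale; case: ifP => _.
  by rewrite mul0r subr0 add0r.
by rewrite !mul1r subrr mulr0 addr0.
Qed.

Lemma coord_act_ball_le i z (c : C) (r : R) : 1 <= r -> normc c <= r ->
  sqnorm (coord_act i c z) <= r ^+ 2 * sqnorm z.
Proof.
move=> r1 cr; rewrite /sqnorm mulr_sumr ler_sum// => j _.
rewrite mxE sqabsM ler_wpM2r ?sqabs_ge0// sqabsE lerXn2r ?nnegrE ?normc_ge0//.
  by rewrite (le_trans _ r1).
by rewrite /coord_scale; case: ifP => // _; rewrite ComplexField.Normc.normc1.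
Qed.

Lemma coord_act_ball i z (c : C) : normc c <= 1 -> unit_ball z -> unit_ball (coord_act i c z).
Proof.
by move=> c1; apply: le_lt_trans; have := coord_act_ball_le i z (lexx 1) c1; rewrite expr1n mul1r.
Qed.

(** The ball is open, so slices extend slightly beyond the unit disc, as [dyavg_cvg] requires. *)
Lemma coord_act_ball_gt1 i z : unit_ball z ->
  exists2 r : R, 1 < r & forall c : C, normc c <= r -> unit_ball (coord_act i c z).
Proof.
rewrite /unit_ball /= => Bz; set S := sqnorm z in Bz *; have S0 : 0 <= S by exact: sqnorm_ge0.
exists (1 + (1 - S) / 4); first by rewrite ltrDl divr_gt0// subr_gt0.
move=> c cr; apply: (le_lt_trans (coord_act_ball_le i z _ cr)); first by lra.
by rewrite -/S; nra.
Qed.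

Lemma bergman_slice_expansion y i z : unit_ball z -> exists c : nat -> C,
  (\sum_(l < K) c l @[K --> \oo] --> y z) /\
  forall k (d : C), normc d <= 1 ->
    dyavg (coord_act i) k N y (coord_act i d z) @[N --> \oo] --> c k * d ^+ k.
Proof.
move=> Bz; have [_ hy _] := bergmanP y.
have [r r1 Hr] := coord_act_ball_gt1 i Bz.
have [w wr|c [_ Hc]] := @dyavg_cvg _ (fun w => y (coord_act i w z)) r r1.
  under eq_fun do rewrite coord_act_affine.
  by apply: slice_cdiff; rewrite -coord_act_affine; apply: hy; exact: Hr.
exists c; split.
  have [|H _] := Hc 1; first by rewrite ComplexField.Normc.normc1.
  by move: H; rewrite coord_act1; under eq_fun do under eq_bigr do rewrite expr1n mulr1.
move=> k d d1; have [_ /(_ k)] := Hc d d1.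
suff -> : (fun N => dyavg *%R k N (fun w => y (coord_act i (w * d) z)) 1) =
  (fun N => dyavg (coord_act i) k N y (coord_act i d z)) by [].
apply/funext => N.
rewrite (dyavg_slice (act := coord_act i)) => [|u v]; last by rewrite coord_actM.
by rewrite -[in RHS](mul1r d) (dyavg_slice (act := *%R)) => [|u v]; rewrite ?mulrA.
Qed.

Lemma bergman_cvg_pointwise (u : nat -> A2) g :
  (forall e : R, 0 < e -> exists N, forall p, (N <= p)%N -> nsq dot (u p - g) <= e) ->
  forall z, unit_ball z -> u p z @[p --> \oo] --> g z.
Proof.
move=> H z Bz; have [d d0 [K K0 HK]] := bergman_evaluation l1 Bz.
have [|_ Hz] := HK z; first by move=> i; rewrite subrr ComplexField.Normc.normc0 ltW.
apply/cvg_seqP => e e0; have K1 : 0 < K + 1 by rewrite ltr_wpDl.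
have [N HN] := H ((e / 2) ^+ 2 / (K + 1)) (divr_gt0 (exprn_gt0 _ (divr_gt0 e0 (ltr0n _ 2))) K1).
exists N => p Np; apply: (@le_lt_trans _ _ (e / 2)); last by rewrite ltr_pdivrMr// ltr_pMr// ltr1n.
rewrite -(@ler_pXn2r _ 2)// ?nnegrE ?normc_ge0 ?divr_ge0 ?(ltW e0)// -sqabsE.
apply: (le_trans (Hz (u p - g))).
apply: (@le_trans _ _ ((K + 1) * nsq dot (u p - g))).
  by rewrite nsq_bergman ler_wpM2r ?sqn_ge0// lerDl.
by rewrite mulrC -ler_pdivlMr// HN.
Qed.

(** The projection onto weight k for rotations of coordinate i. The averages of the isometries droot
    ^- k times rotation converge in norm; since their values are those of [dyavg], the same limit is
    found pointwise. *)
Lemma isotypic_part y i k : exists2 g : A2,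
  (forall z, unit_ball z -> dyavg (coord_act i) k N y z @[N --> \oo] --> g z) &
  forall h : A2, (forall c : C, normc c = 1 -> bergman_rot (coord_scale i c) h = c ^+ k *: h) ->
    dot g h = dot y h.
Proof.
pose V (j : nat) f : A2 := droot R j ^- k *: bergman_rot (coord_scale i (droot R j)) f.
have t1 (j : nat) := normc_coord_scale i (normc_droot R j).
have VE (j : nat) f z : V j f z = droot R j ^- k * f (coord_act i (droot R j) z).
  by rewrite -[LHS]/(_ * bergman_rot _ _ z) rotE.
have Vlin (j : nat) c f g : V j (c *: f + g) = c *: V j f + V j g.
  by rewrite /V rot_lin// scalerDr !scalerA mulrC.
have Viso (j : nat) f g : dot (V j f) (V j g) = dot f g.
  rewrite /V (dotZl (bergman_ip n l1)) (dotZr (bergman_ip n l1)) dot_rot// mulrA mulcJ.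
  by rewrite sqabsE normcVE normcX normc_droot !expr1n invr1 expr1n mul1r.
have V0 f : V 0%N f = f.
  by apply: bergman_eq => z _; rewrite VE droot0 expr1n invr1 mul1r coord_act1.
have VV (j : nat) f : V j.+1 (V j.+1 f) = V j f.
  apply: bergman_eq => z _; rewrite !VE -coord_actM mulrA -expr2 -(droot_sqr R j).
  by rewrite exprVn -!exprM mulnC -expr2.
have [g Hg gh] := orbit_average_cvg (bergman_ip n l1) (bergman_complete l1) Vlin Viso V0 VV y.
have half (f f' : A2) z : (2^-1 *: (f + f') : A2) z = 2^-1 * (f z + f' z) by [].
exists g => [z Bz|h Hh].
  have := bergman_cvg_pointwise Hg Bz.
  suff -> : (fun p => (orbit_average V y p : A2) z) = (fun N => dyavg (coord_act i) k N y z) by [].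
  apply/funext => N; elim: N z {Bz} => [//|N IH] z.
  rewrite [orbit_average V y N.+1]/(2^-1 *: (_ + _)) half.
  by rewrite VE !IH.
by apply: gh => j; rewrite /V Hh ?normc_droot// scalerA mulVf ?scale1r// expf_neq0// droot_neq0.
Qed.

Lemma bergmanZ (c : C) f z : (c *: f : A2) z = c * f z.
Proof. by []. Qed.

(** Homogeneity on the closed disc and not just the circle: values at different points of the ball
    can then be compared by scaling coordinates. *)
Definition isotypic y i (k : nat) := forall (c : C) z, normc c <= 1 -> unit_ball z ->
  y (coord_act i c z) = c ^+ k * y z.

Lemma isotypic_dyavg y i j (b k N : nat) (c : C) z : isotypic y j b -> normc c <= 1 ->
  unit_ball z -> dyavg (coord_act i) k N y (coord_act j c z) =
                 c ^+ b * dyavg (coord_act i) k N y z.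
Proof.
move=> yb c1; elim: N z => [|N IH] z Bz /=; first exact: yb.
rewrite coord_actC !IH//; first ring.
by apply: coord_act_ball => //; rewrite normc_droot.
Qed.

(* The degree k is that of a nonzero Taylor coefficient of y in the i-th variable. *)
Lemma isotypic_step y i : y <> 0 -> exists k, exists g : A2, [/\ g <> 0, isotypic g i k,
  forall j b, isotypic y j b -> isotypic g j b &
  forall h : A2, (forall c : C, normc c = 1 -> bergman_rot (coord_scale i c) h = c ^+ k *: h) ->
    dot g h = dot y h].
Proof.
move=> y0; have /choice[G HG] k : exists g : A2,
    (forall z, unit_ball z -> dyavg (coord_act i) k N y z @[N --> \oo] --> g z) /\
    forall h : A2, (forall c : C, normc c = 1 -> bergman_rot (coord_scale i c) h = c ^+ k *: h) ->
    dot g h = dot y h.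
  by have [g ? ?] := isotypic_part y i k; exists g.
have [k Gk] : exists k, G k <> 0.
  apply: contrapT => /forallNP G0; apply: y0; apply: bergman_eq => z Bz.
  have [c [cy Hc]] := bergman_slice_expansion y i Bz.
  have c0 k : c k = 0.
    have := Hc k 1; rewrite ComplexField.Normc.normc1 coord_act1 expr1n mulr1.
    move=> /(_ (lexx _)) H; apply: (cvg_seq_unique H).
    by have := (HG k).1 z Bz; have /contrapT -> := G0 k.
  apply: (cvg_seq_unique cy); under eq_fun do rewrite big1//.
  exact: cvg_cst.
exists k, (G k); have [Hg gh] := HG k; split => // [c z c1 Bz|j b yb c z c1 Bz].
  have [d [_ Hd]] := bergman_slice_expansion y i Bz.
  have E (e : C) : normc e <= 1 -> G k (coord_act i e z) = d k * e ^+ k.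
    move=> e1; apply: (cvg_seq_unique (Hg _ _) (Hd k e e1)).
    exact: coord_act_ball.
  rewrite E// -[in RHS](coord_act1 i z) E ?ComplexField.Normc.normc1// expr1n mulr1.
  by rewrite mulrC.
apply: (cvg_seq_unique (Hg _ (coord_act_ball j c1 Bz))).
under eq_fun do rewrite (isotypic_dyavg _ _ _ yb)//.
apply/cvg_seqP => e e0.
have b1 : normc (c ^+ b) <= 1 by rewrite normcX exprn_ile1// normc_ge0.
have [N HN] := (cvg_seqP _ _).1 (Hg z Bz) e e0; exists N => m /HN; apply: le_lt_trans.
by rewrite -mulrBr normcM ler_piMl// normc_ge0.
Qed.

Lemma rot_coord_mono i (c : C) a : normc c = 1 ->
  bergman_rot (coord_scale i c) (mono a) = c ^+ a i *: mono a.
Proof.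
move=> c1; rewrite rot_mono//; last exact: normc_coord_scale.
rewrite (bigD1 i)//= /coord_scale eqxx big1 ?mulr1// => j /negbTE ->.
by rewrite expr1n.
Qed.

(** One coordinate is made homogeneous at a time. A step preserves pairings only with vectors of the
    chosen weight, so orthogonality is retained exactly for monomials whose exponents agree with a
    on the treated coordinates. *)
Lemma isotypic_exists y (s : seq 'I_n) : y <> 0 -> uniq s ->
  (forall a, dot y (mono a) = 0) ->
  exists g : A2, exists2 a, g <> 0 /\ (forall i, i \in s -> isotypic g i (a i)) &
    forall b, (forall i, i \in s -> b i = a i) -> dot g (mono b) = 0.
Proof.
move=> y0 us yo; elim: s us => [_|i s IH /= /andP[ni /IH[f [a [f0 fiso] fo]]]].
  by exists y, (fun=> 0%N).
have [k [g [g0 gk gj gh]]] := isotypic_step i f0.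
exists g, (fun j => if j == i then k else a j).
  split=> // j; rewrite inE => /orP[/eqP ->|js]; first by rewrite eqxx.
  by case: eqP => [->//|_]; apply: gj; exact: fiso.
move=> b Hb; have bi := Hb i; rewrite inE !eqxx in bi.
rewrite gh => [|c c1]; last by rewrite rot_coord_mono// bi.
apply: fo => j js; rewrite Hb ?inE ?js ?orbT//.
by case: eqP js ni => // -> ->.
Qed.

(** A nonzero y orthogonal to all monomials would have a nonzero part g homogeneous in every
    variable. Such a g is a multiple of one monomial and still orthogonal to it, a contradiction. *)
Lemma bergman_total y : (forall a, dot y (mono a) = 0) -> y = 0.
Proof.
move=> yo; apply: contrapT => y0.
have [g [a [g0 giso] go]] := isotypic_exists y0 (enum_uniq 'I_n) yo.
have act_all (c : 'I_n -> C) z : (forall i, normc (c i) <= 1) -> unit_ball z ->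
    g (diagact c z) = (\prod_i c i ^+ a i) * g z.
  move=> c1 Bz.
  have H (s : seq 'I_n) : uniq s -> unit_ball (diagact (fun i => if i \in s then c i else 1) z) /\
      g (diagact (fun i => if i \in s then c i else 1) z) = (\prod_(i <- s) c i ^+ a i) * g z.
    elim: s => [_|i s IH /= /andP[ni /IH[Bs gs]]].
      rewrite big_nil mul1r (_ : diagact _ z = z)//.
      by apply/matrixP => o o'; rewrite !mxE mul1r ord1.
    have -> : diagact (fun j => if j \in i :: s then c j else 1) z =
        coord_act i (c i) (diagact (fun j => if j \in s then c j else 1) z).
      apply/matrixP => j o; rewrite !mxE /coord_scale inE.
      by case: eqP => [->|_] /=; rewrite ?(negbTE ni) mul1r.
    split; first exact: coord_act_ball.
    by rewrite (giso i (mem_enum _ _)) ?gs ?big_cons ?mulrA.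
  have [_] := H _ (enum_uniq 'I_n); rewrite big_enum /= => <-.
  by congr (g (diagact _ z)); apply/funext => i; rewrite mem_enum.
pose e : C := n.+1%:R^-1%:C%C; pose b : Cn := corner R n.
have e0 : e != 0 by rewrite /e fmorphV /= invr_eq0 rmorph_nat pnatr_eq0.
have e1 : normc e <= 1.
  by rewrite normc_real ger0_norm ?invr_ge0 ?ler0n// invf_le1 ?ltr0n// ler1n.
have Bb : unit_ball b by exact: corner_in_ball.
pose E := \prod_i e ^+ a i.
have E0 : E != 0 by apply/prodf_neq0 => i _; rewrite expf_neq0.
(* The point with coordinates e z_i is z scaled by e, and also the corner scaled by z; evaluating g
   there in both ways expresses g z through g at the corner. *)
have gE : g = (g b / E) *: mono a.
  apply: bergman_eq => z Bz.
  rewrite bergmanZ monoE//.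
  have H1 : g (diagact (fun=> e) z) = E * g z by rewrite act_all.
  have H2 : g (diagact (fun=> e) z) = (\prod_i z i 0 ^+ a i) * g b.
    rewrite -act_all// => [|i]; last exact: normc_coord_le1.
    congr (bergman_fun g _); apply/matrixP => i o; by rewrite !mxE mulrC.
  have : E * g z = (\prod_i z i 0 ^+ a i) * g b by rewrite -H1.
  by move=> H; apply: (mulfI E0); rewrite H; field.
have := go a (fun _ _ => erefl); rewrite {1}gE (dotZl (bergman_ip n l1)) => /eqP.
rewrite mulf_eq0 => /orP[/eqP c0|/eqP /(dot_self0 (bergman_ip n l1))].
  by apply: g0; rewrite gE c0 scale0r.
exact: mono_neq0.
Qed.

End totality.

(** * Toeplitz operators on homogeneous polynomials *)

Section spans.
Context (C : pzRingType) (E : lmodType C).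

Lemma mem_lspan (G : set E) x : G x -> x \in lspan G.
Proof.
move=> Gx; apply/asboolP; exists 1%N, (fun=> 1), (fun=> x).
by split => //; rewrite big_ord1 scale1r.
Qed.

Lemma lspan_sub (G K : set E) : K 0 -> (forall c x y, K x -> K y -> K (c *: x + y)) ->
  G `<=` K -> forall x, x \in lspan G -> K x.
Proof.
move=> K0 Klin GK x /asboolP[s [c [g [Gg ->]]]].
apply: big_ind => // [y z Ky Kz|i _]; last by have := Klin (c i) _ _ (GK _ (Gg i)) K0; rewrite addr0.
by have := Klin 1 y z Ky Kz; rewrite scale1r.
Qed.

End spans.

(** * Orthogonality of different weights *)

Section rotation_orthogonality.
Context (R : realType) (n : nat) (lambda : R).
Hypothesis l1 : -1 < lambda.
Local Notation C := R[i].
Local Notation Cn := 'cV[C]_n.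
Local Notation A2 := (bergman n lambda).
Local Notation L2 := (@L2 R n lambda).
Local Notation inner := (@inner R n lambda).
Local Notation dot := (@bergman_inner R n lambda).
Local Notation mono := (@mono R n lambda).
Implicit Types (f g : A2) (F G : Cn -> C) (z : Cn) (a b : 'I_n -> nat) (t : 'I_n -> C).

(** The rotation preserves the inner product and also multiplies it by u conj(v). The relation for F
    holds only almost everywhere, as invariance of symbols does. *)
Lemma inner_rotation0 t F G (u v : C) : (forall i, normc (t i) = 1) -> L2 F -> L2 G ->
  ae_ball (fun z => F (diagact t z) = u * F z) ->
  (forall z, unit_ball z -> G (diagact t z) = v * G z) ->
  u * v^*%C != 1 -> inner F G = 0.
Proof.
move=> t1 LF LG Fu Gv uv.
have Z (c : C) F' G' : L2 F' -> L2 G' -> inner (fun z => c * F' z) G' = c * inner F' G'.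
  move=> LF' LG'; have L0 : L2 (0 : Cn -> C) by have [] := bergmanP (0 : A2).
  have := inner_linear c LF' L0 LG'; rewrite addr0 => ->.
  have := inner_linear 1 L0 L0 LG'; rewrite scaler0 addr0 mul1r => /eqP.
  by rewrite -[X in X == _]addr0 (inj_eq (addrI _)) eq_sym => /eqP ->; rewrite addr0.
have cM (x y : C) : (x * y)^*%C = x^*%C * y^*%C by exact: rmorphM.
have LZ (c : C) F' : L2 F' -> L2 (fun z => c * F' z).
  move=> LF'; have L0 : L2 (0 : Cn -> C) by have [] := bergmanP (0 : A2).
  by have := L2_lin c LF' L0; rewrite addr0.
have := inner_diagact lambda t1 LF.1 LG.1.
rewrite (@inner_ae _ _ _ (F \o diagact t) (fun z => u * F z))//; first last.
- exact: ball_measurable_diagact LG.1.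
- exact: (LZ u F LF).1.
- exact: ball_measurable_diagact LF.1.
rewrite (inner_eq lambda (fun z _ => erefl) Gv) Z//; last exact: LZ.
rewrite (inner_conj (LZ v G LG) LF) Z// cM -(inner_conj LG LF) mulrA => /eqP.
rewrite -{2}[inner F G]mul1r -subr_eq0 -mulrBl mulf_eq0 subr_eq0 (negbTE uv).
by move=> /eqP.
Qed.

(** With d = |p - q|, a root c of c ^ d = -1 makes the product equal to -1. *)
Lemma unit_separates (p q : nat) : p <> q -> exists2 c : C, normc c = 1 & c ^+ p * (c ^+ q)^*%C != 1.
Proof.
move=> pq; have cc (c : C) k : normc c = 1 -> c ^+ k * (c ^+ k)^*%C = 1.
  by move=> c1; rewrite mulcJ sqabsE normcX c1 !expr1n.
have n11 : -1 != 1 :> C by rewrite eqNr oner_eq0.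
have flip (d : nat) : (0 < d)%N -> exists2 c : C, normc c = 1 & c ^+ d = -1.
  move=> d0; exists (cis (pi / d%:R)); first exact: normc_cis.
  by rewrite -cisM -cispi; congr cis; rewrite -[_ *+ d]mulr_natr divfK// pnatr_eq0 -lt0n.
have [lt|lt|/pq[]] := ltngtP p q.
  have [c c1 cd] := flip (q - p)%N (etrans (subn_gt0 _ _) lt).
  exists c => //; rewrite -(subnK (ltnW lt)) exprD cd rmorphM rmorphN rmorph1.
  by rewrite mulN1r mulrN cc.
have [c c1 cd] := flip (p - q)%N (etrans (subn_gt0 _ _) lt).
by exists c => //; rewrite -(subnK (ltnW lt)) exprD cd mulN1r mulNr cc.
Qed.

Lemma mono_orth a b : (exists i, a i <> b i) -> dot (mono a) (mono b) = 0.
Proof.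
move=> [i /unit_separates[c c1 cab]].
have t1 := normc_coord_scale i c1.
have E d z : unit_ball z -> mono d (diagact (coord_scale i c) z) = c ^+ d i * mono d z.
  by move=> _; rewrite -rotE// rot_coord_mono// bergmanZ.
apply: (inner_rotation0 t1 (bergman_L2 _) (bergman_L2 _) _ (E b) cab).
by apply: aeW => t Bt; exact: E.
Qed.

Lemma eq_mono a b : a =1 b -> mono a = mono b.
Proof. by move=> /funext ->. Qed.

End rotation_orthogonality.

Lemma ae_ballS (R : realType) n (P Q : 'cV[R[i]]_n -> Prop) :
  (forall z, unit_ball z -> P z -> Q z) -> ae_ball P -> ae_ball Q.
Proof. by move=> PQ; apply: negligibleS => t /= nQ PB; apply: nQ => Bt; exact: PQ (PB Bt). Qed.

(** * The spaces P_kappa attached to the partition *)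

Section blocks.
Context (R : realType) (m : nat) (k : 'I_m -> nat) (lambda : R).
Hypothesis l1 : -1 < lambda.
Local Notation C := R[i].
Local Notation n := (\sum_j k j)%N.
Local Notation Cn := 'cV[C]_n.
Local Notation A2 := (bergman n lambda).
Local Notation dot := (@bergman_inner R n lambda).
Local Notation bergman_rot := (@bergman_rot R n lambda).
Local Notation mono := (@mono R n lambda).
Local Notation blk := (@tagnat.sig1 m k).
Implicit Types (f g p q : A2) (z : Cn) (a b : 'I_n -> nat) (kappa : 'I_m -> nat).

Definition degree a (j : 'I_m) : nat := (\sum_i a (tagnat.Rank j i))%N.

Lemma block_degreeE (alpha : 'cV[nat]_n) j :
  block_degree alpha j = degree (fun i => alpha i 0) j.
Proof. by apply: eq_bigr => i _; rewrite mxE. Qed.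

Lemma le_degree a i : (a i <= degree a (blk i))%N.
Proof. by rewrite /degree (bigD1 (tagnat.sig2 i))//= tagnat.sig2K leq_addr. Qed.

Lemma prod_block (t : 'I_m -> C) a :
  \prod_i t (blk i) ^+ a i = \prod_j t j ^+ degree a j.
Proof.
rewrite (reindex _ tagnat.rank_bij_on)/=.
under [RHS]eq_bigr => j _ do rewrite expr_sum.
rewrite [RHS](@sig_big_dep _ _ _ _ (fun j => 'I_(k j)) xpredT (fun _ => xpredT)
  (fun j i => t j ^+ a (tagnat.Rank j i)))/=.
by apply: eq_bigr => -[j i] _; rewrite tagnat.rankE tagnat.Rank1K.
Qed.

(** All of kappa j is put on the first coordinate of block j, which exists because blocks are
    nonempty. *)
Lemma degree_exists kappa : (forall j, (0 < k j)%N) -> exists a, degree a =1 kappa.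
Proof.
move=> k0; exists (fun i => if (tagnat.sig2 i == 0 :> nat)%N then kappa (blk i) else 0%N).
move=> j; have v i : tagnat.sig2 (tagnat.Rank j i) = i :> nat by rewrite tagnat.Rank2K.
rewrite /degree; under eq_bigr => i _ do rewrite v tagnat.Rank1K.
by rewrite (bigD1 (Ordinal (k0 j)))//= big1 ?addn0// => i; rewrite -val_eqE /= => /negbTE ->.
Qed.

Lemma torus_action (t : 'I_m -> C) z :
  \mxdiag_j (t j)%:M *m z = diagact (fun i => t (blk i)) z.
Proof.
rewrite -{1}(submxcolK z) mul_mxdiag_mxcol; apply/matrixP => i o.
by rewrite mxE mul_scalar_mx !mxE tagnat.sig2K ord1.
Qed.

Definition homogeneous kappa : set A2 := [set p | p \in lspan (@block_monomials R m k lambda kappa)].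

Lemma block_monomialsE kappa f : @block_monomials R m k lambda kappa f <->
  exists2 a, degree a =1 kappa & f = mono a.
Proof.
split=> [[alpha Ha fa]|[a Ha ->]].
  exists (fun i => alpha i 0); first by move=> j; rewrite -block_degreeE.
  by apply: bergman_eq => z Bz; rewrite fa// monoE.
exists (\col_i a i).
  by move=> j; rewrite block_degreeE -(Ha j); apply: eq_bigr => i _; rewrite mxE.
by move=> z Bz; rewrite monoE//; apply: eq_bigr => i _; rewrite mxE.
Qed.

Lemma homogeneous_mono kappa a : degree a =1 kappa -> homogeneous kappa (mono a).
Proof. by move=> Ha; apply: mem_lspan; apply/block_monomialsE; exists a. Qed.

Lemma homogeneous_perp kappa p b : homogeneous kappa p -> (exists j, degree b j <> kappa j) ->
  dot p (mono b) = 0.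
Proof.
move=> hp [j bj]; have ip := bergman_ip n l1; apply: (lspan_sub (K := [set x : A2 | dot x (mono b) = 0]) _ _ _ hp).
- by rewrite /mkset (dot0l ip).
- by move=> c x y x0 y0; rewrite /mkset (dot_lin ip) x0 y0 mulr0 addr0.
- move=> f /block_monomialsE[a Ha ->]; rewrite /mkset; apply: mono_orth => //.
  apply: contrapT => /forallNP ab; apply: bj; rewrite -Ha; apply: eq_bigr => i _.
  by apply/esym; apply: contrapT; exact: ab.
Qed.

(** Exponents of block degree kappa are bounded by the largest kappa j, so they can be enumerated
    among finitely many functions. *)
Lemma homogeneous_basis kappa : exists N (alpha : 'I_N -> 'I_n -> nat),
  [/\ forall s, degree (alpha s) =1 kappa,
      forall s t, s <> t -> exists i, alpha s i <> alpha t i &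
      forall a, degree a =1 kappa -> exists s, a =1 alpha s].
Proof.
pose B := (\max_j kappa j)%N.
pose val_of (u : {ffun 'I_n -> 'I_B.+1}) : 'I_n -> nat := fun i => u i.
pose D := [set u | [forall j, degree (val_of u) j == kappa j]]%SET.
exists #|D|, (fun s => val_of (enum_val s)); split.
- by move=> s j; have := enum_valP s; rewrite inE => /forallP/(_ j)/eqP.
- move=> s t st; apply: contrapT => /forallNP H; apply: st; apply: enum_val_inj.
  by apply/ffunP => i; apply: val_inj; by apply: contrapT; exact: H.
- move=> a Ha; have aB i : (a i < B.+1)%N.
    by rewrite ltnS (leq_trans (le_degree a i))// Ha; exact: leq_bigmax.
  pose u := [ffun i => Ordinal (aB i)].
  have ua : val_of u =1 a by move=> i; rewrite /val_of ffunE.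
  have uD : u \in D.
    rewrite inE; apply/forallP => j; rewrite -Ha; apply/eqP.
    by apply: eq_bigr => i _; rewrite ua.
  by exists (enum_rank_in uD u) => i; rewrite enum_rankK_in.
Qed.

(** The difference between p and its expansion in the finitely many monomials of degree kappa is
    orthogonal to every monomial, hence 0 by totality. Membership in a span becomes a family of
    orthogonality relations, whence [homogeneous_biorth]. *)
Lemma homogeneousP kappa p : homogeneous kappa p <->
  forall b, (exists j, degree b j <> kappa j) -> dot p (mono b) = 0.
Proof.
split=> [hp b|H]; first exact: homogeneous_perp.
have ip := bergman_ip n l1.
have [N [alpha [Ha Hi Hs]]] := homogeneous_basis kappa.
pose e s := mono (alpha s).
have ee s t : dot (e s) (e t) = if s == t then (nsq dot (e t))%:C%C else 0.
  case: eqP => [->|st]; first exact: dot_self ip _.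
  exact/mono_orth/Hi.
pose q := \sum_s (dot p (e s) / (nsq dot (e s))%:C%C) *: e s.
have hq : homogeneous kappa q.
  by apply: rpred_sum => s _; apply: rpredZ; exact: homogeneous_mono.
have n0 s : (nsq dot (e s))%:C%C != 0 :> C.
  apply/eqP => /(congr1 (@complex.Re R)) /= /(dot_definite ip); exact: mono_neq0.
have qe s : dot q (e s) = dot p (e s).
  rewrite (dot_suml ip) (bigD1 s)//= (dotZl ip) ee eqxx divfK// [X in _ + X]big1 ?addr0// => t ts.
  by rewrite (dotZl ip) ee (negbTE ts) mulr0.
suff -> : p = q by [].
apply/eqP; rewrite -subr_eq0; apply/eqP; apply: (bergman_total l1) => a.
rewrite (dotBl ip); have [/Hs[s /eq_mono ->]|ak] := pselect (degree a =1 kappa).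
  by rewrite qe subrr.
have /existsNP[j aj] : ~ forall j, degree a j = kappa j by [].
by rewrite H ?(homogeneous_perp hq) ?subr0//; exists j.
Qed.

Lemma homogeneous_biorth kappa p :
  (forall y, (forall q, homogeneous kappa q -> dot q y = 0) -> dot p y = 0) ->
  homogeneous kappa p.
Proof.
move=> H; apply/homogeneousP => b Hb; apply: H => q hq.
exact: homogeneous_perp hq Hb.
Qed.

Lemma homogeneous_rot (t : 'I_m -> C) kappa p : (forall j, normc (t j) = 1) ->
  homogeneous kappa p ->
  bergman_rot (fun i => t (blk i)) p = (\prod_j t j ^+ kappa j) *: p.
Proof.
move=> t1 hp; have tb1 i : normc (t (blk i)) = 1 by [].
apply: (lspan_sub (K := [set x : A2 | bergman_rot (fun i => t (blk i)) x =
  (\prod_j t j ^+ kappa j) *: x]) _ _ _ hp).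
- by rewrite /mkset scaler0; apply: bergman_eq => z _; rewrite rotE.
- move=> c x y hx hy; rewrite /mkset rot_lin// hx hy scalerDr !scalerA; congr (_ *: _ + _).
  exact: mulrC.
- move=> f /block_monomialsE[a Ha ->]; rewrite /mkset rot_mono// prod_block.
  by congr (_ *: _); apply: eq_bigr => j _; rewrite Ha.
Qed.

Lemma invariant_diagact s (t : 'I_m -> C) : invariant_symbol (block_torus R k) s ->
  (forall j, normc (t j) = 1) -> ae_ball (fun z => s (diagact (fun i => t (blk i)) z) = s z).
Proof.
move=> [_ Hs] t1; have := Hs (\mxdiag_j (t j)%:M).
have tt : block_torus R k (\mxdiag_j (t j)%:M).
  by exists t => // j; rewrite normc_norm t1.
move=> /(_ tt); congr (ae_ball _); apply/funext => z.
by rewrite torus_action.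
Qed.

Lemma projects_homogeneous s kappa p g : invariant_symbol (block_torus R k) s ->
  homogeneous kappa p -> bergman_projects (fun z => s z * p z) g -> homogeneous kappa g.
Proof.
move=> invs hp; have Lp := L2_mul_Linfty invs.1 (bergman_L2 p).
move=> /(bergman_projectsP g Lp) Hg; apply/homogeneousP => b [j bj].
rewrite -Hg; have [c c1 cb] := unit_separates R (nesym bj).
(* Only the block whose degree differs is rotated. *)
pose t j' := if j' == j then c else 1 : C.
have t1 j' : normc (t j') = 1.
  by rewrite /t; case: ifP => // _; rewrite ComplexField.Normc.normc1.
have tE (d : 'I_m -> nat) : \prod_j' t j' ^+ d j' = c ^+ d j.
  rewrite (bigD1 j)//= /t eqxx big1 ?mulr1// => j' /negbTE ->.
  by rewrite expr1n.
have tb1 i : normc (t (blk i)) = 1 by [].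
apply: (inner_rotation0 tb1 Lp (bergman_L2 _) _ _ cb) => [|z _].
  have := invariant_diagact invs t1; apply: ae_ballS => z Bz sz.
  have pz : p (diagact (fun i => t (blk i)) z) = c ^+ kappa j * p z.
    by rewrite -rotE// (homogeneous_rot t1 hp) bergmanZ tE.
  by rewrite sz pz mulrCA.
by rewrite -rotE// rot_mono// bergmanZ prod_block tE.
Qed.

End blocks.

Lemma sqnorm_segment (R : realType) n (x y : 'cV[R[i]]_n) (t : R) : 0 <= t <= 1 ->
  sqnorm (x + t%:C%C *: (y - x)) <= (1 - t) * sqnorm x + t * sqnorm y.
Proof.
move=> /andP[t0 t1]; rewrite /sqnorm !mulr_sumr -big_split ler_sum// => i _.
rewrite !mxE /=; case: (x i 0) (y i 0) => [a b] [c d]; rewrite /sqabs /= -subr_ge0.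
rewrite (_ : _ - _ = t * (1 - t) * ((a - c) ^+ 2 + (b - d) ^+ 2)); last by ring.
by rewrite mulr_ge0 ?addr_ge0 ?sqr_ge0// mulr_ge0// subr_ge0.
Qed.

Lemma unit_ball_segment (R : realType) n (x y : 'cV[R[i]]_n) (t : R) : 0 <= t <= 1 ->
  unit_ball x -> unit_ball y -> unit_ball (x + t%:C%C *: (y - x)).
Proof.
move=> t01; have := sqnorm_segment x y t01; case/andP: t01; rewrite /unit_ball /=.
move: (sqnorm _) (sqnorm x) (sqnorm y) => s a b t0 t1 h a1 b1.
apply: (le_lt_trans h); have [->|tn] := eqVneq t 0; first by rewrite subr0 mul1r mul0r addr0.
have tp : 0 < t by rewrite lt_neqAle eq_sym tn.
have h1 : (1 - t) * a <= (1 - t) by rewrite ler_piMr ?subr_ge0// ltW.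
have h2 : t * b < t by rewrite gtr_pMr.
by lra.
Qed.

(** The [size P] points l / N in [0, 1] are one more than the degree of P. *)
Lemma poly_nonroot (R : realType) (P : {poly R[i]}) : P != 0 ->
  exists2 t : R, 0 <= t <= 1 & P.[t%:C%C] != 0.
Proof.
move=> P0; apply: contrapT => H.
pose N := size P; have N0 : (0 < N)%N by rewrite size_poly_gt0.
pose rs := [seq (l%:R / N%:R : R)%:C%C | l <- iota 0 N].
have : (size rs < size P)%N.
  apply: max_poly_roots => //.
    apply/allP => x /mapP[l]; rewrite mem_iota add0n => /andP[_ lN] ->.
    apply/rootP; apply: contrapT => /eqP Pl; apply: H.
    exists (l%:R / N%:R) => //; rewrite divr_ge0 ?ler0n//= ler_pdivrMr ?ltr0n// mul1r.
    by rewrite ler_nat ltnW.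
  rewrite map_inj_uniq ?iota_uniq// => l l' [] /(mulIf _) E; apply/eqP.
  by rewrite -(eqr_nat R) E// invr_eq0 pnatr_eq0 -lt0n.
by rewrite size_map size_iota ltnn.
Qed.

(** * The Toeplitz algebra acts on every P_kappa *)

Section toeplitz_representation.
Context (R : realType) (m : nat) (k : 'I_m -> nat) (lambda : R).
Hypothesis l1 : -1 < lambda.
Local Notation C := R[i].
Local Notation n := (\sum_j k j)%N.
Local Notation Cn := 'cV[C]_n.
Local Notation A2 := (bergman n lambda).
Local Notation inner := (@inner R n lambda).
Local Notation sqn := (@sqn R n lambda).
Local Notation dot := (@bergman_inner R n lambda).
Local Notation homogeneous := (@homogeneous R m k lambda).
Local Notation algebra := (toeplitz_algebra lambda (block_torus R k)).
Local Notation ip := (bergman_ip n l1).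
Implicit Types (f g p q w : A2) (z : Cn) (a b : 'I_n -> nat) (kappa : 'I_m -> nat).

Lemma invariant_conj (s : Cn -> C) : invariant_symbol (block_torus R k) s ->
  invariant_symbol (block_torus R k) (fun z => (s z)^*%C).
Proof.
move=> [[ms [M sM]] Hs]; split; first split.
- exact: ball_measurable_conj.
- exists M; apply: ae_ballS sM => z _; by rewrite !normc_norm normcJE.
- by move=> A /Hs; apply: ae_ballS => z _ ->.
Qed.

(** Factors may be moved, conjugated, from one argument to the other, whatever the integrability of
    the pieces. *)
Lemma inner_prod_eq (F G F' G' : Cn -> C) :
  (forall z, unit_ball z -> F z * (G z)^*%C = F' z * (G' z)^*%C) -> inner F G = inner F' G'.
Proof.
by move=> E; rewrite !innerE; congr Complex; apply: eq_Rintegral => t; rewrite inE => Bt; rewrite E.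
Qed.

(** For the orthogonal complement, the symbol is moved to the other side: <p, S y> = <g, y> with g
    the projection of conj(s) p. The conjugate symbol is again invariant, so g lies in P_kappa. *)
Lemma toeplitz_reducing s S : invariant_symbol (block_torus R k) s -> is_toeplitz s S ->
  reducing dot homogeneous S.
Proof.
move=> invs HS; split; first exact: toeplitz_bounded invs.1 HS.
move=> kappa; split => [p hp|].
  exact: projects_homogeneous invs hp (HS p).
suff H (y p : A2) : orth dot homogeneous kappa y -> homogeneous kappa p -> dot p (S y) = 0.
  by move=> y oy p; exact: H.
move=> oy hp.
have invc := invariant_conj invs.
have Lc := L2_mul_Linfty invc.1 (bergman_L2 p).
have [g Hg] := projection_exists l1 Lc.
have hg := projects_homogeneous l1 invc hp Hg.
have Ls := L2_mul_Linfty invs.1 (bergman_L2 y).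
rewrite (dot_conj ip) (toeplitz_dot y p invs.1 HS).
have -> : inner (fun z => s z * y z) p = inner y (fun z => (s z)^*%C * p z).
  apply: inner_prod_eq => z _; rewrite rmorphM /= conjcK; ring.
rewrite (inner_conj Lc (bergman_L2 y)) conjcK.
by have /(bergman_projectsP g Lc) -> := Hg; exact: oy.
Qed.

Lemma toeplitz_algebra_reducing : algebra `<=` reducing dot homogeneous.
Proof.
apply: smallest_sub; first by apply: reducing_cstar => //; [exact: ip|exact: homogeneous_biorth].
by move=> S [s invs HS]; exact: toeplitz_reducing HS.
Qed.

Lemma toeplitz_mem s S : invariant_symbol (block_torus R k) s -> is_toeplitz s S -> algebra S.
Proof. by move=> invs HS; apply: sub_gen_smallest; exists s. Qed.

Lemma homogeneous_bounded kappa p : homogeneous kappa p ->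
  exists M : R, forall z, unit_ball z -> normc (p z) <= M.
Proof.
move=> hp; apply: (lspan_sub (K := [set x : A2 | exists M : R,
  forall z, unit_ball z -> normc ((x : A2) z) <= M]) _ _ _ hp).
- by exists 0 => z _; rewrite [X in normc X](_ : _ = 0)// ComplexField.Normc.normc0.
- move=> c x y [M HM] [N HN]; exists (normc c * M + N) => z Bz.
  have -> : (c *: x + y : A2) z = c * (x : A2) z + (y : A2) z by [].
  by rewrite (le_trans (normcD _ _))// normcM lerD ?HN// ler_wpM2l ?normc_ge0// HM.
- move=> f /(block_monomialsE l1)[a _ ->]; exists 1 => z Bz.
  by rewrite monoE// normc_monomial_le1.
Qed.

Lemma homogeneous_Linfty kappa p : homogeneous kappa p -> Linfty p.
Proof.
move=> /homogeneous_bounded[M HM]; split; first exact: (bergman_L2 p).1.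
by exists M; apply: aeW => t Bt; rewrite normc_norm lecR HM.
Qed.

Lemma Linfty_conjM (F G : Cn -> C) : Linfty F -> Linfty G -> Linfty (fun z => (F z)^*%C * G z).
Proof.
move=> [mF [M FM]] [mG [N GN]]; split.
  by apply: ball_measurableM => //; exact: ball_measurable_conj.
exists (M * N); apply: negligibleS (negligibleU FM GN) => t /= H.
apply: contrapT => /not_orP[/contrapT h1 /contrapT h2]; apply: H => Bt.
have := h1 Bt; have := h2 Bt; rewrite !normc_norm !lecR normcM normcJE => ? ?.
by rewrite mulrC [leRHS]mulrC ler_pM ?normc_ge0.
Qed.

Lemma product_symbol_invariant kappa p q : homogeneous kappa p -> homogeneous kappa q ->
  invariant_symbol (block_torus R k) (fun z => (p z)^*%C * q z).
Proof.
move=> hp hq; split; first by apply: Linfty_conjM; apply: homogeneous_Linfty; eassumption.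
move=> _ [t t1 <-]; have t1' j : normc (t j) = 1.
  by have /(congr1 (@complex.Re R)) := t1 j; rewrite normc_norm.
apply: aeW => x Bx; rewrite torus_action.
rewrite -!rotE ?(homogeneous_rot l1 t1' hp) ?(homogeneous_rot l1 t1' hq)//.
rewrite !bergmanZ; set u := \prod_j _; have u1 : u * u^*%C = 1.
  rewrite mulcJ sqabsE (_ : normc u = 1) ?expr1n// /u normc_prod big1// => j _.
  by rewrite normcX t1' expr1n.
rewrite rmorphM /= mulrACA [_^*%C * u]mulrC u1 mul1r//.
Qed.

Lemma homogeneous_poly kappa p : homogeneous kappa p -> forall z h : Cn, exists P : {poly C},
  forall c : C, unit_ball (z + c *: h) -> p (z + c *: h) = P.[c].
Proof.
move=> hp; apply: (lspan_sub (K := [set x : A2 | forall z h : Cn, exists P : {poly C},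
  forall c : C, unit_ball (z + c *: h) -> (x : A2) (z + c *: h) = P.[c]]) _ _ _ hp).
- by move=> z h; exists 0 => c _; rewrite horner0.
- move=> d x y Hx Hy z h; have [P HP] := Hx z h; have [Q HQ] := Hy z h.
  exists (d *: P + Q) => c Bc; rewrite hornerD hornerZ -HP// -HQ//.
- move=> f /(block_monomialsE l1)[a _ ->] z h.
  exists (\prod_i ((z i 0)%:P + h i 0 *: 'X) ^+ a i) => c Bc.
  rewrite monoE// horner_prod; apply: eq_bigr => i _.
  by rewrite horner_exp hornerD hornerC hornerZ hornerX !mxE mulrC.
Qed.

(* On a segment in the ball homogeneous elements are polynomials in one variable,
   and the integral domain {poly C} has no zero divisors. *)
Lemma homogeneous_mul_eq0 kappa kappa' p q : homogeneous kappa p -> homogeneous kappa' q ->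
  sqn (fun z => p z * q z) = 0 -> p = 0 \/ q = 0.
Proof.
move=> hp hq pq0; have [_ dp p0] := bergmanP p; have [_ dq q0] := bergmanP q.
have [f fE] : exists f : A2, (f : Cn -> C) = (fun z => p z * q z).
  apply: bergman_val; first exact: L2_mul_Linfty (homogeneous_Linfty hp) (bergman_L2 q).
  - by move=> z Bz; apply: differentiable_fun_mul; [exact: dp|exact: dq].
  - by move=> z Bz; rewrite p0// mul0r.
have f0 : f = 0 by apply: (bergman_sqn0 l1); rewrite fE.
have pqz z : p z * q z = 0.
  by have := congr1 (fun F : Cn -> C => F z) fE; rewrite f0.
apply: contrapT => /not_orP[pn qn].
have nz (x : A2) : x <> 0 -> exists2 z, unit_ball z & x z <> 0.
  move=> x0; apply: contrapT => H; apply: x0; apply: bergman_eq => z Bz.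
  by apply: contrapT => xz; apply: H; exists z.
have [z1 B1 pz1] := nz p pn; have [z2 B2 qz2] := nz q qn.
have [P HP] := homogeneous_poly hp z1 (z2 - z1).
have [Q HQ] := homogeneous_poly hq z1 (z2 - z1).
have P0 : P != 0.
  apply/eqP => P0; apply: pz1; have := HP 0.
  by rewrite scale0r addr0 P0 horner0; apply.
have Q0 : Q != 0.
  apply/eqP => Q0; apply: qz2; have := HQ 1.
  by rewrite scale1r addrC subrK Q0 horner0; apply.
have [t t01] := poly_nonroot (mulf_neq0 P0 Q0).
have Bt := unit_ball_segment t01 B1 B2.
by rewrite hornerM -HP// -HQ// pqz eqxx.
Qed.

End toeplitz_representation.

(** * Irreducibility and noncommutativity *)

Section irreducibility.
Context (R : realType) (m : nat) (k : 'I_m -> nat) (lambda : R).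
Hypothesis l1 : -1 < lambda.
Local Notation C := R[i].
Local Notation n := (\sum_j k j)%N.
Local Notation Cn := 'cV[C]_n.
Local Notation A2 := (bergman n lambda).
Local Notation inner := (@inner R n lambda).
Local Notation sqn := (@sqn R n lambda).
Local Notation dot := (@bergman_inner R n lambda).
Local Notation mono := (@mono R n lambda).
Local Notation blk := (@tagnat.sig1 m k).
Local Notation homogeneous := (@homogeneous R m k lambda).
Local Notation algebra := (toeplitz_algebra lambda (block_torus R k)).
Local Notation ip := (bergman_ip n l1).
Implicit Types (f g p q w h : A2) (z : Cn) (a b : 'I_n -> nat).

Section fixed_degree.
Variable kappa : 'I_m -> nat.
Local Notation P := (homog_poly k lambda kappa).
Local Notation restrict := (restrict_homog k lambda kappa).
Implicit Types (u v x y : P).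

Lemma homog_polyP u : homogeneous kappa u.
Proof. exact: (valP u). Qed.

Lemma restrictE (S : A2 -> A2) u : reducing dot homogeneous S -> restrict S u = S u :> A2.
Proof.
move=> [_ /(_ kappa)[Su _]]; have {}Su := Su (u : A2) (homog_polyP u).
by rewrite /restrict_homog /homog_bergman -/(\val _) insubdK.
Qed.

Lemma homog_poly_eq u v : (u : A2) = v -> u = v.
Proof. exact: val_inj. Qed.

Lemma homog_poly_lin (c : C) u v : (c *: u + v : P) = c *: (u : A2) + (v : A2) :> A2.
Proof. by []. Qed.

Lemma restrict_star : star_representation dot (homog_inner k lambda kappa) algebra restrict.
Proof.
have red S : algebra S -> reducing dot homogeneous S by exact: toeplitz_algebra_reducing.
split.
- move=> S /red rS; have [[Slin [M SM]] _] := rS; split.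
    by move=> c x y; apply: homog_poly_eq; rewrite homog_poly_lin !restrictE// homog_poly_lin Slin.
  by exists M => x; have := SM (homog_bergman x); rewrite /hnorm /homog_inner restrictE.
- move=> c S S' /red rS /red rS'; apply/funext => x; apply: homog_poly_eq.
  rewrite homog_poly_lin !restrictE//.
  exact: (cstar_linear (reducing_cstar ip (@homogeneous_biorth _ _ _ _ l1))).
- move=> S S' /red rS /red rS'; apply/funext => x; apply: homog_poly_eq.
  rewrite /= !restrictE//.
  exact: (cstar_comp (reducing_cstar ip (@homogeneous_biorth _ _ _ _ l1))).
- by move=> S S' /red rS /red rS' SS' x y; rewrite /homog_inner !restrictE.
Qed.

Lemma homog_poly_total x y : (forall a, degree a =1 kappa -> dot x (mono a) = dot y (mono a)) ->
  x = y.
Proof.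
move=> H; apply: homog_poly_eq; apply/eqP; rewrite -subr_eq0; apply/eqP.
apply: (bergman_total l1) => a; rewrite (dotBl ip).
have [ak|ak] := pselect (degree a =1 kappa); first by rewrite H// subrr.
have /existsNP[j aj] : ~ forall j, degree a j = kappa j by [].
by rewrite !(homogeneous_perp l1 (homog_polyP _)) ?subrr//; exists j.
Qed.

(** Multiplication by |w| ^ 2 is self-adjoint, so g is the projection of |w| ^ 2 h. In the form <q,
    g> the pairing expands directly over a sum q. *)
Lemma mul_sq_adjoint w h : Linfty w -> exists g, forall q,
  inner (fun z => (w z)^*%C * q z * w z) h = dot q g.
Proof.
move=> Lw; have Lh := L2_mul_Linfty (Linfty_conjM Lw Lw) (bergman_L2 h).
have [g /(bergman_projectsP g Lh) Hg] := projection_exists l1 Lh.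
exists g => q; rewrite (dot_conj ip) -Hg -(inner_conj Lh (bergman_L2 q)).
by apply: inner_prod_eq => z _; rewrite !rmorphM /= conjcK; ring.
Qed.

Lemma toeplitz_product w q : homogeneous kappa w -> homogeneous kappa q -> exists2 S,
  algebra S & forall f h, dot (S f) h = inner (fun z => (w z)^*%C * q z * f z) h.
Proof.
move=> hw hq; have inv := product_symbol_invariant l1 hw hq.
have [S HS] := toeplitz_exists l1 inv.1; exists S; first exact: toeplitz_mem HS.
by move=> f h; rewrite (toeplitz_dot f h inv.1 HS).
Qed.

Lemma inner_sq_mul w q : inner (fun z => (w z)^*%C * q z * w z) q =
  (sqn (fun z => w z * q z))%:C%C.
Proof.
by rewrite -inner_self; apply: inner_prod_eq => z _; rewrite !rmorphM /=; ring.
Qed.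

(** The injective map q |-> T_{conj(w) q} w is handled through the matrix of pairings of its values
    [y s] on the monomial basis with that same basis; invertibility of the matrix solves for any
    x. *)
Lemma invariant_subspace_full (W : set P) (w : P) : W 0 ->
  (forall (c : C) u v, W u -> W v -> W (c *: u + v)) ->
  (forall S v, algebra S -> W v -> W (restrict S v)) -> W w -> w <> 0 -> forall x, W x.
Proof.
move=> W0 Wlin Winv Ww w0 x; have hw := homog_polyP w.
have Lw := homogeneous_Linfty l1 hw.
have [N [alpha [Ha Hi Hs]]] := homogeneous_basis k kappa.
pose e s := mono (alpha s).
have he s : homogeneous kappa (e s) by exact: homogeneous_mono.
have /choice[y Hy] s : exists v : P, W v /\
    forall h, dot v h = inner (fun z => (homog_bergman w z)^*%C * e s z * homog_bergman w z) h.
  have [S AS HS] := toeplitz_product hw (he s).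
  exists (restrict S w); split; first exact: Winv.
  by move=> h; rewrite restrictE ?HS//; exact: toeplitz_algebra_reducing.
have sumW (c : 'I_N -> C) : exists2 v : P, W v & forall h, dot v h = \sum_s c s * dot (y s) h.
  elim: (index_enum 'I_N) => [|s r [v Wv Hv]].
    by exists 0 => // h; rewrite big_nil [LHS](dot0l ip).
  exists (c s *: y s + v); first by apply: Wlin => //; exact: (Hy s).1.
  by move=> h; rewrite homog_poly_lin (dot_lin ip) Hv big_cons.
pose G := \matrix_(s, t) dot (y s) (e t).
have uG : G \in unitmx.
  rewrite -row_free_unit; apply: inj_row_free => c cG.
  pose q : A2 := \sum_s c 0 s *: e s.
  have hq : homogeneous kappa q by apply: rpred_sum => s _; apply: rpredZ; exact: he.
  have Bq h : \sum_s c 0 s * dot (y s) h =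
      inner (fun z => (homog_bergman w z)^*%C * q z * homog_bergman w z) h.
    have [g Hg] := mul_sq_adjoint h Lw; rewrite Hg (dot_suml ip).
    by apply: eq_bigr => s _; rewrite (dotZl ip) (Hy s).2 Hg.
  (* c G = 0 makes the combination of the [y s] with coefficients c orthogonal to every [e t], hence
     to q; that pairing with q is |w q| ^ 2. *)
  have q0 : sqn (fun z => homog_bergman w z * q z) = 0.
    suff : (sqn (fun z => homog_bergman w z * q z))%:C%C = 0 :> C by case.
    rewrite -inner_sq_mul -Bq; have [v _ Hv] := sumW (c 0).
    rewrite -Hv (dot_conj ip) /q (dot_suml ip) [X in X^*%C]big1 ?conjc0// => t _.
    rewrite (dotZl ip) (dot_conj ip) Hv.
    have -> : \sum_s c 0 s * dot (y s) (e t) = (c *m G) 0 t.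
      by rewrite mxE; apply: eq_bigr => s _; rewrite mxE.
    by rewrite cG mxE conjc0 mulr0.
  have [w00|q00] := homogeneous_mul_eq0 l1 hw hq q0; first by case: w0; exact: homog_poly_eq.
  apply/rowP => t; rewrite mxE; have : dot q (e t) = 0 by rewrite q00 (dot0l ip).
  rewrite (dot_suml ip) (bigD1 t)//= [X in _ + X]big1 => [|s st].
    rewrite (dotZl ip) addr0 => /eqP; rewrite mulf_eq0 => /orP[/eqP//|/eqP].
    by move=> /(dot_self0 ip) /(mono_neq0 l1).
  rewrite (dotZl ip) mono_orth ?mulr0//; apply: Hi; exact/eqP.
(* These coefficients give an element of W with the same pairings as x against the basis, hence x
   itself. *)
pose c := (\row_t dot x (e t)) *m invmx G.
have cG : c *m G = \row_t dot x (e t) by rewrite mulmxKV.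
have [v Wv Hv] := sumW (c 0).
suff -> : x = v by [].
apply: homog_poly_total => a /Hs[t /eq_mono ->].
have := congr1 (fun M : 'rV_N => M 0 t) cG; rewrite /= [RHS]mxE => <-.
by rewrite Hv mxE; apply: eq_bigr => s _; rewrite [in LHS]/G [X in _ * X = _]mxE.
Qed.

Lemma restrict_irreducible : (forall j, (0 < k j)%N) ->
  irreducible_representation dot (homog_inner k lambda kappa) algebra restrict.
Proof.
move=> k0; split; first exact: restrict_star.
  have [a Ha] := degree_exists kappa k0.
  (* The symbol 1 supplies an operator acting as the identity, so the representation is nonzero. *)
  have inv1 : invariant_symbol (block_torus R k) (fun=> 1).
    split; last by move=> A _; exact: aeW.
    split; first by split; exact: measurable_cst.
    by exists 1; apply: aeW => t _; rewrite normr1.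
  have [S HS] := toeplitz_exists l1 inv1.1.
  have AS := toeplitz_mem inv1 HS.
  have hm : homogeneous kappa (mono a) by exact: homogeneous_mono.
  pose v : P := Subsp hm; exists S => //; exists v => Sv0.
  apply: (mono_neq0 l1 (a := a)); apply: (dot_self0 ip).
  have <- : dot (S (mono a)) (mono a) = dot (mono a) (mono a).
    rewrite (toeplitz_dot _ _ inv1.1 HS); apply: inner_eq => // z _; exact: mul1r.
  have -> : S (mono a) = restrict S v by rewrite restrictE//; exact: toeplitz_algebra_reducing.
  by rewrite Sv0 [LHS](dot0l ip).
move=> W W0 Wlin Winv.
have [[w [Ww w0]]|H] := pselect (exists x : P, W x /\ x <> 0).
  right; apply/seteqP; split => // x _.
  exact: (invariant_subspace_full W0 Wlin Winv Ww w0).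
left; apply/seteqP; split => [x Wx|_ -> //].
by apply: contrapT => x0; apply: H; exists x.
Qed.

End fixed_degree.

Lemma block_collision : (m < n)%N -> exists i i' : 'I_n, i <> i' /\ blk i = blk i'.
Proof.
move=> mn; apply: contrapT => H.
have inj : injective blk.
  by move=> i i' ii; apply: contrapT => ne; apply: H; exists i, i'.
by have := leq_card _ inj; rewrite !card_ord leqNgt mn.
Qed.

Lemma degree_unit i j : degree (fun l => (l == i)%N : nat) j = (blk i == j)%N.
Proof.
have [<-|ij] := eqVneq.
  rewrite /degree (bigD1 (tagnat.sig2 i))//= tagnat.sig2K eqxx big1 ?addn0// => l li.
  apply/eqP; rewrite eqb0; apply: contra li => /eqP E.
  apply/eqP; apply: ord_inj.
  by have := congr1 (fun x => tagnat.sig2 x : nat) E; rewrite tagnat.Rank2K /= => <-.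
rewrite /degree big1// => l _; apply/eqP; rewrite eqb0; apply: contra ij => /eqP <-.
by rewrite tagnat.Rank1K.
Qed.

Lemma toeplitz_noncommutative : (m < n)%N ->
  exists S S', [/\ algebra S, algebra S' & S \o S' <> S' \o S].
Proof.
move=> /block_collision[i [i' [ii' bii']]].
pose p := mono (fun l => (l == i)%N : nat); pose q := mono (fun l => (l == i')%N : nat).
pose kappa j : nat := (blk i == j)%N.
have hp : homogeneous kappa p.
  by apply: (homogeneous_mono l1) => j; rewrite degree_unit.
have hq : homogeneous kappa q.
  by apply: (homogeneous_mono l1) => j; rewrite degree_unit /kappa bii'.
have p0 : p <> 0 by exact: mono_neq0.
have q0 : q <> 0 by exact: mono_neq0.
have Lp := homogeneous_Linfty l1 hp; have Lq := homogeneous_Linfty l1 hq.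
have [S AS HS] := toeplitz_product hp hq.
have [S' AS' HS'] := toeplitz_product hq hp.
exists S, S'; split => // SS'.
have S'p : S' p = 0.
  apply: (bergman_total l1) => b; rewrite HS'.
  (* Rotating coordinate i' by c multiplies conj(q) p p by conj(c) and the monomial b by c ^ (b i').
     The pairing is thus scaled by conj(c ^ (b i' + 1)); the exponent is positive for every b, so
     some c makes this differ from 1. *)
  have [c c1 cb] := @unit_separates R 0%N (b i').+1 (@O_S _).
  have t1 := normc_coord_scale i' c1.
  have LF := L2_mul_Linfty (Linfty_conjM Lq Lp) (bergman_L2 p).
  apply: (inner_rotation0 (u := c^*%C) (v := c ^+ b i') t1 LF (bergman_L2 _)).
  - apply: aeW => x _; rewrite -!rotE// !rot_coord_mono// !bergmanZ eqxx.
    have -> : (i' == i) = false by apply/eqP => /esym.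
    by rewrite expr1 expr0 !mul1r rmorphM /= !mulrA.
  - by move=> z _; rewrite -rotE// rot_coord_mono// bergmanZ.
  - by move: cb; rewrite expr0 mul1r exprS rmorphM.
have S0 : S 0 = 0.
  have [[lS _] _] := toeplitz_algebra_reducing l1 AS.
  by have := lS (-1) 0 0; rewrite scaler0 addr0 scaleN1r addNr.
have Sp0 : S p = 0.
  apply: (dot_self0 ip).
  have <- : dot (S' (S p)) p = 0.
    by rewrite -[S' (S p)]/((S' \o S) p) -SS' /= S'p S0 (dot0l ip).
  have Lpq := L2_mul_Linfty (Linfty_conjM Lp Lq) (bergman_L2 p).
  rewrite HS' (dot_conj ip) HS -(inner_conj Lpq (bergman_L2 _)).
  by apply: inner_prod_eq => z _; rewrite !rmorphM /= conjcK; ring.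
have pq0 : sqn (fun z => p z * q z) = 0.
  suff : (sqn (fun z => p z * q z))%:C%C = 0 :> C by case.
  by rewrite -inner_sq_mul -HS Sp0 (dot0l ip).
by have [] := homogeneous_mul_eq0 l1 hp hq pq0.
Qed.

End irreducibility.

(** The clause on [restrict_homog] records that its default value is never taken on the algebra, so
    that it is the genuine restriction; it holds because the algebra is contained in [reducing]. *)
Theorem corollary5p1 (R : realType) (m : nat) (k : 'I_m -> nat)
    (m_gt0 : (0 < m)%N) (k_gt0 : forall j : 'I_m, (0 < k j)%N) :
  (forall (lambda : R) (kappa : 'I_m -> nat), -1 < lambda ->
    (forall T, toeplitz_algebra lambda (block_torus R k) T ->
     forall p : homog_poly k lambda kappa,
       restrict_homog k lambda kappa T p = T p :> bergman (\sum_j k j) lambda) /\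
    irreducible_representation
      (bergman_inner lambda)
      (homog_inner k lambda kappa)
      (toeplitz_algebra lambda (block_torus R k))
      (restrict_homog k lambda kappa)) /\
  ((m < \sum_j k j)%N ->
    forall lambda : R, -1 < lambda ->
    exists S T, [/\ toeplitz_algebra lambda (block_torus R k) S,
                    toeplitz_algebra lambda (block_torus R k) T &
                    S \o T <> T \o S]).
Proof.
split=> [lambda kappa l1|mn lambda l1]; last exact: toeplitz_noncommutative.
split=> [T AT p|]; last exact: restrict_irreducible.
by apply: restrictE; exact: toeplitz_algebra_reducing.
Qed.
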